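(* Let $X$ be a real Banach space, $A\subset X$ open, and $\mathcal M\subset X$ a second-countable embedded real-analytic manifold of finite dimension $d$. Let $\mathbb K\in\{\mathbb R,\mathbb C\}$. Let $(\mathcal Z,\nu)$ be a probability space and $\mathfrak m\colon A\times\mathcal Z\to\mathbb K$ a map given by one of the following two sampling architectures. (I) Finite-dimensional analytic sampling: $\mathcal Z=Z$ is a connected real-analytic manifold of finite dimension $q\ge 1$ endowed with a smooth positive volume measure $\mathrm{vol}_Z$; $\nu=\mu$ is a Borel probability measure on $Z$ with $\mu\ll\mathrm{vol}_Z$; $\mathfrak m\colon A\times Z\to\mathbb K$ is real analytic; and for all $a_1\ne a_2$ in $A\cap\mathcal M$ the function $\mathfrak m(a_1,\cdot)-\mathfrak m(a_2,\cdot)$ is not identically zero on $Z$. (II) Gaussian multilinear sampling: $H$ is a separable Hilbert space over $\mathbb K$, $Z$ is an infinite-dimensional separable real Hilbert space, $r\ge1$ is an integer; $F\colon A\to\mathcal L^r(H;\mathbb K)$ is real analytic and is injective on $A\cap\mathcal M$; $\psi\colon Z\to H$ is bounded and real linear with $\overline{\operatorname{span}_{\mathbb K}\psi(Z)}=H$; $\gamma$ is a nondegenerate Gaussian Borel probability measure on $Z$; $\mathcal Z=Z^r$, $\nu=\gamma^r$ (the $r$-fold product measure), and $\mathfrak m(a,z)=F(a)(\psi z^1,\dots,\psi z^r)$ for $a\in A$, $z=(z^1,\dots,z^r)\in Z^r$. Let $M\ge 2d+1$ and let $z_1,\dots,z_M\in\mathcal Z$ be independent samples with law $\nu$. Then,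 with probability one, the following holds for every $a_1,a_2\in A\cap\mathcal M$: if $\mathfrak m(a_1,z_i)=\mathfrak m(a_2,z_i)$ for $i=1,\dots,M$, then $a_1=a_2$. (Equivalently, the set of $(z_1,\dots,z_M)\in\mathcal Z^M$ for which there exist $a_1\neq a_2$ in $A\cap\mathcal M$ with $\mathfrak m(a_1,z_i)=\mathfrak m(a_2,z_i)$ for all $i$ has $\nu^M$-measure zero.)
   Context: Complex Banach spaces are regarded as real Banach spaces when analyticity is discussed. Real analytic map: for real Banach spaces $Y_1,Y_2$ and $U\subset Y_1$ open, $G\colon U\to Y_2$ is real analytic if for every $y\in U$ there are $\rho>0$ and continuous symmetric $j$-linear maps $G_j\colon Y_1^j\to Y_2$, $j\ge0$, with $\sum_{j\ge0}\|G_j\|\rho^j<\infty$ and $G(y+h)=\sum_{j\ge0}G_j(h,\dots,h)$ for $\|h\|_{Y_1}<\rho$. On a finite-dimensional real-analytic manifold, or a product of an open subset of a Banach space with one, analyticity is understood in analytic charts. Embedded real-analytic manifold of dimension $d$ in $X$: a subset $\mathcal M\subset X$ (with the topology induced by $X$) such that for every $a\in\mathcal M$ there are an open set $V\subset\mathbb R^d$ and a real-analytic map $\varphi\colon V\to X$ such that $d\varphi_t\colon\mathbb R^d\to X$ is injective for every $t\in V$ and $\varphi$ is a homeomorphism from $V$ onto an open neighbourhood of $a$ in $\mathcal M$. $\mathcal L^r(H;\mathbb K)$ is the Banach space of bounded $\mathbb K$-multilinear forms on $H^r$. A Gaussian measure on $Z$ is nondegenerate if its covariance operator has trivial kernel (its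 mean is arbitrary). *)

(* Defs.v *)
From HB Require Import structures.
From mathcomp Require Import all_boot all_order all_fingroup all_algebra.
From mathcomp Require Import all_classical all_reals all_analysis.
From mathcomp Require Import complex.

Set Implicit Arguments.
Unset Strict Implicit.
Unset Printing Implicit Defensive.

Import Order.TTheory GRing.Theory Num.Theory.
Import numFieldNormedType.Exports.

Local Open Scope classical_set_scope.
Local Open Scope ring_scope.

(** The scalar field [K] is [R] or [R[i]]. *)
Variant scalar_kind := RealScalars | ComplexScalars.

Definition scalar_field (R : realType) (k : scalar_kind) : numFieldType :=
  match k with
  | RealScalars => R : numFieldType
  | ComplexScalars => R[i] : numFieldType
  end.

Definition of_real (R : realType) (k : scalar_kind) : R -> scalar_field R k :=
  match k with
  | RealScalars => fun x => x
  | ComplexScalars => fun x => (x%:C)%C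
  end.
Arguments of_real {R k}.

Definition scalar_re (R : realType) (k : scalar_kind) : scalar_field R k -> R :=
  match k with
  | RealScalars => fun x => x
  | ComplexScalars => fun x => complex.Re x
  end.
Arguments scalar_re {R k}.

Definition scalar_conj (R : realType) (k : scalar_kind) :
    scalar_field R k -> scalar_field R k :=
  match k with
  | RealScalars => fun x => x
  | ComplexScalars => fun x => conjc x
  end.
Arguments scalar_conj {R k}.

Section scalar_theory.
Context {R : realType} {k : scalar_kind}.
Implicit Types (x y : R) (a b : scalar_field R k).

Lemma of_realD x y :
  of_real (x + y) = of_real x + of_real y :> scalar_field R k.
Proof. by case: k => //=; exact: rmorphD. Qed.

Lemma of_realM x y :
  of_real (x * y) = of_real x * of_real y :> scalar_field R k.
Proof. by case: k => //=; exact: rmorphM. Qed.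

Lemma of_real1 : of_real 1 = 1 :> scalar_field R k.
Proof. by case: k. Qed.

Lemma scalar_reD a b : scalar_re (a + b) = scalar_re a + scalar_re b.
Proof. by case: k a b => //= -[a b] [c d]. Qed.

Lemma scalar_re_le a b : a <= b -> scalar_re a <= scalar_re b.
Proof. by case: k a b => //= a b; rewrite lecE => /andP[]. Qed.

Lemma scalar_re_normM x a :
  scalar_re (`|of_real x : scalar_field R k| * a) = `|x| * scalar_re a.
Proof.
case: k a => //= -[a b]; rewrite normc_def/= expr0n/= addr0 sqrtr_sqr.
by rewrite mul0r subr0.
Qed.

Lemma scalar_re_eq0 a : 0 <= a -> scalar_re a = 0 -> a = 0.
Proof.
case: k a => //= -[a b]; rewrite lecE/= => /andP[/eqP -> _] ->.
by [].
Qed.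

End scalar_theory.

(** Restriction of scalars: the normed [K]-space [E] seen as a real one. *)
Definition realify (R : realType) (k : scalar_kind)
  (E : normedModType (scalar_field R k)) : Type := E.

Section realify.
Context {R : realType} {k : scalar_kind} {E : normedModType (scalar_field R k)}.
Local Notation ER := (realify E).

HB.instance Definition _ := GRing.Zmodule.copy ER E.

Let scale (x : R) (u : ER) : ER := (of_real x : scalar_field R k) *: (u : E).

Let scaleA x y u : scale x (scale y u) = scale (x * y) u.
Proof. by rewrite /scale of_realM scalerA. Qed.

Let scale1 : left_id 1 scale.
Proof. by move=> u; rewrite /scale of_real1 scale1r. Qed.

Let scaleDr : right_distributive scale +%R.
Proof. by move=> x u v; rewrite /scale scalerDr. Qed.

Let scaleDl u : {morph scale^~ u : x y / x + y}.
Proof. by move=> x y; rewrite /scale of_realD scalerDl. Qed.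

HB.instance Definition _ :=
  GRing.Zmodule_isLmodule.Build R ER scaleA scale1 scaleDr scaleDl.

Let norm (u : ER) : R := scalar_re `|u : E|.

Let norm_triangle u v : norm (u + v) <= norm u + norm v.
Proof. by rewrite /norm -scalar_reD; apply/scalar_re_le/ler_normD. Qed.

Let normZ (x : R) u : norm (x *: u) = `|x| * norm u.
Proof. by rewrite /norm/= normrZ scalar_re_normM. Qed.

Let norm_eq0 u : norm u = 0 -> u = 0.
Proof. by move=> /(scalar_re_eq0 (normr_ge0 _)) /normr0_eq0. Qed.

HB.instance Definition _ :=
  Lmodule_isNormed.Build R ER norm_triangle normZ norm_eq0.

End realify.

Notation real_scalar R k := (realify ((scalar_field R k)^o)).

Section multilinear.
Context {K : numFieldType} {j : nat}.

Definition multilinear (U V : lmodType K) (f : ('I_j -> U) -> V) : Prop :=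
  forall (x : 'I_j -> U) (i : 'I_j) (c : K) (u v : U),
    f (dfwith x i (c *: u + v)) = c *: f (dfwith x i u) + f (dfwith x i v).

Definition symmetric_map (U V : Type) (f : ('I_j -> U) -> V) : Prop :=
  forall (s : 'S_j) (x : 'I_j -> U), f (x \o s) = f x.

Definition multibounded (U V : normedModType K) (f : ('I_j -> U) -> V) : Prop :=
  exists C : K, forall x : 'I_j -> U, `|f x| <= C * \prod_(i < j) `|x i|.

End multilinear.

Definition unit_polyball (K : numFieldType) (U : normedModType K) (j : nat) :
  set ('I_j -> U) := [set x | forall i, `|x i| <= 1].
Arguments unit_polyball {K} U j.

(** For a bounded multilinear [f] this is its operator norm. *)
Definition multinorm (R : realType) (K : numFieldType) (U : normedModType K)
    (V : normedModType R) (j : nat) (f : ('I_j -> U) -> V) : R :=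
  sup [set `|f x| | x in unit_polyball U j].

(** [G] is only looked at on [U]: the balls of convergence are contained in
    [U]. The topology of [{ptws 'I_j -> Y1}] is the product topology. *)
Definition real_analytic (R : realType) (Y1 Y2 : normedModType R)
    (U : set Y1) (G : Y1 -> Y2) : Prop :=
  forall y, U y ->
  exists rho : R, 0 < rho /\
  exists Gj : forall j : nat, ('I_j -> Y1) -> Y2,
    [/\ forall j, [/\ multilinear (Gj j), symmetric_map (Gj j) &
          continuous (Gj j : {ptws 'I_j -> Y1} -> Y2)],
        cvgn (series (fun j => multinorm (Gj j) * rho ^+ j)) &
        forall h, `|h| < rho ->
          U (y + h) /\ series (fun j => Gj j (fun=> h)) @ \oo --> G (y + h)].

Section mform.
Context {R : realType} {k : scalar_kind} (H : normedModType (scalar_field R k)).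
Variable r : nat.
Local Notation K := (scalar_field R k).
Local Notation KR := (real_scalar R k).

Definition is_mform (f : ('I_r -> H) -> KR) : Prop :=
  @multilinear K r H K^o f /\ @multibounded K r H K^o f.

Definition mform_pred : {pred (('I_r -> H) -> KR)} :=
  [pred f | `[< is_mform f >]].

(** L^r(H; K), made below into a real normed space by the operator norm. *)
Record mform := MForm { mform_fun :> ('I_r -> H) -> KR ;
                        _ : mform_fun \in mform_pred }.

HB.instance Definition _ := [isSub for mform_fun].
HB.instance Definition _ := [Choice of mform by <:].

Lemma mformP (f : mform) : is_mform f.
Proof. by case: f => f /= /asboolP. Qed.

Let mform_submod_closed : submod_closed mform_pred.
Proof.
split.
  apply/asboolP; split.
    by move=> x i c u v /=; rewrite /= scaler0 addr0.
  by exists 0 => x /=; rewrite mul0r normr0.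
move=> a f g /asboolP[fl [Cf fb]] /asboolP[gl [Cg gb]]; apply/asboolP; split.
  move=> x i c u v.
  rewrite /= -[LHS]/(of_real a * f _ + g _ : K).
  rewrite -[RHS]/(c * (of_real a * f _ + g _) +
                  (of_real a * f _ + g _) : K).
  rewrite fl gl -[c *: f _]/(c * f _ : K) -[c *: g _]/(c * g _ : K).
  by rewrite !mulrDr (mulrCA c) -!addrA; congr (_ + _); rewrite addrCA.
exists (`|of_real a : K| * Cf + Cg) => x.
rewrite -[X in `|X|]/(of_real a * f x + g x : K).
apply: le_trans (ler_normD _ _) _; rewrite mulrDl; apply: lerD; last exact: gb.
by rewrite normrM -mulrA ler_wpM2l//; exact: fb.
Qed.

HB.instance Definition _ := GRing.isSubmodClosed.Build _ _ mform_pred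
  mform_submod_closed.

HB.instance Definition _ := [SubChoice_isSubLmodule of mform by <:].

Let norm (f : mform) : R := multinorm (f : ('I_r -> H) -> KR).

Let ball_values (f : mform) : set R :=
  [set `|f x : KR| | x in unit_polyball H r].

Let ball_values_neq0 f : ball_values f !=set0.
Proof. by exists `|f (fun=> 0) : KR|, (fun=> 0) => // i; rewrite normr0. Qed.

Let ball_values_ub f : has_ubound (ball_values f).
Proof.
have [_ [C fC]] := mformP f; exists (scalar_re `|C|) => _ [x x1 <-].
apply: scalar_re_le; apply: (le_trans (fC x)).
have p0 : 0 <= \prod_(i < r) `|x i| by exact: prodr_ge0.
have p1 : \prod_(i < r) `|x i| <= 1.
  by apply: prodr_ile1 => i _; rewrite normr_ge0 x1.
have Cp_real : C * \prod_(i < r) `|x i| \is Num.real.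
  by apply: ger0_real; apply: le_trans (fC x).
rewrite (le_trans (real_ler_norm Cp_real))// normrM (ger0_norm p0).
by rewrite ler_piMr.
Qed.

Let norm_ge (f : mform) x : unit_polyball H r x -> `|f x : KR| <= norm f.
Proof. by move=> x1; apply: (ub_le_sup (ball_values_ub f)); exists x. Qed.

Let norm_triangle (f g : mform) : norm (f + g) <= norm f + norm g.
Proof.
apply: ge_sup; [exact: ball_values_neq0|move=> _ [x x1 <-]].
by apply: le_trans (ler_normD _ _) _; apply: lerD; exact: norm_ge.
Qed.

Let norm_scale_le (l : R) (f : mform) : norm (l *: f) <= `|l| * norm f.
Proof.
apply: ge_sup; [exact: ball_values_neq0|move=> _ [x x1 <-]].
by rewrite /= normrZ ler_wpM2l// norm_ge.
Qed.

Let normZ (l : R) (f : mform) : norm (l *: f) = `|l| * norm f.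
Proof.
apply/eqP; rewrite eq_le norm_scale_le/=.
have [->|l0] := eqVneq l 0.
  rewrite normr0 mul0r; have [_ [x x1 _]] := ball_values_neq0 (0 *: f).
  exact: (le_trans (normr_ge0 _) (@norm_ge (0 *: f) x x1)).
rewrite -ler_pdivlMl ?normr_gt0// -normfV.
by rewrite -{1}[f](scalerK l0) norm_scale_le.
Qed.

Let norm_eq0 (f : mform) : norm f = 0 -> f = 0.
Proof.
move=> f0; have [fl _] := mformP f.
have fball x : unit_polyball H r x -> f x = 0.
  by move=> /(@norm_ge f); rewrite f0 normr_le0 => /eqP.
suff fE n x : (forall i : 'I_r, (n <= i)%N -> `|x i| <= 1) -> f x = 0.
  by apply/val_inj/funext => x /=; apply: (fE r) => i; rewrite leqNgt ltn_ord.
elim: n x => [x x1|n IHn x x1]; first by apply: fball => i; exact: x1.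
have [nr|rn] := ltnP n r; last first.
  by apply: IHn => i /(leq_trans rn); rewrite leqNgt ltn_ord.
pose i0 := Ordinal nr; pose t : K := 1 + `|x i0|.
have t0 : 0 < t by rewrite ltr_pwDl.
have fdf0 v : `|v| <= 1 -> f (dfwith x i0 v) = 0.
  move=> v1; apply: IHn => i ni; have [<-|i0i] := eqVneq i0 i.
    by rewrite dfwithin.
  rewrite dfwithout//; apply: x1; rewrite ltn_neqAle ni andbT.
  by apply: contra i0i => /eqP n_i; apply/eqP/val_inj.
have -> : x = dfwith x i0 (t *: (t^-1 *: x i0) + 0).
  apply/funext => i; have [<-|i0i] := eqVneq i0 i; last by rewrite dfwithout.
  by rewrite dfwithin scalerKV ?gt_eqF// addr0.
rewrite fl !fdf0 ?normr0// ?scaler0 ?addr0//.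
rewrite normrZ normfV (gtr0_norm t0) ler_pdivrMl// mulr1.
by rewrite /t lerDr.
Qed.

HB.instance Definition _ :=
  Lmodule_isNormed.Build R mform norm_triangle normZ norm_eq0.

End mform.

Definition homeo_between (S T : topologicalType) (A : set S) (B : set T)
    (f : S -> T) (g : T -> S) : Prop :=
  [/\ set_fun A B f, set_fun B A g, {in A, cancel f g}, {in B, cancel g f} &
      {within A, continuous f} /\ {within B, continuous g}].

Definition embedded_manifold (R : realType) (X : normedModType R) (d : nat)
    (M : set X) : Prop :=
  forall a, M a ->
  exists (V : set 'rV[R]_d) (phi : 'rV[R]_d -> X) (W : set X),
    [/\ open V, real_analytic V phi,
        forall t, V t -> injective ('d phi t),
        exists2 O : set X, open O & W = O `&` M &
        W a /\ exists g, homeo_between V W phi g].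

Record chart (R : realType) (Z : Type) (q : nat) := Chart {
  chart_dom : set Z ;
  chart_img : set 'rV[R]_q ;
  chart_map : Z -> 'rV[R]_q ;
  chart_inv : 'rV[R]_q -> Z
}.

(** As usual, manifolds are Hausdorff and second countable. *)
Definition analytic_atlas (R : realType) (Z : topologicalType) (q : nat)
    (atlas : set (chart R Z q)) : Prop :=
  [/\ hausdorff_space Z, @second_countable Z,
      forall c, atlas c ->
        [/\ open (chart_dom c), open (chart_img c) &
            homeo_between (chart_dom c) (chart_img c)
              (chart_map c) (chart_inv c)],
      forall z, exists2 c, atlas c & chart_dom c z &
      forall c1 c2, atlas c1 -> atlas c2 ->
        real_analytic
          (chart_img c1 `&` chart_inv c1 @^-1` chart_dom c2)
          (chart_map c2 \o chart_inv c1)].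

(** Analyticity on [A * Z] in the charts of [Z]. *)
Definition real_analytic_prod (R : realType) (X Y : normedModType R)
    (Z : topologicalType) (q : nat) (atlas : set (chart R Z q))
    (A : set X) (m : X -> Z -> Y) : Prop :=
  forall c, atlas c ->
    real_analytic (A `*` chart_img c)
      (fun p : X * 'rV[R]_q => m p.1 (chart_inv c p.2)).

Fixpoint power_measure d (T : measurableType d) (R : realType)
    (mu : set T -> \bar R) (n : nat) : set (n.-tuple T) -> \bar R :=
  match n with
  | 0 => \d_([tuple] : 0.-tuple T)
  | n'.+1 => pushforward (mu \x^ @power_measure _ T R mu n')%E
               (fun p : T * n'.-tuple T => [tuple of p.1 :: p.2])
  end.
Arguments power_measure {d T R} mu n _.

Section power_measure.
Context d (T : measurableType d) (R : realType).

Let measurable_tcons n :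
  measurable_fun [set: T * n.-tuple T]
    (fun p : T * n.-tuple T => [tuple of p.1 :: p.2]).
Proof. by apply: measurable_cons. Qed.

Section sigma_finite.
Variable mu : {sigma_finite_measure set T -> \bar R}.

Let power_measure_ex n :
  exists nu : {measure set (n.-tuple T) -> \bar R}, power_measure mu n = nu.
Proof.
elim: n => [|n [nu nuE]]; first by exists (\d_([tuple] : 0.-tuple T)).
pose f : T * n.-tuple T -> n.+1.-tuple T := fun p => [tuple of p.1 :: p.2].
have mf : measurable_fun setT f by exact: measurable_tcons.
exists (measure_function_pushforward__canonical__measure_function_Measure
          (mu \x^ nu)%E mf).
by rewrite /= nuE.
Qed.

Let power_measure0 n : power_measure mu n set0 = 0%E.
Proof. by have [nu ->] := power_measure_ex n; rewrite measure0. Qed.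

Let power_measure_ge0 n A : (0 <= power_measure mu n A)%E.
Proof. by have [nu ->] := power_measure_ex n. Qed.

Let power_measure_sigma_additive n : semi_sigma_additive (power_measure mu n).
Proof.
by have [nu ->] := power_measure_ex n; exact: measure_semi_sigma_additive.
Qed.

HB.instance Definition _ n := isMeasure.Build _ _ _ (power_measure mu n)
  (power_measure0 n) (@power_measure_ge0 n) (@power_measure_sigma_additive n).

Lemma power_measureE n (B : 'I_n -> set T) : (forall i, measurable (B i)) ->
  power_measure mu n [set t | forall i, B i (tnth t i)] =
  (\prod_(i < n) mu (B i))%E.
Proof.
elim: n B => [|n IHn] B mB.
  by rewrite big_ord0 /= diracE mem_set//; case.
rewrite big_ord_recl/= /pushforward.
rewrite (_ : _ @^-1` _ =
    B ord0 `*` [set t | forall i, B (lift ord0 i) (tnth t i)]).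
  rewrite product_measure2E; [by rewrite -IHn|exact: mB|].
  rewrite (_ : [set t | _] = \bigcap_(i in [set: 'I_n])
      ((fun t => tnth t i) @^-1` B (lift ord0 i))).
    apply: fin_bigcap_measurable => // i _.
    by rewrite -[X in measurable X]setTI; exact: measurable_tnth.
  by apply/seteqP; split => t /= h i; [move=> _|]; exact: h.
apply/seteqP; split => -[a t] /= => [h|[h1 h2] i].
  split=> [|i]; first exact: (h ord0).
  by have := h (lift ord0 i); rewrite tnthS.
by case: (unliftP ord0 i) => [j ->|->//]; rewrite tnthS; exact: h2.
Qed.

End sigma_finite.

Section probability.
Variable P : probability T R.

Let power_measure_setT n : power_measure P n setT = 1%E.
Proof.
elim: n => [|n IHn]; first by rewrite /= diracT.
rewrite /= /pushforward preimage_setT -setXTT.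
rewrite product_measure2E// -[RHS]mule1; congr (_ * _)%E; last exact: IHn.
exact: (probability_setT P).
Qed.

HB.instance Definition _ n := Measure_isProbability.Build _ _ _
  (power_measure P n) (power_measure_setT n).

End probability.
End power_measure.

Definition row_of_tuple (R : realType) (q : nat) (t : q.-tuple R) : 'rV[R]_q :=
  \row_i tnth t i.

Fixpoint ck_on (R : realType) (V W : normedModType R) (k : nat) (U : set V)
    (f : V -> W) : Prop :=
  match k with
  | 0 => {within U, continuous f}
  | k'.+1 => [/\ {within U, continuous f},
                 forall x v, U x -> derivable f x v &
                 forall v, ck_on k' U ('D_v f)]
  end.

Definition smooth_on (R : realType) (V W : normedModType R) (U : set V)
    (f : V -> W) : Prop := forall k, ck_on k U f.

Definition borel (T : ptopologicalType) : Type :=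
  g_sigma_algebraType (@open T).
HB.instance Definition _ (T : ptopologicalType) :=
  Measurable.copy (borel T) (g_sigma_algebraType (@open T)).

(** In every chart, [vol] has a smooth positive density with respect to the
    Lebesgue measure of [R^q], which is the [q]-fold power of the Lebesgue
    measure of [R]. *)
Definition smooth_positive_volume (R : realType) (Z : ptopologicalType)
    (q : nat) (atlas : set (chart R Z q))
    (vol : {measure set (borel Z) -> \bar R}) : Prop :=
  forall c, atlas c ->
  exists rho : 'rV[R]_q -> R,
    [/\ smooth_on (chart_img c) rho,
        forall t, chart_img c t -> 0 < rho t &
        forall B : set (borel Z), measurable B -> B `<=` chart_dom c ->
          vol B = (\int[power_measure (@lebesgue_measure R) q]_(t in
            [set t | (chart_map c @` B) (row_of_tuple t)])
              (rho (row_of_tuple t))%:E)%E].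

(** [ip] is an inner product inducing the norm of [H]; [conj] is the
    conjugation of [K]. *)
Definition inner_product (K : numFieldType) (conj : K -> K)
    (H : normedModType K) (ip : H -> H -> K) : Prop :=
  [/\ forall (c : K) x y z, ip (c *: x + y) z = c * ip x z + ip y z,
      forall x y, ip y x = conj (ip x y) &
      forall x, ip x x = `|x| ^+ 2].

Definition separable (T : topologicalType) : Prop :=
  exists2 S : set T, countable S & dense S.

Definition linear_span (K : numFieldType) (V : lmodType K) (S : set V) :
  set V :=
  [set v | exists n (c : 'I_n -> K) (e : 'I_n -> V),
     (forall i, S (e i)) /\ v = \sum_(i < n) c i *: e i].

Definition infinite_dimensional (K : numFieldType) (V : lmodType K) : Prop :=
  forall n (e : 'I_n -> V), linear_span (range e) <> setT.

(** Dirac masses are the Gaussian laws of variance zero. *)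
Definition gaussian_law (R : realType) (mu : set R -> \bar R) : Prop :=
  (exists m s : R, s != 0 /\
     forall B : set R, measurable B -> mu B = normal_prob m s B) \/
  (exists m : R, forall B : set R, measurable B -> mu B = \d_m B).

Section gaussian.
Context {R : realType} {Z : normedModType R}.
Variables (ip : Z -> Z -> R) (gamma : probability (borel Z) R).

Definition gaussian_measure : Prop :=
  forall u : Z, gaussian_law (fun B : set R => gamma (ip u @^-1` B)).

Definition covariance_operator (C : Z -> Z) : Prop :=
  forall u v : Z,
    (ip (C u) v)%:E =
      covariance gamma (ip u : borel Z -> R) (ip v : borel Z -> R).

(** The covariance operator of a Gaussian measure exists and is unique. *)
Definition nondegenerate_gaussian : Prop :=
  exists2 C : Z -> Z, covariance_operator C & forall u, C u = 0 -> u = 0.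

End gaussian.

Variant sampling_architecture (R : realType) (k : scalar_kind)
    (X : completeNormedModType R) (A M : set X) :
  forall (d : measure_display) (Zs : measurableType d),
    probability Zs R -> (X -> Zs -> scalar_field R k) -> Prop :=
| AnalyticSampling (Z : ptopologicalType) (q : nat)
    (atlas : set (chart R Z q)) (vol : {measure set (borel Z) -> \bar R})
    (mu : probability (borel Z) R) (m : X -> borel Z -> scalar_field R k) :
    (1 <= q)%N ->
    analytic_atlas atlas ->
    connected [set: Z] ->
    smooth_positive_volume atlas vol ->
    mu `<< vol ->
    real_analytic_prod atlas A (m : X -> Z -> real_scalar R k) ->
    (forall a1 a2, (A `&` M) a1 -> (A `&` M) a2 -> a1 <> a2 ->
       exists z, m a1 z <> m a2 z) ->
    sampling_architecture A M mu m
| GaussianSampling (H : completeNormedModType (scalar_field R k))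
    (ipH : H -> H -> scalar_field R k) (Z : completeNormedModType R)
    (ipZ : Z -> Z -> R) (r : nat) (F : X -> mform H r)
    (psi : {linear Z -> realify H}) (gamma : probability (borel Z) R)
    (m : X -> r.-tuple (borel Z) -> scalar_field R k) :
    inner_product scalar_conj ipH -> separable H ->
    inner_product idfun ipZ -> separable Z -> infinite_dimensional Z ->
    (1 <= r)%N ->
    real_analytic A F ->
    {in A `&` M &, injective F} ->
    (exists C : R, forall z, `|psi z| <= C * `|z|) ->
    closure (linear_span (range (psi : Z -> H))) = [set: H] ->
    gaussian_measure ipZ gamma -> nondegenerate_gaussian ipZ gamma ->
    (forall a z, A a -> m a z = F a (fun i => psi (tnth z i))) ->
    sampling_architecture A M (power_measure gamma r) m.

Definition independent_samples (d d' : measure_display)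
    (Omega : measurableType d) (Zs : measurableType d') (R : realType)
    (P : probability Omega R) (nu : probability Zs R) (n : nat)
    (z : 'I_n -> {RV P >-> Zs}) : Prop :=
  (forall i (B : set Zs), measurable B -> distribution P (z i) B = nu B) /\
  (forall B : 'I_n -> set Zs, (forall i, measurable (B i)) ->
     P (\bigcap_i (z i @^-1` B i)) = (\prod_(i < n) P (z i @^-1` B i))%E).

(* Main.v *)
Require Import Defs.
From HB Require Import structures.
From mathcomp Require Import all_boot all_order all_fingroup all_algebra.
From mathcomp Require Import all_classical all_reals all_analysis.
From mathcomp Require Import measurable_realfun complex ring lra.
Import Order.TTheory GRing.Theory Num.Theory.
Import numFieldNormedType.Exports.
Set Implicit Arguments.
Unset Strict Implicit.
Unset Printing Implicit Defensive.
Local Open Scope classical_set_scope.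
Local Open Scope ring_scope.

(** The coincidences to be excluded are the common zeros
    [g (t, z_1) = ... = g (t, z_N) = 0], where [t] ranges over the pairs of
    distinct points of the manifold, a [2d]-dimensional set, and where [g (t, z)]
    is the squared modulus of the difference of the two samples at [z].  For each
    [t] the function [g (t, -)] is almost surely nonzero, so for almost every
    [z_1] the analytic function [g (-, z_1)] is nonzero on a countable dense
    set.  Near a zero of such a function some iterated directional derivative
    vanishes while the next one does not; hence, by the analytic implicit
    function theorem, the zero set is covered by countably many analytic images
    of balls of one dimension less.  Restricting [g] to these pieces and using
    Fubini's theorem, each sample lowers the dimension by one, and nothing is
    left after [2d + 1] samples.

    That two distinct points almost surely give distinct samples follows in the
    first architecture from the fact that a nonzero analytic function on a
    connected manifold has a null zero set.  In the second one, a nonzero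
    continuous linear functional is a nondegenerate Gaussian variable, and
    multilinear forms are treated one slot at a time.

    Analyticity is handled through the class [aser] of sums of absolutely
    convergent monomial series.  Being an inductive predicate closed under
    countable sums, it gives products, compositions, recentring, division by a
    coordinate and the contraction estimate of the implicit function theorem by
    induction, without any rearrangement of multiple series. *)

(** * Absolutely convergent monomial series *)

(** Every condition carried through the induction on the dimension concerns one [t] at a time:
    analyticity of [g (-, z)] at [t], measurability of [g (t, -)] and its almost sure nonvanishing.
    All three pass to [g (phi t, -)] for any analytic [phi], so the pieces may overlap, may have any
    rank, and may depend on [z_1] in an arbitrary way, [z_1] being frozen while the other samples
    are integrated.

    The obstacle is measurability: the bad set is a union over uncountably many [t], while Fubini's
    theorem asks for a measurable set. It is therefore cut into the common zeros over closed balls,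
    measurable by compactness, and the rest of the covering argument speaks of negligible sets.

    The squared modulus merges the real and imaginary equations into one real equation, so that both
    scalar fields obey the same count. Analytic maps between Banach spaces are only ever evaluated
    along analytic parametrisations by finitely many real variables, and the two architectures enter
    the count only through [generic_sampling]. *)

Section row_norm.
Context {R : realType} {n : nat}.
Implicit Types (t : 'rV[R]_n) (r : R).

Lemma rv_norm_leP t r : 0 <= r ->
  reflect (forall l, `|t ord0 l| <= r) (`|t| <= r).
Proof.
move=> r0; apply: (iffP idP) => [tr l|tr].
  by apply: le_trans tr; rewrite [leRHS]/Num.norm/= mx_normrE;
    apply/bigmax_geP; right; exists (ord0, l).
rewrite [leLHS]/Num.norm/= mx_normrE; apply/bigmax_leP; split => // -[i j] _ /=.
by rewrite (ord1 i).
Qed.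

Lemma rv_coord_le t l : `|t ord0 l| <= `|t|.
Proof. by have /rv_norm_leP : `|t| <= `|t| by []; exact. Qed.

End row_norm.

(** Functions on the closed polydisc of radius [r] that are sums of monomial
    series; [C] bounds the sum of the absolute values of the terms. *)
Inductive aser {R : realType} {n : nat} {W : normedModType R} (r : R) :
    ('rV[R]_n -> W) -> R -> Prop :=
| aser_cst x C : `|x| <= C -> aser r (fun=> x) C
| aser_coord l f C : aser r f C -> aser r (fun t => t ord0 l *: f t) (r * C)
| aser_sum (f_ : nat -> 'rV[R]_n -> W) (C_ : nat -> R) f C :
    (forall j, aser r (f_ j) (C_ j)) ->
    (forall k, \sum_(0 <= j < k) C_ j <= C) ->
    (forall t, `|t| <= r -> series (f_ ^~ t) @ \oo --> f t) ->
    aser r f C.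

Section aser_theory.
Context {R : realType} {n : nat}.
Implicit Types (r s C : R).

Lemma norm_series_le (W : normedModType R) (u : W ^nat) (c : R ^nat) x C :
  (forall j, `|u j| <= c j) -> (forall k, \sum_(0 <= j < k) c j <= C) ->
  series u @ \oo --> x -> `|x| <= C.
Proof.
move=> uc cC /cvg_norm ux; apply: (cvgr_to_le ux); apply: nearW => k.
apply: le_trans (cC k); apply: le_trans (ler_norm_sum _ _ _) _.
exact: ler_sum.
Qed.

Lemma aser_norm (W : normedModType R) r (f : 'rV[R]_n -> W) C t :
  aser r f C -> `|t| <= r -> `|f t| <= C.
Proof.
move=> + tr; elim=> {f C}[//|l f C _ IH|f_ C_ f C _ IH CC fs].
  by rewrite normrZ ler_pM// (le_trans (rv_coord_le _ _) tr).
exact: norm_series_le (IH) CC (fs _ tr).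
Qed.

Lemma aser_ge0 (W : normedModType R) r (f : 'rV[R]_n -> W) C :
  0 <= r -> aser r f C -> 0 <= C.
Proof.
move=> r0 fC; apply: le_trans (normr_ge0 (f 0)) _.
by apply: aser_norm fC _; rewrite normr0.
Qed.

(** [aser] has no weakening rule. A series whose only nonzero term is [f] supplies it, because
    [aser_sum] bounds the partial sums from above only and constrains the limit only on the
    polydisc. *)
Lemma aser_le_ext (W : normedModType R) r (f g : 'rV[R]_n -> W) C D :
  0 <= C -> aser r f C -> C <= D -> (forall t, `|t| <= r -> g t = f t) ->
  aser r g D.
Proof.
move=> C0 fC CD fg.
apply: (@aser_sum _ _ _ r (fun j => if j is 0 then f else fun=> 0)
  (fun j => if j is 0 then C else 0)).
- by case=> [//|j]; apply: aser_cst; rewrite normr0.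
- case=> [|k]; first by rewrite big_geq// (le_trans C0).
  by rewrite big_nat_recl//= big1// addr0.
- move=> t tr; rewrite fg//.
  apply: (@cvg_near_cst _ _ (f t)); exists 1%N => // -[//|k] _ /=.
  by rewrite /series/= big_nat_recl//= big1// addr0.
Qed.

Lemma aser_le (W : normedModType R) r (f : 'rV[R]_n -> W) C D :
  0 <= C -> aser r f C -> C <= D -> aser r f D.
Proof. by move=> C0 fC CD; exact: aser_le_ext fC CD _. Qed.

Lemma aser_ext (W : normedModType R) r (f g : 'rV[R]_n -> W) C :
  0 <= C -> aser r f C -> (forall t, `|t| <= r -> g t = f t) -> aser r g C.
Proof. by move=> C0 fC; exact: aser_le_ext fC _. Qed.

Lemma aserD (W : normedModType R) r (f g : 'rV[R]_n -> W) C D :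
  0 <= C -> 0 <= D -> aser r f C -> aser r g D ->
  aser r (fun t => f t + g t) (C + D).
Proof.
move=> C0 D0 fC gD.
apply: (@aser_sum _ _ _ r
  (fun j => match j with 0 => f | 1 => g | _ => fun=> 0 end)
  (fun j => match j with 0 => C | 1 => D | _ => 0 end)).
- by case=> [//|[//|j]]; apply: aser_cst; rewrite normr0.
- case=> [|[|k]]; first by rewrite big_geq// addr_ge0.
    by rewrite big_nat1 lerDl.
  by rewrite big_nat_recl//= big_nat_recl//= big1// addr0.
- move=> t tr; apply: (@cvg_near_cst _ _ (f t + g t)).
  exists 2%N => // -[//|[//|k]] _ /=.
  by rewrite /series/= big_nat_recl//= big_nat_recl//= big1// addr0.
Qed.

Lemma linear_for0 (V W : lmodType R) (B : V -> W) : linear B -> B 0 = 0.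
Proof.
by move=> Bl; have /eqP := Bl 1 0 0;
  rewrite !scale1r addr0 eq_sym -subr_eq0 addrK => /eqP.
Qed.

Lemma linear_cvg_bounded (V W : normedModType R) (B : V -> W) K
    (u : V ^nat) x :
  linear B -> (forall v, `|B v| <= K * `|v|) ->
  series u @ \oo --> x -> series (B \o u) @ \oo --> B x.
Proof.
move=> Bl BK ux; have BD v w : B (v - w) = B v - B w.
  by rewrite addrC -scaleN1r Bl scaleN1r addrC.
have B0 := linear_for0 Bl.
have -> : series (B \o u) = B \o series u.
  apply/funext => k /=; rewrite /series/=; apply: (big_ind2 (fun x y => x = B y)) => // _ b _ e -> ->.
  by rewrite -[in RHS](scale1r b) Bl scale1r.
have K1 : 0 < `|K| + 1 by rewrite ltr_wpDl.
apply/cvgrPdist_lt => e e0; move/cvgrPdist_lt: ux => /(_ (e / (`|K| + 1))).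
rewrite divr_gt0// => /(_ isT); apply: filterS => k /= xk.
rewrite -BD; apply: le_lt_trans (BK _) _; rewrite mulrC.
apply: (@le_lt_trans _ _ (`|x - series u k| * (`|K| + 1))).
  by rewrite ler_wpM2l// (le_trans (ler_norm _))// lerDl.
by rewrite -ltr_pdivlMr.
Qed.

(** A bounded linear [B t] passes through multiples and convergent sums, so induction on [f] leaves
    only constants. Since [B] may depend on [t], bounded linear maps, products and multilinear
    substitution are all instances. *)
Lemma aser_apply (V W : normedModType R) r (B : 'rV[R]_n -> V -> W) (K : R) :
  0 <= K -> (forall t, linear (B t)) ->
  (forall v, aser r (B ^~ v) (K * `|v|)) ->
  forall (f : 'rV[R]_n -> V) C, aser r f C -> aser r (fun t => B t (f t)) (K * C).
Proof.
move=> K0 Bl BK f C fC; elim: fC => {f C}[x C xC|l f C _ IH|f_ C_ f C _ IH CC fs].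
- by apply: aser_le (BK x) _; rewrite ?mulr_ge0// ler_wpM2l.
- rewrite (_ : (fun t : 'rV[R]_n => _) =
      (fun t : 'rV[R]_n => t ord0 l *: B t (f t))).
    by rewrite mulrCA; exact: aser_coord.
  apply/funext => t.
  by rewrite -[in LHS](addr0 (_ *: _)) Bl (linear_for0 (Bl t)) addr0.
- apply: (aser_sum IH); first by move=> k; rewrite -mulr_sumr ler_wpM2l.
  move=> t tr; apply: linear_cvg_bounded (Bl t) _ (fs _ tr) => v.
  exact: aser_norm (BK v) tr.
Qed.

Lemma aser_linear (V W : normedModType R) r (B : V -> W) (K : R)
    (f : 'rV[R]_n -> V) C :
  0 <= K -> linear B -> (forall v, `|B v| <= K * `|v|) -> aser r f C ->
  aser r (B \o f) (K * C).
Proof.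
move=> K0 Bl BK; apply: (@aser_apply _ _ _ (fun=> B)) => // v.
exact: aser_cst.
Qed.

Lemma aserZ (W : normedModType R) r (f : 'rV[R]_n -> W) a C :
  aser r f C -> aser r (fun t => a *: f t) (`|a| * C).
Proof.
apply: (@aser_linear _ _ _ ( *:%R a)) => //.
  by move=> c u v; rewrite scalerDr !scalerA mulrC.
by move=> v; rewrite normrZ.
Qed.

Lemma aserM (W : normedModType R) r (f : 'rV[R]_n -> R) (g : 'rV[R]_n -> W)
    C D :
  0 <= C -> aser r f C -> aser r g D ->
  aser r (fun t => f t *: g t) (C * D).
Proof.
move=> C0 fC; apply: (@aser_apply _ _ _ (fun t v => f t *: v)) => //.
  by move=> t c u v; rewrite scalerDr !scalerA mulrC.
move=> v; rewrite mulrC; apply: (@aser_linear R W r (fun x => x *: v) `|v| f C) => //.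
  by move=> c x y; rewrite scalerDl scalerA.
by move=> x; rewrite normrZ mulrC.
Qed.

Lemma aser_proj r l : 0 <= r -> aser r (fun t : 'rV[R]_n => t ord0 l) r.
Proof.
move=> r0; have : aser r (fun t : 'rV[R]_n => t ord0 l *: (1 : R^o)) (r * 1).
  by apply: aser_coord; apply: aser_cst; rewrite normr1.
by rewrite mulr1; under eq_fun do rewrite [_ *: _]mulr1.
Qed.

End aser_theory.

(** The bound is unchanged: each coordinate factor of a monomial counts as [s] in [C], and it is
    replaced by a function whose own bound is [s]. *)
Lemma aser_comp (R : realType) n p (W : normedModType R) (r s : R)
    (phi : 'rV[R]_n -> 'rV[R]_p) (f : 'rV[R]_p -> W) C :
  0 <= s -> (forall l, aser r (fun t => phi t ord0 l) s) -> aser s f C ->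
  aser r (f \o phi) C.
Proof.
move=> s0 phis; elim => {f C}[x C xC|l f C _ IH|f_ C_ f C _ IH CC fs].
- exact: aser_cst.
- exact: aserM IH.
- apply: (aser_sum IH CC) => t tr; apply: fs.
  by apply/rv_norm_leP => // l; exact: aser_norm (phis l) tr.
Qed.

Section aser_radius.
Context {R : realType} {n : nat} {W : normedModType R}.
Implicit Types (r s C : R) (f : 'rV[R]_n -> W).

Lemma aser_restrict r s f C : 0 <= s -> s <= r -> aser r f C -> aser s f C.
Proof.
move=> s0 sr; apply: (@aser_comp _ _ _ _ _ _ id) => [|l].
  exact: le_trans sr.
exact: aser_le (aser_proj l s0) _.
Qed.

(** Subtracting [f 0] removes the constant term; every other monomial has at least one coordinate
    factor, whose bound drops from [r] to [s]. *)
Lemma aser_shrink r s f C : 0 <= s -> s <= r -> 0 < r -> aser r f C ->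
  aser s (fun t => f t - f 0) (s / r * C).
Proof.
move=> s0 sr r0; elim => {f C}[x C xC|l f C fC _|f_ C_ f C _ IH CC fs].
- apply: (@aser_le_ext _ _ _ _ (fun=> 0) _ 0) => //.
  + by apply: aser_cst; rewrite normr0.
  + by rewrite mulr_ge0 ?divr_ge0 ?(ltW r0)//; exact: le_trans xC.
  + by move=> t _; rewrite subrr.
- rewrite mulrA divfK ?gt_eqF//.
  under eq_fun do rewrite mxE scale0r subr0.
  exact/aser_coord/(aser_restrict s0 sr fC).
- apply: (aser_sum IH); first by move=> k; rewrite -mulr_sumr ler_wpM2l ?divr_ge0 ?(ltW r0).
  move=> t ts; rewrite (_ : series _ = series (f_ ^~ t) - series (f_ ^~ 0)).
    by apply: cvgB; apply: fs; rewrite ?normr0 ?(ltW r0)// (le_trans ts).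
  by apply/funext => k; rewrite /series/= sumrB.
Qed.

Lemma aser_recenter r s f C t0 : 0 <= s -> `|t0| + s <= r -> aser r f C ->
  aser s (fun t => f (t0 + t)) C.
Proof.
move=> s0 sr; apply: (@aser_comp _ _ _ _ _ _ (fun t => t0 + t)) => [|l].
  exact: le_trans (addr_ge0 (normr_ge0 _) s0) sr.
apply: (@aser_le_ext _ _ _ _ _ _ (`|t0| + s) _ _ _ sr).
- by rewrite addr_ge0.
- apply: (@aserD _ _ _ _ (fun=> t0 ord0 l)) (aser_proj l s0) => //.
  exact/aser_cst/rv_coord_le.
- by move=> t _; rewrite mxE.
Qed.

(* Shrinking a recentred series to the radius [|h|] gives a Lipschitz bound. *)
Lemma aser_lipschitz r f C t h : 0 < r - `|t| -> `|h| <= r - `|t| ->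
  aser r f C -> `|f (t + h) - f t| <= `|h| / (r - `|t|) * C.
Proof.
move=> rt hr fC.
have : aser (r - `|t|) (fun u => f (t + u)) C.
  by apply: aser_recenter fC; rewrite ?(ltW rt)// addrC subrK.
move=> /(aser_shrink (normr_ge0 h) hr rt) /(@aser_norm _ _ _ _ _ _ h).
by rewrite addr0; exact.
Qed.

End aser_radius.

(** * Division by a coordinate, order of vanishing, identity theorem *)

Section aser_division.
Context {R : realType} {n : nat}.
Implicit Types (r s C : R) (f : 'rV[R]_n -> R) (l : 'I_n).

Definition coord_zero l (t : 'rV[R]_n) : 'rV[R]_n :=
  \row_i (if i == l then 0 else t ord0 i).

Lemma coord_zero_le l t : `|coord_zero l t| <= `|t|.
Proof.
apply/rv_norm_leP => // i; rewrite mxE.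
by case: eqP => _; rewrite ?normr0// rv_coord_le.
Qed.

Lemma cvg_series_bounded (V : completeNormedModType R) (u : V ^nat) (c : R ^nat) C :
  (forall j, `|u j| <= c j) -> (forall k, \sum_(0 <= j < k) c j <= C) ->
  cvgn (series u).
Proof.
move=> uc cC; apply: normed_cvg.
rewrite (_ : [normed series u] = series (fun k => `|u k|))//.
apply: nondecreasing_is_cvgn; first by apply: nondecreasing_series.
by exists C => _ [k _ <-]; apply: le_trans (cC k); exact: ler_sum.
Qed.

(** Monomials containing the coordinate [l] give up one factor of it, which divides their bound by
    [r]; the others are accounted for by [f (coord_zero l t)]. For a sum, the quotients are summed,
    and the bounds [C_ j / r] make that series converge. *)
Lemma aser_div r f C l : 0 < r -> aser r f C ->
  exists2 q, aser r q (C / r) &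
    forall t, `|t| <= r -> f t = f (coord_zero l t) + t ord0 l * q t.
Proof.
move=> r0; elim=> {f C}[x C xC|i f C fC [q qC qE]|f_ C_ f C f_C IH CC fs].
- exists (fun=> 0); last by move=> t _; rewrite mulr0 addr0.
  by apply: aser_cst; rewrite normr0 divr_ge0 ?(ltW r0)// (le_trans _ xC).
- have [->|il] := eqVneq i l.
    exists f; first by rewrite mulrC mulKf// gt_eqF.
    by move=> t _; rewrite mxE eqxx scale0r add0r.
  exists (fun t : 'rV[R]_n => t ord0 i *: q t); first by rewrite -mulrA; exact: aser_coord.
  by move=> t /qE ->; rewrite mxE (negbTE il) /GRing.scale/= mulrDr mulrCA.
- have /choice[q_ qP] : forall j, exists q, aser r q (C_ j / r) /\
      forall t, `|t| <= r ->
        f_ j t = f_ j (coord_zero l t) + t ord0 l * q t.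
    by move=> j; have [q ? ?] := IH j; exists q.
  have sC k : \sum_(0 <= j < k) C_ j / r <= C / r.
    by rewrite -mulr_suml ler_wpM2r// invr_ge0 ltW.
  have qcvg t : `|t| <= r -> series (q_ ^~ t) @ \oo --> limn (series (q_ ^~ t)).
    move=> tr; apply: cvg_series_bounded sC => j.
    exact: aser_norm (qP j).1 tr.
  exists (fun t => limn (series (q_ ^~ t))).
    by apply: aser_sum sC qcvg => j; exact: (qP j).1.
  move=> t tr; have ztr := le_trans (coord_zero_le l t) tr.
  apply: (cvg_unique _ (fs _ tr)) => //.
  rewrite (_ : series (f_ ^~ t) = series (f_ ^~ (coord_zero l t)) +
                       (fun k => t ord0 l * series (q_ ^~ t) k)).
    apply: cvgD; first exact: fs.
    by apply: cvgM; [exact: cvg_cst|exact: qcvg].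
  apply/funext => k; rewrite /series fctE/= mulr_sumr -big_split/=.
  by apply: eq_bigr => j _; exact: (qP j).2.
Qed.

End aser_division.

Lemma coord_zero1 (R : realType) (t : 'rV[R]_1) : coord_zero ord0 t = 0.
Proof. by apply/rowP => i; rewrite !mxE (ord1 i). Qed.

Lemma rv1_norm (R : realType) (t : 'rV[R]_1) : `|t| = `|t ord0 ord0|.
Proof.
apply/eqP; rewrite eq_le rv_coord_le andbT.
by apply/rv_norm_leP => // l; rewrite (ord1 l).
Qed.

(** If division by the variable never stops, the quotient after [q] steps has bound [C / r ^+ q], so
    [|g s| <= (|s| / r) ^+ q * C] for every [q], and this tends to zero. *)
Lemma aser_order (R : realType) (r C : R) (g : 'rV[R]_1 -> R) :
  0 < r -> aser r g C ->
  (forall s, `|s| < r -> g s = 0) \/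
  exists q h, [/\ aser r h (C / r ^+ q), h 0 != 0 &
     forall s, `|s| <= r -> g s = s ord0 ord0 ^+ q * h s].
Proof.
move=> r0 gC; have C0 := aser_ge0 (ltW r0) gC.
apply/or_asboolP; rewrite orbC -implyNb; apply/implyP => /asboolPn ng.
have gq q : exists2 h, aser r h (C / r ^+ q) &
    forall s, `|s| <= r -> g s = s ord0 ord0 ^+ q * h s.
  elim: q => [|q [h hC hE]].
    by exists g; rewrite ?divr1// => s _; rewrite mul1r.
  have h0 : h 0 = 0.
    by apply/eqP; apply: contrapT => /negP ?; apply: ng; exists q, h.
  have [h' h'C h'E] := aser_div ord0 r0 hC.
  exists h'; first by rewrite exprSr invfM mulrA.
  by move=> s sr; rewrite hE// h'E// coord_zero1 h0 add0r exprSr mulrA.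
apply/asboolP => s sr; apply/eqP; rewrite -normr_eq0 eq_le normr_ge0 andbT.
have z1 : `| `|s| / r | < 1.
  by rewrite ger0_norm ?divr_ge0 ?(ltW r0)// ltr_pdivrMr ?mul1r.
have : (fun q => (`|s| / r) ^+ q * C) @ \oo --> 0 * C.
  by apply: cvgM; [exact: cvg_expr|exact: cvg_cst].
rewrite mul0r => /cvgr_to_ge; apply; apply: nearW => q.
have [h hC ->] := gq q; last exact: ltW.
rewrite normrM normrX -rv1_norm expr_div_n mulrAC -mulrA.
by rewrite ler_wpM2l ?exprn_ge0// (aser_norm hC (ltW sr)).
Qed.

(** Restricted to the line through [t], the function either vanishes or is a power of the parameter
    times some [h] with [h 0 != 0]; the latter is incompatible with vanishing near the origin. *)
Lemma aser_identity (R : realType) n (r C : R) (f : 'rV[R]_n -> R) :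
  0 < r -> aser r f C -> (\forall t \near (0 : 'rV[R]_n), f t = 0) ->
  forall t, `|t| < r -> f t = 0.
Proof.
move=> r0 fC /nbhs_ballP[e /= e0 fe] t tr.
have [->|t0] := eqVneq t 0; first by apply: fe; exact: ballxx.
have nt0 : 0 < `|t| by rewrite normr_gt0.
pose phi (s : 'rV[R]_1) : 'rV[R]_n := s ord0 ord0 *: (`|t|^-1 *: t).
have phiC l : aser r (fun s => phi s ord0 l) r.
  rewrite -[X in aser _ _ X]mulr1.
  under eq_fun do rewrite mxE; apply: aser_coord; apply: aser_cst.
  rewrite mxE normrM normfV normr_id mulrC ler_pdivrMr// mul1r.
  exact: rv_coord_le.
have [g0|[q [h [hC h0 gE]]]] := aser_order r0 (aser_comp (ltW r0) phiC fC).
  have := g0 (const_mx `|t|); rewrite rv1_norm mxE normr_id => /(_ tr).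
  by rewrite /= /phi mxE scalerA divff ?gt_eqF// scale1r.
exfalso; move/negP: h0; apply.
have rh : 0 < r - `|0 : 'rV[R]_1| by rewrite normr0 subr0.
apply/eqP/eqP; rewrite -normr_eq0 eq_le normr_ge0 andbT.
set K := C / r ^+ q in hC.
(* [h] vanishes at the parameter [x], so the Lipschitz estimate between [0] and [x] bounds [h 0]
   itself. *)
have hs (x : R) : 0 < x -> x < e -> x <= r -> `|h 0| <= x * (K / r).
  move=> x0 xe xr; pose s : 'rV[R]_1 := const_mx x.
  have sx : `|s| = x by rewrite rv1_norm mxE gtr0_norm.
  have phs : `|phi s| = x.
    by rewrite normrZ mxE gtr0_norm// normrZ normfV normr_id mulVf ?mulr1// gt_eqF.
  have hs0 : h s = 0.
    apply/eqP; have := gE s; rewrite sx => /(_ xr)/esym/eqP.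
    rewrite /= fe; last by rewrite -ball_normE/= sub0r normrN phs.
    by rewrite mulf_eq0 expf_eq0 mxE gt_eqF// andbF.
  have := @aser_lipschitz _ _ _ r h K 0 s rh.
  rewrite add0r hs0 sub0r normrN sx normr0 subr0 => /(_ xr hC).
  by rewrite mulrAC mulrA.
have : (fun x => x * (K / r)) @ 0^'+ --> 0 * (K / r).
  by apply: cvgM; [exact: cvg_at_right_filter|exact: cvg_cst].
rewrite mul0r => /cvgr_to_ge; apply; near=> x.
by apply: hs; near: x;
  [exact: nbhs_right_gt|exact: nbhs_right_lt|exact: nbhs_right_le].
Unshelve. all: by end_near. Qed.

(** * Analytic functions of several real variables *)

Definition analytic_at {R : realType} {n} {W : normedModType R}
    (f : 'rV[R]_n -> W) (t0 : 'rV[R]_n) : Prop :=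
  exists r C, 0 < r /\ aser r (fun t => f (t0 + t)) C.

Lemma near_right_ex (R : realType) (P : R -> Prop) :
  (\forall s \near 0^'+, P s) -> exists2 s, 0 < s & P s.
Proof.
move=> nP; near (0 : R)^'+ => s; exists s; near: s => //.
exact: nbhs_right_gt.
Unshelve. all: by end_near. Qed.

Lemma nearandP (T : Type) (F : set_system T) {FF : Filter F} (P Q : T -> Prop) :
  (\forall s \near F, P s) -> (\forall s \near F, Q s) ->
  \forall s \near F, P s /\ Q s.
Proof. exact: filterI. Qed.

Section analytic_at_theory.
Context {R : realType} {n : nat}.
Implicit Types (r s C : R) (t : 'rV[R]_n).

Lemma analytic_at_aser (W : normedModType R) r (f : 'rV[R]_n -> W) C t :
  `|t| < r -> aser r f C -> analytic_at f t.
Proof.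
move=> tr fC; exists (r - `|t|), C; split; first by rewrite subr_gt0.
by apply: aser_recenter fC; rewrite ?subr_ge0 ?(ltW tr)// addrC subrK.
Qed.

(** The bound [s / r * C] given by [aser_shrink] tends to zero with [s]. The result holds for all
    small [s], so that several functions can share one radius. *)
Lemma analytic_at_small (W : normedModType R) (f : 'rV[R]_n -> W) t0 (e : R) :
  analytic_at f t0 -> 0 < e ->
  \forall s \near 0^'+, aser s (fun t => f (t0 + t) - f t0) e.
Proof.
move=> [r [C [r0 fC]]] e0; have C0 := aser_ge0 (ltW r0) fC.
have C1 : 0 < C + 1 by rewrite ltr_wpDl.
near=> s; have s0 : 0 < s by near: s; exact: nbhs_right_gt.
have sr : s < r by near: s; exact: nbhs_right_lt.
have se : s < e * r / (C + 1).
  by near: s; apply: nbhs_right_lt; rewrite divr_gt0// mulr_gt0.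
have := aser_shrink (ltW s0) (ltW sr) r0 fC; rewrite addr0 => fs.
apply: aser_le fs _.
  by rewrite mulr_ge0// divr_ge0// ltW.
rewrite mulrAC ler_pdivrMr//; move: se; rewrite ltr_pdivlMr// => /ltW; apply: le_trans.
by rewrite ler_pM2l// lerDl.
Unshelve. all: by end_near. Qed.

Lemma analytic_at_bound (W : normedModType R) (f : 'rV[R]_n -> W) t0 (e : R) :
  analytic_at f t0 -> 0 < e ->
  \forall s \near 0^'+, aser s (fun t => f (t0 + t)) (`|f t0| + e).
Proof.
move=> fa e0; have := analytic_at_small fa e0; apply: filterS => s fs.
have /(_ W (f t0)) cs := @aser_cst R n _ s _ _ (lexx _).
rewrite addrC; under eq_fun do rewrite -[f _](subrK (f t0)).
by apply: aserD => //; rewrite ltW.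
Qed.

Lemma analytic_at_near (W : normedModType R) (f : 'rV[R]_n -> W) t0 :
  analytic_at f t0 -> \forall t \near t0, analytic_at f t.
Proof.
move=> [r [C [r0 fC]]]; near=> t.
have tr : `|t - t0| < r.
  by rewrite distrC; near: t; exact: cvgr_dist_lt.
have [s [D [s0 gD]]] := analytic_at_aser tr fC.
exists s, D; split => //.
rewrite (_ : (fun u => _) = (fun u => f (t0 + (t - t0 + u)))) //.
by apply/funext => u; rewrite addrA [t0 + _]addrC subrK.
Unshelve. all: by end_near. Qed.

Lemma analytic_at_eq_near (W : normedModType R) (f g : 'rV[R]_n -> W) t0 :
  analytic_at f t0 -> (\forall t \near t0, g t = f t) -> analytic_at g t0.
Proof.
move=> [r [C [r0 fC]]] /nbhs_ballP[e /= e0 fg].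
pose s := Num.min r (e / 2).
have s0 : 0 < s by rewrite lt_min r0 divr_gt0.
exists s, C; split => //.
have sr : s <= r by rewrite ge_min lexx.
apply: aser_ext (aser_restrict (ltW s0) sr fC) _; first exact: aser_ge0 (ltW r0) fC.
move=> t ts; apply: fg; rewrite -ball_normE/= opprD addNKr normrN.
apply: le_lt_trans ts _; rewrite gt_min; apply/orP; right.
by rewrite ltr_pdivrMr// ltr_pMr// ltr1n.
Qed.

Lemma analytic_at_cont (W : normedModType R) (f : 'rV[R]_n -> W) t0 :
  analytic_at f t0 -> {for t0, continuous f}.
Proof.
move=> fa; apply/(@cvgrPdist_le _ _ _ (nbhs t0)) => e e0.
have [s s0 fs] := near_right_ex (analytic_at_small fa e0).
near=> t; rewrite distrC.
have : `|t - t0| <= s by rewrite distrC; near: t; exact: cvgr_dist_le.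
by move=> /(aser_norm fs); rewrite subrKC.
Unshelve. all: by end_near. Qed.

Lemma analytic_at_cst (W : normedModType R) (x : W) t0 :
  analytic_at (fun=> x) t0.
Proof. by exists 1, `|x|; split => //; exact: aser_cst. Qed.

Lemma analytic_at_proj (l : 'I_n) t0 :
  analytic_at (fun t : 'rV[R]_n => t ord0 l) t0.
Proof.
by apply: (@analytic_at_aser _ (`|t0| + 1) _ (`|t0| + 1)); [rewrite ltrDl|apply: aser_proj; rewrite addr_ge0].
Qed.

Lemma analytic_atD (W : normedModType R) (f g : 'rV[R]_n -> W) t0 :
  analytic_at f t0 -> analytic_at g t0 -> analytic_at (fun t => f t + g t) t0.
Proof.
move=> fa ga.
have [s s0 [fs gs]] := near_right_ex (nearandP (analytic_at_bound fa ltr01)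
  (analytic_at_bound ga ltr01)).
by exists s; eexists; split => //; apply: aserD fs gs; rewrite addr_ge0.
Qed.

Lemma analytic_atM (W : normedModType R) (f : 'rV[R]_n -> R)
    (g : 'rV[R]_n -> W) t0 :
  analytic_at f t0 -> analytic_at g t0 -> analytic_at (fun t => f t *: g t) t0.
Proof.
move=> fa ga.
have [s s0 [fs gs]] := near_right_ex (nearandP (analytic_at_bound fa ltr01)
  (analytic_at_bound ga ltr01)).
by exists s; eexists; split => //; apply: aserM fs gs; rewrite addr_ge0.
Qed.

Lemma analytic_at_linear (V W : normedModType R) (B : V -> W) K
    (f : 'rV[R]_n -> V) t0 :
  0 <= K -> linear B -> (forall v, `|B v| <= K * `|v|) -> analytic_at f t0 ->
  analytic_at (B \o f) t0.
Proof.
move=> K0 Bl BK [r [C [r0 fC]]]; exists r, (K * C); split => //.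
exact: aser_linear fC.
Qed.

Lemma analytic_atZ (W : normedModType R) a (f : 'rV[R]_n -> W) t0 :
  analytic_at f t0 -> analytic_at (fun t => a *: f t) t0.
Proof. by apply: analytic_atM; exact: analytic_at_cst. Qed.

Lemma analytic_atB (W : normedModType R) (f g : 'rV[R]_n -> W) t0 :
  analytic_at f t0 -> analytic_at g t0 -> analytic_at (fun t => f t - g t) t0.
Proof.
move=> fa /(analytic_atZ (-1)) ga; have := analytic_atD fa ga.
by under eq_fun do rewrite scaleN1r.
Qed.

End analytic_at_theory.

Lemma analytic_at_comp (R : realType) n p (W : normedModType R)
    (f : 'rV[R]_p -> W) (phi : 'rV[R]_n -> 'rV[R]_p) t0 :
  (forall l, analytic_at (fun t => phi t ord0 l) t0) ->
  analytic_at f (phi t0) -> analytic_at (f \o phi) t0.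
Proof.
move=> phia [r [C [r0 fC]]].
have [s s0 phis] := near_right_ex
  (filter_forall _ (fun l => analytic_at_small (phia l) r0)).
exists s, C; split => //.
have := @aser_comp _ _ _ _ s r (fun t => phi (t0 + t) - phi t0) _ C (ltW r0) _ fC.
rewrite (_ : _ \o _ = (fun t => (f \o phi) (t0 + t))).
  apply => l; under eq_fun do rewrite !mxE; exact: phis.
by apply/funext => t /=; rewrite subrKC.
Qed.

(** * Directional derivatives of analytic functions *)

Section derivative.
Context {R : realType} {n : nat}.
Implicit Types (t h : 'rV[R]_n) (f : 'rV[R]_n -> R).

Let ext t (s : R) : 'rV[R]_(n + 1) := row_mx t (const_mx s).

Let ext_norm_le t s r : 0 <= r -> `|t| <= r -> `|s| <= r -> `|ext t s| <= r.
Proof.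
move=> r0 tr sr; apply/rv_norm_leP => // l.
rewrite /ext mxE; case: fintype.split => j; last by rewrite mxE.
exact: le_trans (rv_coord_le _ _) tr.
Qed.

Let ext_zero t s : coord_zero (rshift n ord0) (ext t s) = ext t 0.
Proof.
apply/rowP => l; rewrite !mxE; case: splitP => j lj.
  rewrite ifF// -val_eqE/= lj addn0; apply/negbTE.
  by rewrite neq_ltn ltn_ord.
by rewrite ifT ?mxE// -val_eqE/= lj (ord1 j).
Qed.

(* [F] below is the function [(t, s) |-> f (t0 + t + s *: h)]; dividing its
   increment in [s] by [s] gives an analytic function of [(t, s)]. *)
Lemma analytic_at_derive f t0 h : analytic_at f t0 ->
  derivable f t0 h /\ analytic_at ('D_h f) t0.
Proof.
(* If [t] and [s] are bounded by [r1], then [t + s *: h] is bounded by [r1 * (1 + |h|) = r]. *)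
move=> [r [C [r0 fC]]]; pose r1 := r / (1 + `|h|).
have h1 : 0 < 1 + `|h| by rewrite ltr_pwDl.
have r10 : 0 < r1 by rewrite divr_gt0.
pose shift_ (u : 'rV[R]_(n + 1)) : 'rV[R]_n :=
  lsubmx u + u ord0 (rshift n ord0) *: h.
pose F (u : 'rV[R]_(n + 1)) := f (t0 + shift_ u).
have FC : aser r1 F C.
  apply: (aser_comp (ltW r0) _ fC) => l.
  have -> : r = r1 + r1 * `|h| by rewrite -{1}(mulr1 r1) -mulrDr divfK ?gt_eqF.
  under eq_fun do rewrite !mxE.
  apply: (@aserD _ _ R _ (fun u : 'rV[R]_(n + 1) => u ord0 (lshift 1 l))
    (fun u => u ord0 (rshift n ord0) *: h ord0 l)).
  - exact: ltW.
  - by rewrite mulr_ge0 ?(ltW r10).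
  - by apply: aser_proj; exact: ltW.
  - exact/aser_coord/aser_cst/rv_coord_le.
have [q qC qE] := aser_div (rshift n ord0) r10 FC.
have Fext t s : F (ext t s) = f (t0 + t + s *: h).
  by rewrite /F /shift_ row_mxKl row_mxEr mxE addrA.
(* Stated at all [x] near [t0], so that the derivative is identified with the function
   [x |-> q (x - t0, 0)], which is analytic. *)
have key x : `|x - t0| < r1 ->
    s^-1 *: (f (s *: h + x) - f x) @[s --> 0^'] --> q (ext (x - t0) 0).
  move=> xr; set t := x - t0.
  have ext0 : `|ext t 0| <= `|t| by apply: ext_norm_le; rewrite ?normr0.
  have rt : 0 < r1 - `|ext t 0| by rewrite subr_gt0 (le_lt_trans ext0).
  set K := (r1 - `|ext t 0|)^-1 * (C / r1).
  have K0 : 0 <= K.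
    by rewrite mulr_ge0 ?invr_ge0 ?(ltW rt)// (aser_ge0 (ltW r10) qC).
  apply/cvgrPdist_le => e e0; near=> s.
  have s0 : s != 0 by near: s; exact: nbhs_dnbhs_neq.
  have sr : `|s| <= r1 - `|ext t 0|.
    near: s; apply: dnbhs0_le; exact: rt.
  have se : `|s| <= e / (K + 1).
    by near: s; apply: dnbhs0_le; rewrite divr_gt0// ltr_wpDl.
  have -> : s^-1 *: (f (s *: h + x) - f x) = q (ext t s).
    have xE : x = t0 + t by rewrite subrKC.
    rewrite [s *: h + x]addrC {1}xE -Fext qE; last first.
      apply: ext_norm_le; rewrite ?(ltW r10) ?(ltW xr)//.
      by apply: (le_trans sr); rewrite gerBl.
    rewrite ext_zero Fext scale0r addr0 -xE [f x + _]addrC addrK row_mxEr mxE.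
    by rewrite /GRing.scale/= mulKf.
  rewrite distrC; have st0 : ext t 0 + ext 0 s = ext t s.
    by rewrite /ext add_row_mx addr0; congr row_mx; apply/rowP => i; rewrite !mxE add0r.
  have ss : `|ext 0 s| <= `|s| by apply: ext_norm_le; rewrite ?normr0.
  have := aser_lipschitz rt (le_trans ss sr) qC; rewrite st0 => /le_trans; apply.
  rewrite -mulrA -/K; apply: le_trans (_ : `|s| * (K + 1) <= _).
    by apply: ler_pM; rewrite ?lerDl.
  by rewrite -ler_pdivlMr// ltr_wpDl.
split; first by apply/cvg_ex; exists (q (ext (t0 - t0) 0)); apply: key; rewrite subrr normr0.
apply: (@analytic_at_eq_near _ _ _ (fun x => q (ext (x - t0) 0))).
  apply: (@analytic_at_comp _ _ _ _ q (fun x => ext (x - t0) 0)) => [l|].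
    have -> : (fun t => ext (t - t0) 0 ord0 l) =
       match fintype.split l with
       | inl j => fun t : 'rV[R]_n => t ord0 j - t0 ord0 j
       | inr _ => fun=> 0 end.
      by apply/funext => t; rewrite /ext mxE; case: fintype.split => j; rewrite !mxE.
    case: fintype.split => j; last exact: analytic_at_cst.
    by apply: analytic_atB; [exact: analytic_at_proj|exact: analytic_at_cst].
  by apply: analytic_at_aser qC; apply: le_lt_trans r10; apply: ext_norm_le; rewrite ?subrr ?normr0.
near=> x; apply: cvg_lim => //; apply: key.
by rewrite distrC; near: x; exact: cvgr_dist_lt.
Unshelve. all: by end_near. Qed.

End derivative.

Section difference.
Context {R : realType}.

(** A Cauchy estimate: the factor [1 / (s - s')] pays for one derivative of [f]. The bound is stable
    under one more coordinate factor because [D * C + s' * (D * C / (s - s')) = D * (s * C) / (s -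
    s')]. *)
Lemma aser_comp_sub n p (r s s' D : R) (phi psi : 'rV[R]_n -> 'rV[R]_p)
    (f : 'rV[R]_p -> R) C :
  0 <= r -> 0 <= s' -> s' < s -> 0 <= D ->
  (forall l, aser r (fun t => phi t ord0 l) s') ->
  (forall l, aser r (fun t => psi t ord0 l) s') ->
  (forall l, aser r (fun t => phi t ord0 l - psi t ord0 l) D) ->
  aser s f C ->
  aser r (fun t => f (phi t) - f (psi t)) (D * C / (s - s')).
Proof.
move=> r0 s'0 ss D0 phis psis pD.
have s0 : 0 < s by exact: le_lt_trans ss.
have ss0 : 0 < s - s' by rewrite subr_gt0.
elim=> {f C}[x C xC|l f C fC IH|f_ C_ f C f_C IH CC fs].
- have C0 : 0 <= C by exact: le_trans xC.
  apply: (@aser_le_ext _ _ _ _ (fun=> 0) _ 0) => //.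
  + by apply: aser_cst; rewrite normr0.
  + by rewrite divr_ge0 ?mulr_ge0 ?(ltW ss0).
  + by move=> t _; rewrite subrr.
- have C0 := aser_ge0 (ltW s0) fC.
  have fphi : aser r (f \o phi) C.
    apply: aser_comp fC; rewrite ?(ltW s0)// => j.
    exact: aser_le (phis j) (ltW ss).
  apply: (@aser_le_ext _ _ _ _ (fun t => (phi t ord0 l - psi t ord0 l) *: (f \o phi) t +
     psi t ord0 l *: (f (phi t) - f (psi t))) _ (D * C + s' * (D * C / (s - s')))).
  + by rewrite addr_ge0 ?mulr_ge0 ?invr_ge0 ?(ltW ss0)//.
  + apply: aserD; rewrite ?mulr_ge0 ?invr_ge0 ?(ltW ss0)//.
      exact: aserM.
    exact: aserM IH.
  + rewrite le_eqVlt; apply/orP; left; apply/eqP; field.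
    by rewrite gt_eqF.
  + by move=> t _; rewrite /GRing.scale/=; ring.
- apply: (aser_sum IH).
    move=> k; rewrite -mulr_suml -mulr_sumr ler_wpM2r ?invr_ge0 ?(ltW ss0)//.
    by rewrite ler_wpM2l.
  move=> t tr; rewrite (_ : series _ = series (f_ ^~ (phi t)) - series (f_ ^~ (psi t))).
    by apply: cvgB; apply: fs; apply/rv_norm_leP; rewrite ?(ltW s0)// => l;
      rewrite (le_trans _ (ltW ss))//; [exact: aser_norm (phis l) tr|exact: aser_norm (psis l) tr].
  by apply/funext => k; rewrite /series/= sumrB.
Qed.

End difference.

(** * The analytic implicit function theorem *)

Section implicit_function.
Context {R : realType} {k : nat} (l : 'I_k.+1).
Implicit Types (r s C D e : R) (t : 'rV[R]_k).

Definition insert_coord t (y : R) : 'rV[R]_k.+1 :=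
  \row_i (if unlift l i is Some j then t ord0 j else y).

Lemma insert_coord_eq t y : insert_coord t y ord0 l = y.
Proof. by rewrite mxE unlift_none. Qed.

Lemma insert_coord_norm t y e : 0 <= e -> `|t| <= e -> `|y| <= e ->
  `|insert_coord t y| <= e.
Proof.
move=> e0 te ye; apply/rv_norm_leP => // i; rewrite mxE.
by case: unliftP => [j _|_//]; exact: le_trans (rv_coord_le _ _) te.
Qed.

Lemma coord_zero_insert t y : coord_zero l (insert_coord t y) = insert_coord t 0.
Proof.
apply/rowP => i; rewrite !mxE; case: unliftP => [j ->|->]; last by rewrite eqxx.
by rewrite eq_sym (negbTE (neq_lift _ _)).
Qed.

Lemma aser_insert e a (Y : 'rV[R]_k -> R) i : 0 <= e -> e <= a ->
  aser e Y a -> aser e (fun t => insert_coord t (Y t) ord0 i) a.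
Proof.
move=> e0 ea Ya; under eq_fun do rewrite mxE.
case: unliftP => [j _|_//]; exact: aser_le (aser_proj j e0) ea.
Qed.

(* Near [0] the equation [F = 0] amounts to [y = g t + y * E (t, y)] where [g]
   and [E] are small; the solution is the sum of the successive differences of
   the iterates of the contraction given by the right hand side. *)
Lemma aser_implicit (F q : 'rV[R]_k.+1 -> R) r C D e0 :
  0 < r -> aser r F C -> aser r q D -> F 0 = 0 -> q 0 != 0 ->
  (forall v, `|v| <= r -> F v = F (coord_zero l v) + v ord0 l * q v) ->
  0 < e0 ->
  exists e a (Y : 'rV[R]_k -> R),
    [/\ 0 < e, e <= a, a <= e0, aser e Y a &
      forall t y, `|t| <= e -> `|y| <= a -> F (insert_coord t y) = 0 -> y = Y t].
Proof.
move=> r0 FC qD F0 q0 FE e00; set c := q 0 in q0.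
(* Writing [q = c + (q - c)] in [F (t, 0) + y * q (t, y) = 0] and dividing by [c] gives
   [y = g t + y * E (t, y)]. *)
pose E v := - c^-1 * (q v - c).
pose g t := - c^-1 * F (insert_coord t 0).
have qa : analytic_at q 0 by apply: analytic_at_aser qD; rewrite normr0.
have ga : analytic_at g 0.
  apply: analytic_atZ; apply: (@analytic_at_comp _ _ _ _ F (insert_coord^~ 0)) => [i|].
    under eq_fun do rewrite mxE; case: unliftP => [j _|_].
      exact: analytic_at_proj.
    exact: analytic_at_cst.
  apply: analytic_at_aser FC; apply: le_lt_trans r0.
  by apply: insert_coord_norm; rewrite ?normr0.
have g0 : g 0 = 0.
  rewrite /g (_ : insert_coord 0 0 = 0) ?F0 ?mulr0//.
  by apply/rowP => i; rewrite !mxE; case: unliftP => [j _|_//]; rewrite mxE.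
have c4 : 0 < `|c| / 4 by rewrite divr_gt0 ?normr_gt0.
have [s s0 [[Es sr] se]] := near_right_ex (nearandP (nearandP
  (analytic_at_small qa c4) (nbhs_right_le r0)) (nbhs_right_le e00)).
have {}Es : aser s E (1 / 4).
  have /(aserZ (- c^-1)) := Es; rewrite normrN normfV mulrA mulVf ?normr_eq0//.
  by under eq_fun do rewrite add0r.
(* The iterates are kept within [a] while [E] is controlled up to [s = 2 * a]: the margin
   [s - a = a] makes the contraction factor [1 / 4 + 1 / 4 = 1 / 2]. *)
pose a := s / 2; have a0 : 0 < a by rewrite divr_gt0.
have sE : s = 2 * a by rewrite /a mulrC divfK.
have as_ : a < s by rewrite sE; lra.
have a4 : 0 < a / 4 by rewrite divr_gt0.
have [e e_gt0 [ge ea]] := near_right_ex (nearandP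
  (analytic_at_small ga a4) (nbhs_right_le a0)).
have {}ge : aser e g (a / 4).
  by move: ge; under eq_fun do rewrite add0r g0 subr0.
have eP := ltW e_gt0; have aP := ltW a0.
pose N (Y : 'rV[R]_k -> R) t := g t + Y t * E (insert_coord t (Y t)).
have contr (Y Y' : 'rV[R]_k -> R) d : 0 <= d -> aser e Y a -> aser e Y' a ->
    aser e (fun t => Y t - Y' t) d -> aser e (fun t => N Y t - N Y' t) (d / 2).
  move=> d0 Ya Y'a Yd.
  have EY : aser e (fun t => E (insert_coord t (Y t))) (1 / 4).
    apply: (aser_comp (ltW s0) _ Es) => i.
    by apply: aser_le (aser_insert i eP ea Ya) _; rewrite ?(ltW as_).
  have dE : aser e (fun t => E (insert_coord t (Y t)) - E (insert_coord t (Y' t)))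
      (d * (1 / 4) / (s - a)).
    apply: aser_comp_sub (Es) => // i; [exact: aser_insert|exact: aser_insert|].
    under eq_fun do rewrite !mxE; case: unliftP => [j _|_//].
    by under eq_fun do rewrite subrr; apply: aser_cst; rewrite normr0.
  have q4 : 0 <= 1 / 4 :> R by rewrite divr_ge0.
  have d4 : 0 <= d * (1 / 4) by rewrite mulr_ge0.
  have ad : 0 <= a * (d * (1 / 4) / a) by rewrite mulr_ge0// divr_ge0.
  have sa : s - a = a by rewrite sE; ring.
  rewrite sa in dE.
  apply: (@aser_le_ext _ _ _ _ (fun t => (Y t - Y' t) *: E (insert_coord t (Y t)) +
     Y' t *: (E (insert_coord t (Y t)) - E (insert_coord t (Y' t)))) _
     (d * (1 / 4) + a * (d * (1 / 4) / a))).
  - exact: addr_ge0.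
  - apply: aserD => //.
      exact: aserM.
    exact: aserM dE.
  - rewrite le_eqVlt; apply/orP; left; apply/eqP; field.
    by rewrite gt_eqF.
  - by move=> t _; rewrite /N /GRing.scale/=; ring.
pose Y_ := fix Y_ p := if p is p'.+1 then N (Y_ p') else fun=> 0.
have h1 p : 0 <= 1 - 2^-1 ^+ p :> R.
  by rewrite subr_ge0 exprn_ile1// invf_le1// ler1n.
have half p : 0 <= 2^-1 ^+ p :> R by rewrite exprn_ge0.
have ha p : a / 2 * (1 - 2^-1 ^+ p) <= a.
  have /(mulr_ge0 aP) := half p; move: (2^-1 ^+ p) => x ax.
  by rewrite mulrBr mulr1; lra.
(* The steps start at the bound [a / 4] of [g] and are halved each time; they add up to at most
   [a / 2], so the iterates never leave the range where [contr] applies. *)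
have YP p : aser e (Y_ p) (a / 2 * (1 - 2^-1 ^+ p)) /\
    aser e (fun t => Y_ p.+1 t - Y_ p t) (a / 4 * 2^-1 ^+ p).
  have Ya p' : aser e (Y_ p') (a / 2 * (1 - 2^-1 ^+ p')) -> aser e (Y_ p') a.
    by move=> Ya; apply: aser_le Ya (ha _); rewrite mulr_ge0// divr_ge0.
  elim: p => [|p [IHY IHd]].
    split; first by apply: aser_cst; rewrite normr0 expr0 subrr mulr0.
    rewrite expr0 mulr1; apply: aser_ext ge _; first exact: ltW.
    by move=> t _; rewrite /= /N mul0r addr0 subr0.
  have YS : aser e (Y_ p.+1) (a / 2 * (1 - 2^-1 ^+ p.+1)).
    have : aser e (fun t => Y_ p t + (Y_ p.+1 t - Y_ p t))
       (a / 2 * (1 - 2^-1 ^+ p) + a / 4 * 2^-1 ^+ p).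
      by apply: aserD => //; apply: mulr_ge0 => //; apply: divr_ge0.
    under eq_fun do rewrite subrKC.
    by congr aser; rewrite exprS; field.
  split => //; rewrite exprSr mulrA.
  by apply: contr; rewrite ?mulr_ge0//; [exact: ltW|exact: Ya YS|exact: Ya IHY].
have Ya p : aser e (Y_ p) a.
  by apply: aser_le (YP p).1 (ha _); rewrite mulr_ge0// divr_ge0.
have sumY t p : series (fun j => Y_ j.+1 t - Y_ j t) p = Y_ p t.
  by rewrite /series/= telescope_sumr// subr0.
have sumC p : \sum_(0 <= j < p) a / 4 * 2^-1 ^+ j <= a.
  have -> : \sum_(0 <= j < p) a / 4 * 2^-1 ^+ j = a / 2 * (1 - 2^-1 ^+ p).
    elim: p => [|p IH]; first by rewrite big_geq// expr0 subrr mulr0.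
    by rewrite big_nat_recr//= IH exprS; field.
  exact: ha.
have Ycvg t : `|t| <= e -> series (fun j => Y_ j.+1 t - Y_ j t) @ \oo -->
    limn (series (fun j => Y_ j.+1 t - Y_ j t)).
  move=> te; apply: cvg_series_bounded sumC => j; exact: aser_norm (YP j).2 te.
exists e, a, (fun t => limn (series (fun j => Y_ j.+1 t - Y_ j t))).
split => //; first by rewrite (le_trans (ltW as_)).
  by apply: aser_sum sumC Ycvg => j; exact: (YP j).2.
(* Uniqueness: a zero with last variable [y] is a fixed point, and the iterates at [t] converge to
   it. *)
move=> t y te ya Fy.
have yN : y = N (fun=> y) t.
  have := FE (insert_coord t y); rewrite coord_zero_insert insert_coord_eq Fy.
  have -> : `|insert_coord t y| <= r.
    apply: le_trans sr; apply: insert_coord_norm; rewrite ?(ltW s0)//.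
      by rewrite (le_trans te)// (le_trans ea)// ltW.
    by rewrite (le_trans ya)// ltW.
  move=> /(_ isT)/esym/eqP; rewrite addr_eq0 => /eqP Fg.
  by rewrite /N /E /g Fg; field.
have Yy p : `|Y_ p t - y| <= 2^-1 ^+ p * `|y|.
  elim: p => [|p IH]; first by rewrite sub0r normrN mul1r.
  have Yt : `|Y_ p t| <= a by exact: aser_norm (Ya p) te.
  (* Applied to the constant functions with values [Y_ p t] and [y], [contr] becomes a pointwise
     contraction, since [N Y t] depends on [Y] only through [Y t]. *)
  have := contr (fun=> Y_ p t) (fun=> y) `|Y_ p t - y| (normr_ge0 _)
    (aser_cst _ Yt) (aser_cst _ ya) (aser_cst _ (lexx _)).
  move=> /aser_norm/(_ te); rewrite -yN exprS -mulrA => /le_trans; apply.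
  by rewrite mulrC ler_wpM2l.
apply: (cvg_unique _ _ (Ycvg _ te)) => //.
rewrite (_ : series _ = Y_ ^~ t); last by apply/funext => p; rewrite sumY.
apply/cvgrPdist_le => d d0.
have h0 : (fun p => 2^-1 ^+ p * `|y|) @ \oo --> 0 * `|y|.
  apply: cvgM; last exact: cvg_cst.
  by apply: cvg_expr; rewrite ger0_norm// invf_lt1// ltr1n.
rewrite mul0r in h0; near=> p; rewrite distrC; apply: le_trans (Yy p) _.
apply: le_trans (ler_norm _) _; rewrite -[X in `|X|]subr0 distrC.
by near: p; exact: cvgr_dist_le.
Unshelve. all: by end_near. Qed.

End implicit_function.

(** * Zero sets of analytic functions *)

Section lindelof.

(** The union is regrouped along the values of an injection of [D] into [nat]; a value that is not
    attained contributes the empty set. It is used for thin, measurable and negligible sets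
    alike. *)
Lemma countable_bigcup_ind T U (Q : set U -> Prop) (D : set T) (S : T -> set U) :
  Q set0 -> (forall F : nat -> set U, (forall i, Q (F i)) -> Q (\bigcup_i F i)) ->
  countable D -> (forall t, D t -> Q (S t)) -> Q (\bigcup_(t in D) S t).
Proof.
move=> Q0 QU /countable_injP[f finj] DS.
have -> : \bigcup_(t in D) S t = \bigcup_i \bigcup_(t in D `&` [set t | f t = i]) S t.
  apply/seteqP; split => [x [t Dt Sx]|x [i _ [t [Dt _] Sx]]]; last by exists t.
  by exists (f t) => //; exists t.
apply: QU => i.
have [[t [Dt ft]]|nt] := pselect (exists t, D t /\ f t = i).
  suff -> : \bigcup_(t in D `&` [set t | f t = i]) S t = S t by exact: DS.
  apply/seteqP; split => [x [u [Du fu] Sx]|x Sx]; last by exists t.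
  by rewrite (finj t u)// ?inE// ft fu.
suff -> : \bigcup_(t in D `&` [set t | f t = i]) S t = set0 by [].
by apply/seteqP; split => [x [u [Du fu] _]|//]; apply: nt; exists u.
Qed.

(** Lindelof's argument: for each basic set contained in some [U t] with [t] in [S], one such [t] is
    chosen. *)
Lemma second_countable_cover (T : topologicalType) (S : set T)
    (U : T -> set T) :
  @second_countable T -> (forall t, S t -> nbhs t (U t)) ->
  exists D, [/\ countable D, D `<=` S & S `<=` \bigcup_(t in D) U t].
Proof.
move=> [B cB [_ Bb]] SU.
have [->|/set0P[x0 Sx0]] := eqVneq S set0.
  by exists set0; split => //; exact: countable0.
have /choice[f fP] : forall b : set T, exists t,
    (exists2 t, S t & b `<=` U t) -> S t /\ b `<=` U t.
  move=> b; have [[t St bt]|nb] := pselect (exists2 t, S t & b `<=` U t).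
    by exists t.
  by exists x0.
exists [set f b | b in B `&` [set b | exists2 t, S t & b `<=` U t]]; split.
- apply: sub_countable (card_image_le _ _) _; apply: sub_countable cB.
  by apply: subset_card_le => b [].
- by move=> _ [b [_ /fP[Sf _]] <-].
- move=> t St; have [b [Bb' bt] bU] := Bb t _ (SU _ St).
  have [Sf bf] := fP b (ex_intro2 _ _ t St bU).
  by exists (f b); [exists b => //; split => //; exists t|exact: bf].
Qed.

Lemma rat_vector_dense (R : realType) n (t : 'rV[R]_n) (e : R) : 0 < e ->
  exists c : 'rV[rat]_n, `|t - map_mx ratr c| < e.
Proof.
move=> e0; have /choice[f fP] : forall i, exists q : rat,
    ratr q \in `]t ord0 i - e / 2, t ord0 i + e / 2[.
  move=> i; have : t ord0 i - e / 2 < t ord0 i + e / 2.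
    by rewrite ltrBlDr -addrA ltrDl addr_gt0// divr_gt0.
  by move=> /rat_in_itvoo[q]; exists q.
exists (\row_i f i); apply: le_lt_trans (_ : e / 2 < e); last first.
  by rewrite ltr_pdivrMr// ltr_pMr// ltr1n.
apply/rv_norm_leP => [|i]; first by rewrite divr_ge0 ?ltW.
by have := fP i; rewrite !mxE in_itv/= => /andP[? ?]; rewrite ler_distlC !ltW.
Qed.

Lemma rv_second_countable (R : realType) n : @second_countable 'rV[R]_n.
Proof.
pose b (p : 'rV[rat]_n * nat) : set 'rV[R]_n :=
  ball (map_mx ratr p.1 : 'rV[R]_n) (p.2.+1%:R^-1).
exists (range b); first exact: sub_countable (card_image_le _ _) (countableP _).
split; first by move=> _ [p _ <-]; exact: ball_open.
move=> x U /nbhs_ballP[e /= e0 xU].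
have [m me] : exists m, m.+1%:R^-1 < e / 2.
  by have [m] := ltr_add_invr (divr_gt0 e0 (ltr0n R 2)); rewrite add0r; exists m.
have m0 : 0 < m.+1%:R^-1 :> R by rewrite invr_gt0.
have [c xc] := rat_vector_dense x m0.
exists (b (c, m)); first by split; [exists (c, m)|rewrite /b -ball_normE/= distrC].
move=> y; rewrite /b -ball_normE/= => cy; apply: xU; rewrite -ball_normE/=.
rewrite -(subrK (map_mx ratr c) x) -addrA.
apply: le_lt_trans (ler_normD _ _) _; rewrite (splitr e).
by rewrite ltrD// (lt_trans _ me).
Qed.

End lindelof.

Section thin.
Context {R : realType} {k : nat}.
Implicit Types (V S : set 'rV[R]_k.+1).

(* Pieces with [e j <= 0] are empty. *)
Definition thin V S : Prop :=
  exists (e : nat -> R) (phi : nat -> 'rV[R]_k -> 'rV[R]_k.+1),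
    (forall j t, `|t| < e j ->
       V (phi j t) /\ forall l, analytic_at (fun u => phi j u ord0 l) t) /\
    S `<=` \bigcup_j (phi j @` [set t | `|t| < e j]).

Lemma sub_thin V S S' : S `<=` S' -> thin V S' -> thin V S.
Proof.
by move=> SS [e [phi [H1 H2]]]; exists e, phi; split => //; exact: subset_trans H2.
Qed.

Lemma thin0 V : thin V set0.
Proof.
exists (fun=> 0), (fun=> fun=> 0); split => // j t.
by rewrite ltNge normr_ge0.
Qed.

Lemma thin_bigcup V (S : nat -> set 'rV[R]_k.+1) :
  (forall i, thin V (S i)) -> thin V (\bigcup_i S i).
Proof.
move=> /choice[e /choice[phi HS]].
pose pair_ j : nat * nat := odflt (0, 0)%N (unpickle j).
exists (fun j => e (pair_ j).1 (pair_ j).2), (fun j => phi (pair_ j).1 (pair_ j).2).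
split; first by move=> j; exact: (HS _).1.
move=> x [i _ /(HS i).2[j _ xj]]; exists (pickle (i, j)) => //.
by rewrite /pair_ pickleK.
Qed.

Lemma thin_countable V (D : set 'rV[R]_k.+1) (S : 'rV[R]_k.+1 -> set 'rV[R]_k.+1) :
  countable D -> (forall t, D t -> thin V (S t)) -> thin V (\bigcup_(t in D) S t).
Proof.
apply: countable_bigcup_ind; [exact: thin0|exact: thin_bigcup].
Qed.

Lemma thin_local V S :
  (forall t, S t -> exists2 U, nbhs t U & thin V (U `&` S)) -> thin V S.
Proof.
move=> SU; have /choice[U UP] : forall t, exists U, S t -> nbhs t U /\ thin V (U `&` S).
  move=> t; have [/SU[U ? ?]|] := pselect (S t); first by exists U.
  by exists set0.
have [D [cD DS SD]] := @second_countable_cover _ S U (@rv_second_countable R k.+1)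
  (fun t St => (UP t St).1).
apply: (@sub_thin _ _ (\bigcup_(t in D) (U t `&` S))).
  by move=> t St; have [u Du Ut] := SD _ St; exists u.
by apply: thin_countable => // t /DS /UP[].
Qed.

End thin.

Section zero_graph.
Context {R : realType}.

Lemma derive_along0 (V W : normedModType R) (f : V -> W) x : 'D_0 f x = 0.
Proof.
rewrite /derive; under eq_fun do rewrite /= scaler0 add0r subrr scaler0.
exact: lim_cst.
Qed.

Context {k : nat}.
Implicit Types (f : 'rV[R]_k.+1 -> R) (V : set 'rV[R]_k.+1).

(** The map [L] is a linear change of variables in which [h] replaces the basis vector of a
    coordinate [l] with [h_l != 0]. In these variables the quotient of [F] by the coordinate [l] has
    the value ['D_h f t0] at the origin, so [aser_implicit] applies. *)
Lemma zero_graph f V t0 h : open V -> V t0 -> analytic_at f t0 -> f t0 = 0 ->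
  'D_h f t0 != 0 ->
  exists (e : R) (phi : 'rV[R]_k -> 'rV[R]_k.+1),
    (forall t, `|t| < e ->
       V (phi t) /\ forall l, analytic_at (fun u => phi u ord0 l) t) /\
    \forall t \near t0, f t = 0 -> (phi @` [set u | `|u| < e]) t.
Proof.
move=> oV Vt0 fa ft0 Dh.
have [l hl] : exists l, h ord0 l != 0.
  apply: contrapT => nh; move/negP: Dh; apply; apply/eqP.
  have -> : h = 0; last exact: derive_along0.
  by apply/rowP => l; rewrite mxE; apply/eqP; apply: contrapT => /negP ?; apply: nh; exists l.
have /nbhs_ballP[d /= d0 dV] : nbhs t0 V by exact: open_nbhs_nbhs.
have h1 : 0 < 1 + `|h| by rewrite ltr_pwDl.
(* Keeps the graph in [V]: its points are at distance at most [e0 * (1 + |h|) = d / 2] from [t0]. *)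
pose e0 := d / 2 / (1 + `|h|).
have e00 : 0 < e0 by rewrite !divr_gt0.
pose L (v : 'rV[R]_k.+1) := coord_zero l v + v ord0 l *: h.
pose F v := f (t0 + L v).
have L0 : L 0 = 0.
  by apply/rowP => i; rewrite !mxE if_same mul0r addr0.
have Fa : analytic_at F 0.
  apply: (@analytic_at_comp _ _ _ _ f (fun v => t0 + L v)); last by rewrite L0 addr0.
  move=> i; have -> : (fun t => (t0 + L t) ord0 i) = (fun t : 'rV[R]_k.+1 =>
      t0 ord0 i + ((if i == l then 0 else t ord0 i) + t ord0 l *: h ord0 i)).
    by apply/funext => t; rewrite !mxE.
  apply: analytic_atD; first exact: analytic_at_cst.
  apply: analytic_atD; first by case: eqP => _; [exact: analytic_at_cst|exact: analytic_at_proj].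
  by apply: analytic_atM; [exact: analytic_at_proj|exact: analytic_at_cst].
have [r [C [r0 FC]]] := Fa.
have {}FC : aser r F C by move: FC; under eq_fun do rewrite add0r.
have F0 : F 0 = 0 by rewrite /F L0 addr0.
have [q qC qE] := aser_div l r0 FC.
have ins0 : insert_coord l (0 : 'rV[R]_k) 0 = 0.
  by apply/rowP => i; rewrite !mxE; case: unliftP => [j _|_//]; rewrite mxE.
have Lins t y : L (insert_coord l t y) = insert_coord l t 0 + y *: h.
  by rewrite /L coord_zero_insert insert_coord_eq.
have q0 : q 0 != 0.
  suff <- : 'D_h f t0 = q 0 by [].
  apply: cvg_lim => //; apply/cvgrPdist_le => e e_gt0.
  have /analytic_at_cont/(@cvgrPdist_le _ _ _ (nbhs (0 : 'rV[R]_k.+1)))/(_ e e_gt0)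
    /nbhs_ballP[s /= s0 qs] : analytic_at q 0.
    by apply: analytic_at_aser qC; rewrite normr0.
  near=> y; have y0 : y != 0 by near: y; exact: nbhs_dnbhs_neq.
  have yr : `|y| <= r by near: y; exact: dnbhs0_le.
  have ys : `|y| < s by near: y; exact: dnbhs0_lt.
  have -> : y^-1 *: (f (y *: h + t0) - f t0) = q (insert_coord l 0 y).
    have := qE (insert_coord l 0 y); rewrite coord_zero_insert ins0 F0 add0r.
    rewrite insert_coord_eq /F Lins ins0 add0r addrC ft0 subr0 => -> .
      by rewrite /GRing.scale/= mulKf.
    by apply: insert_coord_norm; rewrite ?normr0 ?(ltW r0).
  apply: qs; rewrite -ball_normE/= sub0r normrN; apply: le_lt_trans ys.
  by apply: insert_coord_norm; rewrite ?normr0.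
have [e [a [Y [e_gt0 ea ae0 Ya YE]]]] := aser_implicit r0 FC qC F0 q0 qE e00.
exists e, (fun t => t0 + (insert_coord l t 0 + Y t *: h)); split.
  move=> t te; split.
    apply: dV; rewrite -ball_normE/= opprD addNKr normrN.
    apply: le_lt_trans (_ : d / 2 < d); last by rewrite ltr_pdivrMr// ltr_pMr// ltr1n.
    have -> : d / 2 = e0 + e0 * `|h|.
      by rewrite -{1}(mulr1 e0) -mulrDr divfK ?gt_eqF.
    apply: le_trans (ler_normD _ _) _; apply: lerD.
      apply: insert_coord_norm; rewrite ?normr0 ?(ltW e00)//.
      by rewrite (le_trans (ltW te))// (le_trans ea).
    rewrite normrZ ler_wpM2r//; apply: le_trans ae0.
    exact: aser_norm Ya (ltW te).
  move=> i; have -> : (fun u => (t0 + (insert_coord l u 0 + Y u *: h)) ord0 i) =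
      (fun u => t0 ord0 i + ((if unlift l i is Some j then u ord0 j else 0) + Y u *: h ord0 i)).
    by apply/funext => u; rewrite !mxE.
  apply: analytic_atD; first exact: analytic_at_cst.
  apply: analytic_atD.
    by case: unliftP => [j _|_]; [exact: analytic_at_proj|exact: analytic_at_cst].
  apply: analytic_atM; last exact: analytic_at_cst.
  exact: analytic_at_aser te Ya.
(* Bounds the inverse of [L]: with [w = t - t0], both [y = w_l / h_l] and [u], the other coordinates
   of [w - y *: h], are at most [|w| * K]. *)
pose K := 1 + (1 + `|h|) / `|h ord0 l|.
have nhl : 0 < `|h ord0 l| by rewrite normr_gt0.
have K0 : 0 < K by rewrite ltr_pwDl// divr_ge0// ltW.
near=> t => ft.
have tK : `|t - t0| < e / K.
  by rewrite distrC; near: t; apply: cvgr_dist_lt => //; rewrite divr_gt0.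
set w := t - t0 in tK.
pose y := w ord0 l / h ord0 l.
pose u : 'rV[R]_k := \row_j (w ord0 (lift l j) - y * h ord0 (lift l j)).
have wE : w = insert_coord l u 0 + y *: h.
  apply/rowP => i; rewrite [RHS]mxE [insert_coord _ _ _ _ _]mxE [(y *: h) _ _]mxE.
  case: unliftP => [j ->|->]; first by rewrite [u _ _]mxE subrK.
  by rewrite add0r divfK.
have yw : `|y| <= `|w| * (1 / `|h ord0 l|).
  by rewrite normrM normfV mul1r ler_wpM2r ?invr_ge0// rv_coord_le.
have wK : `|w| * K < e by rewrite -ltr_pdivlMr.
have ye : `|y| < e.
  apply: le_lt_trans wK; apply: le_trans yw _; rewrite ler_wpM2l//.
  by rewrite /K mulrDl addrCA lerDl addr_ge0// divr_ge0.
have ue : `|u| < e.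
  apply: le_lt_trans wK; apply/rv_norm_leP => [|j].
    by rewrite mulr_ge0// ltW.
  rewrite mxE; apply: le_trans (ler_normB _ _) _.
  apply: (@le_trans _ _ (`|w| + `|w| * (1 / `|h ord0 l|) * `|h|)).
    apply: lerD; first exact: rv_coord_le.
    by rewrite normrM ler_pM// rv_coord_le.
  rewrite -{1}[`|w|]mulr1 -mulrA -mulrDr ler_wpM2l// lerD2l mulrAC mul1r.
  by rewrite ler_pM2r ?invr_gt0// lerDr.
exists u => //=; rewrite -(YE u y (ltW ue)).
- by rewrite -wE subrKC.
- by rewrite (le_trans (ltW ye)).
- by rewrite /F Lins -wE subrKC.
Unshelve. all: by end_near. Qed.

End zero_graph.

(** * Order of vanishing along a line *)

Section order_of_vanishing.
Context {R : realType}.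

Lemma difference_quotient_line (V : normedModType R) (f : V -> R) x h s :
  (fun u : R => u^-1 *: (((fun u : R => f (x + u *: h)) \o shift s) (u *: 1) -
     f (x + s *: h))) =
  (fun u : R => u^-1 *: ((f \o shift (x + s *: h)) (u *: h) - f (x + s *: h))).
Proof.
apply/funext => u; congr (_ *: (f _ - _)).
by rewrite /= [u *: 1]mulr1 scalerDl addrCA.
Qed.

Lemma derive_line (V : normedModType R) (f : V -> R) x h s :
  'D_1 (fun u : R => f (x + u *: h)) s = 'D_h f (x + s *: h).
Proof. by rewrite /derive difference_quotient_line. Qed.

Lemma derivable_line (V : normedModType R) (f : V -> R) x h s :
  derivable f (x + s *: h) h -> derivable (fun u : R => f (x + u *: h)) s 1.
Proof. by rewrite /derivable difference_quotient_line. Qed.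

Lemma near_line (V : normedModType R) (x h : V) (P : V -> Prop) :
  (\forall v \near x, P v) -> \forall s \near (0 : R), P (x + s *: h).
Proof.
move=> xP; have : (fun s : R => x + s *: h) @ 0 --> x.
  rewrite -[X in _ --> X]addr0 -[X in _ --> _ + X](scale0r h).
  by apply: cvgD; [exact: cvg_cst|apply: cvgZr_tmp; exact: cvg_id].
exact.
Qed.

Context {n : nat}.
Implicit Types (f : 'rV[R]_n -> R).

(** By the product rule, the derivative of [s ^+ q.+1 * psi] is [s ^+ q * psi2], where [psi2] takes
    the nonzero value [q.+1 * psi 0] at the origin; the order drops by one. *)
Lemma iter_derive_neq0 q f x h (psi : 'rV[R]_1 -> R) :
  analytic_at f x -> analytic_at psi 0 -> psi 0 != 0 ->
  (\forall s \near (0 : R), f (x + s *: h) = s ^+ q * psi (s *: const_mx 1)) ->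
  exists2 j, (j <= q)%N & iter j (fun g => 'D_h g) f x != 0.
Proof.
elim: q f psi => [|q IH] f psi fa psia psi0 fE.
  exists 0%N => //=; have := nbhs_singleton fE.
  by rewrite !scale0r addr0 mul1r => ->.
have [_ Dfa] := analytic_at_derive h fa.
have [_ Dpa] := analytic_at_derive (const_mx 1) psia.
pose psi2 (v : 'rV[R]_1) : R :=
  q.+1%:R *: psi v + v ord0 ord0 *: 'D_(const_mx 1) psi v.
have [|||j jq Dj] := IH ('D_h f) psi2 Dfa.
- apply: analytic_atD; first exact: analytic_atZ.
  by apply: analytic_atM => //; exact: analytic_at_proj.
- by rewrite /psi2 mxE scale0r addr0 scaler_eq0 negb_or psi0 pnatr_eq0.
(* To be differentiated at [s], the identity must hold in a neighbourhood of [s]. *)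
- have fE' : \forall s \near (0 : R), \forall u \near s,
      f (x + u *: h) = u ^+ q.+1 * psi (u *: const_mx 1) by exact: near_join.
  near=> s; rewrite -derive_line.
  have psi_s : analytic_at psi (s *: const_mx 1).
    rewrite -[_ *: _]add0r; near: s.
    exact: near_line (analytic_at_near psia).
  have [psid _] := analytic_at_derive (const_mx 1) psi_s.
  rewrite (@near_eq_derive _ _ _ _ ((fun u : R => u ^+ q.+1) *
      (fun u => psi (0 + u *: const_mx 1)))); last first.
    near: s; apply: filterS fE' => s; apply: filterS => u ->.
    by rewrite fctE add0r.
  rewrite deriveM; last first.
  + by apply: derivable_line; rewrite add0r.
  + exact: exprn_derivable.
  rewrite (derive_line psi) exp_derive add0r /psi2 mxE /GRing.scale/= !mxE !mulr1.
  by rewrite exprSr; ring.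
exists j.+1; first by rewrite ltnS.
by rewrite iterSr.
Unshelve. all: by end_near. Qed.

Lemma iter_derive_analytic j f x h :
  analytic_at f x -> analytic_at (iter j (fun g => 'D_h g) f) x.
Proof. by move=> fa; elim: j => //= j /(analytic_at_derive h)[]. Qed.

(** Near [x] there is a point [t] with [f t != 0]. In the direction [h = t - x] the restriction of
    [f] to the line is not zero, so it has a finite order at [x]. *)
Lemma analytic_iter_derive f x V : nbhs x V -> analytic_at f x ->
  (forall U, open U -> U `<=` V -> U !=set0 -> exists2 t, U t & f t != 0) ->
  exists h j, iter j (fun g => 'D_h g) f x != 0.
Proof.
move=> /nbhs_ballP[d /= d0 dV] [r [C [r0 fC]]] fV.
pose e := Num.min r d / 2.
have rd0 : 0 < Num.min r d by rewrite lt_min r0 d0.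
have e0 : 0 < e by rewrite divr_gt0.
have eV : ball x e `<=` V.
  apply: subset_trans dV; apply: le_ball.
  by rewrite /e ler_pdivrMr// mulr2n mulrDr mulr1 ler_wpDr ?(ltW d0)// ge_min lexx orbT.
have er : e < r.
  rewrite /e ltr_pdivrMr// mulr2n mulrDr mulr1 (le_lt_trans (_ : _ <= r))//.
    by rewrite ge_min lexx.
  by rewrite ltrDl.
have [t xt ft] := fV _ (ball_open x e) eV (ex_intro _ x (ballxx x e0)).
pose h := t - x.
have hr : `|h| < r by move: xt; rewrite -ball_normE/= distrC => /lt_trans; exact.
exists h.
have hle : `|h| <= r by exact: ltW.
have [h0|h0] := eqVneq h 0.
  exists 0%N => /=; move: ft; rewrite /h in h0.
  by move/eqP: h0; rewrite subr_eq0 => /eqP ->.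
have nh : 0 < `|h| by rewrite normr_gt0.
(* Since [|h| < r], the parameter [1], which corresponds to [t], lies inside the radius [r1]. *)
pose r1 := r / `|h|; have r10 : 0 < r1 by rewrite divr_gt0.
have gC : aser r1 ((fun v => f (x + v)) \o (fun s : 'rV[R]_1 => s ord0 ord0 *: h)) C.
  apply: aser_comp fC; first exact: ltW.
  move=> l; under eq_fun do rewrite mxE.
  have -> : r = r1 * `|h| by rewrite divfK ?gt_eqF.
  exact/aser_coord/aser_cst/rv_coord_le.
have [/(_ (const_mx 1))|[q [psi [psiC psi0 gE]]]] := aser_order r10 gC.
  rewrite rv1_norm mxE normr1 ltr_pdivlMr// mul1r => /(_ hr) /=.
  by rewrite mxE scale1r /h subrKC => ft0; rewrite ft0 eqxx in ft.
have [||||j _ Dj] := @iter_derive_neq0 q f x h psi.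
- by exists r, C.
- by apply: analytic_at_aser psiC; rewrite normr0.
- by [].
- near=> s; have := gE (s *: const_mx 1).
  rewrite /= !mxE mulr1; apply.
  rewrite rv1_norm !mxE mulr1 -[s]subr0 distrC; near: s.
  exact: cvgr_dist_le.
by exists j.
Unshelve. all: by end_near. Qed.

End order_of_vanishing.

Section analytic_zeros.
Context {R : realType} {k : nat}.
Implicit Types (V : set 'rV[R]_k.+1) (f : 'rV[R]_k.+1 -> R).

Lemma regular_zeros_thin V f g h : open V ->
  (forall t, V t -> analytic_at f t) ->
  (forall t, g t -> 'D_h f t != 0) ->
  thin V (V `&` [set t | f t = 0 /\ g t]).
Proof.
move=> oV fa fg; apply: thin_local => t [Vt [ft /fg Dt]].
have [e [phi [ephi nphi]]] := zero_graph oV Vt (fa _ Vt) ft Dt.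
exists [set u | f u = 0 -> (phi @` [set u | `|u| < e]) u] => //.
exists (fun=> e), (fun=> phi); split => // u [fu [_ [fu0 _]]].
by exists 0%N => //; exact: fu.
Qed.

Lemma analytic_zeros_thin V f : open V ->
  (forall t, V t -> analytic_at f t) ->
  (forall U, open U -> U `<=` V -> U !=set0 -> exists2 t, U t & f t != 0) ->
  thin V (V `&` [set t | f t = 0]).
Proof.
move=> oV fa fV; apply: thin_local => t [Vt /= ft].
have [h [j Dj]] := analytic_iter_derive (open_nbhs_nbhs (conj oV Vt)) (fa _ Vt) fV.
pose D i := iter i (fun g => 'D_h g) f.
have Da i u : V u -> analytic_at (D i) u.
  by move=> Vu; apply: iter_derive_analytic; exact: fa.
exists (V `&` [set u | D j u != 0]).
  apply: filterI; first exact: open_nbhs_nbhs.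
  have Dc := analytic_at_cont (Da j t Vt).
  exact: (cvgr_neq0 _ Dc Dj).
(* With [h] and [j] fixed at [t], [D 0 u = 0] and [D j u != 0] force a switch at some [i]. There [u]
   is a regular zero of [D i], and the graph through it is obtained from [D i], not from [f]. *)
apply: (@sub_thin _ _ _ _ (\bigcup_i (V `&` [set u | D i u = 0 /\ D i.+1 u != 0]))).
  move=> u [[Vu Dju] [_ fu]].
  have [i [Di DSi]] : exists i, D i u = 0 /\ D i.+1 u != 0.
    elim: (j) Dju => [|i IH] /= Di; first by move/eqP: Di.
    have [Diu|/IH//] := eqVneq (D i u) 0.
    by exists i.
  by exists i.
apply: thin_bigcup => i.
exact: (@regular_zeros_thin V (D i) (fun u => D i.+1 u != 0) h oV (Da i)).
Qed.

End analytic_zeros.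

(** * Common zeros of random analytic functions *)

Section power_measure_null.
Context {R : realType} d (T : measurableType d).

Lemma integral_ge0_null (d' : measure_display) (S : measurableType d')
    (mu : {measure set S -> \bar R}) (h : S -> \bar R) (N : set S) :
  measurable_fun setT h -> measurable N -> mu N = 0%E ->
  (forall x, ~ N x -> h x = 0%E) -> (\int[mu]_x h x = 0)%E.
Proof.
move=> mh mN N0 hN; rewrite -[RHS](integral0 mu setT).
apply: ae_eq_integral => //.
exists N; split => // x /= hx; apply: contrapT => /hN hx0; exact: hx.
Qed.

(** Sections at a fixed tail, measured in the first entry. Sigma-finiteness covers both the Lebesgue
    measure and the Gaussian one. *)
Lemma power_measure_null_rest (mu : {sigma_finite_measure set T -> \bar R}) n
    (E : set (n.+1.-tuple T)) (N : set (n.-tuple T)) :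
  measurable E -> measurable N -> power_measure mu n N = 0%E ->
  (forall t, ~ N t -> mu [set x | E [tuple of x :: t]] = 0%E) ->
  power_measure mu n.+1 E = 0%E.
Proof.
move=> mE mN N0 EN; rewrite /= /pushforward.
set A := _ @^-1` E.
have mA : measurable A by rewrite -[A]setTI; exact: measurable_cons.
rewrite /product_measure2.
apply: (@integral_ge0_null _ _ (power_measure mu n) _ N) => //.
  exact: measurable_fun_ysection.
move=> t Nt /=; rewrite -[RHS](EN t Nt); congr (mu _).
by apply/seteqP; split => x /=; rewrite /ysection/= inE.
Qed.

Variable P : probability T R.

(** The opposite order of integration, with the first sample frozen; the two orders agree by
    uniqueness of the product measure. *)
Lemma power_measure_null n (E : set (n.+1.-tuple T)) (N : set T) :
  measurable E -> measurable N -> P N = 0%E ->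
  (forall x, ~ N x -> power_measure P n [set s : n.-tuple T | E [tuple of x :: s]] = 0%E) ->
  power_measure P n.+1 E = 0%E.
Proof.
move=> mE mN N0 EN; rewrite /= /pushforward.
set A := _ @^-1` E.
have mA : measurable A.
  rewrite -[A]setTI; apply: measurable_cons => //.
have pE B C : measurable B -> measurable C ->
    (P \x^ power_measure P n)%E (B `*` C) = (P B * power_measure P n C)%E.
  by move=> mB mC; rewrite product_measure2E.
have /= <- := @product_measure_unique _ _ _ _ _ P (power_measure P n)
   (P \x^ power_measure P n)%E pE A mA.
rewrite /product_measure1; apply: (@integral_ge0_null _ _ _ _ N) => //.
  exact: measurable_fun_xsection.
move=> x Nx /=; rewrite -[RHS](EN x Nx); congr (power_measure P n _).
by apply/seteqP; split => s /=; rewrite /xsection/= inE.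
Qed.

End power_measure_null.

Lemma continuous_at_sum_norm (R : realType) (S : topologicalType) n
    (F : 'I_n -> S -> R) (t : S) :
  (forall i, {for t, continuous (F i)}) ->
  {for t, continuous (fun u => \sum_(i < n) `|F i u|)}.
Proof.
move=> Fc; apply: cvg_big => [|i _]; first exact: add_continuous.
by apply: cvg_norm; exact: Fc.
Qed.

Section common_zeros.
Context {R : realType} {d : measure_display} {T : measurableType d}.
Variable P : probability T R.

Definition common_zeros k n (V : set 'rV[R]_k) (g : 'rV[R]_k -> T -> R) :
    set (n.-tuple T) :=
  [set s | exists2 t, V t & forall i, g t (tnth s i) = 0].

Lemma rat_vector_in k (U : set 'rV[R]_k) : open U -> U !=set0 ->
  exists c : 'rV[rat]_k, U (map_mx ratr c).
Proof.
move=> oU [t Ut]; have /nbhs_ballP[e /= e0 eU] := open_nbhs_nbhs (conj oU Ut).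
have [c tc] := rat_vector_dense t e0.
by exists c; apply: eU; rewrite -ball_normE.
Qed.

Lemma closed_ball_rv_compact k (c : 'rV[R]_k) (e : R) : 0 < e ->
  compact [set t | `|t - c| <= e].
Proof.
move=> e0; apply: bounded_closed_compact.
  exists (`|c| + e); split; first exact: num_real.
  move=> x cx t /= tc; apply: le_trans (ltW cx).
  by rewrite -[t](subrKC c); apply: le_trans (ler_normD _ _) _; rewrite lerD2l.
rewrite (_ : [set t | _] = closed_ball c e); first exact: closed_ball_closed.
by rewrite closed_ballE//; apply/seteqP; split => t /=; rewrite /closed_ball_/= distrC.
Qed.

(* The witnesses may be taken among rational vectors, up to an arbitrarily
   small error, because the closed ball is compact. *)
Lemma measurable_common_zeros k n (V : set 'rV[R]_k) (g : 'rV[R]_k -> T -> R)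
    (c : 'rV[R]_k) (e : R) :
  0 < e -> [set t | `|t - c| <= e] `<=` V ->
  (forall z t, V t -> {for t, continuous (g ^~ z)}) ->
  (forall t, V t -> measurable_fun setT (g t)) ->
  measurable (@common_zeros k n [set t | `|t - c| <= e] g).
Proof.
move=> e0 eV gc gm.
pose h t (s : n.-tuple T) := \sum_(i < n) `|g t (tnth s i)|.
have h0 t s : (forall i, g t (tnth s i) = 0) <-> h t s = 0.
  split=> [gs|/psumr_eq0P hs i]; first by apply: big1 => i _; rewrite gs normr0.
  by apply: normr0_eq0; apply: hs.
have hge0 t s : 0 <= h t s by apply: sumr_ge0.
have hc t s : V t -> {for t, continuous (h ^~ s)}.
  by move=> Vt; apply: continuous_at_sum_norm => i; exact: gc.
pose Q : set 'rV[rat]_k := [set q | `|map_mx ratr q - c| < e].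
have -> : @common_zeros k n [set t | `|t - c| <= e] g =
    \bigcap_m \bigcup_(q in Q) [set s | h (map_mx ratr q) s < m.+1%:R^-1].
  apply/seteqP; split => s.
  - move=> [t /= te /h0 gt0] m _.
    have /(@cvgrPdist_lt _ _ _ (nbhs t)) := hc t s (eV _ te).
    move=> /(_ m.+1%:R^-1); rewrite invr_gt0 ltr0n => /(_ isT).
    move=> /nbhs_ballP[r /= r0 rh].
    pose U := ball t r `&` ball c e.
    have [||q [tq cq]] := @rat_vector_in k U; first by apply: openI; exact: ball_open.
      (* [t] may lie on the boundary of the ball; moving it by the fraction [x] towards the centre
         gives a point of the open ball still within [r] of [t]. *)
      pose x := Num.min 1 (r / (`|t - c| + 1)) / 2.
      have tc1 : 0 < `|t - c| + 1 by rewrite ltr_wpDl.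
      have x0 : 0 < x by rewrite divr_gt0// lt_min ltr01 divr_gt0.
      have x1 : x < 1.
        rewrite /x ltr_pdivrMr// mul1r; apply: le_lt_trans (_ : 1 < 2); last by rewrite ltr1n.
        by rewrite ge_min lexx.
      have xr : x * `|t - c| < r.
        apply: le_lt_trans (_ : x * (`|t - c| + 1) < r); first by rewrite ler_pM2l// lerDl.
        rewrite -ltr_pdivlMr//; apply: lt_le_trans (_ : x * 2 <= _).
          by rewrite mulr2n mulrDr mulr1 ltrDl.
        by rewrite divfK// ge_min lexx orbT.
      exists (t - x *: (t - c)); split; rewrite -ball_normE/=.
        by rewrite opprB addrC subrK normrZ gtr0_norm.
      rewrite distrC (_ : _ - c = (1 - x) *: (t - c)).
        rewrite normrZ gtr0_norm ?subr_gt0//.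
        apply: le_lt_trans (_ : (1 - x) * e < e); first by rewrite ler_wpM2l// subr_ge0 ltW.
        by rewrite gtr_pMl// ltrBlDr ltrDl.
      by rewrite scalerBl scale1r addrAC.
    exists q; first by rewrite /Q/= distrC; move: cq; rewrite -ball_normE.
    have := rh _ tq; rewrite /= gt0 sub0r normrN; exact: le_lt_trans (ler_norm _).
  - move=> sQ.
    have ne : [set t | `|t - c| <= e] !=set0 by exists c; rewrite /= subrr normr0 ltW.
    (* The minimum of [h] over the ball is attained and lies below every [1 / (m + 1)], so it is a
       common zero. *)
    have [] := @compact_EVT_min _ R (h ^~ s) [set t | `|t - c| <= e] ne.
    + exact: closed_ball_rv_compact.
    + by apply: continuous_in_subspaceT => t /set_mem te; apply: hc; exact: eV.
    + move=> t /set_mem te tmin; exists t => //; apply/h0/eqP.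
      rewrite eq_le hge0 andbT; apply/ler_addgt0Pl => r r0; rewrite addr0.
      have [m] := ltr_add_invr r0; rewrite add0r => mr.
      have [q /= Qq hq] := sQ m I.
      apply: le_trans (ltW mr); apply: le_trans (ltW hq).
      by apply: tmin; rewrite inE /= ltW.
apply: bigcap_measurable => [|m _]; first by exists 0%N.
apply: countable_bigcup_ind => //.
- by move=> F mF; exact: bigcup_measurable.
- move=> q Qq.
  have mh : measurable_fun setT (h (map_mx ratr q)).
    apply: measurable_sum => i; apply: measurableT_comp => //.
    apply: measurableT_comp; last exact: measurable_tnth.
    by apply: gm; apply: eV; exact: ltW.
  rewrite (_ : [set s | _] = setT `&` h (map_mx ratr q) @^-1` `]-oo, m.+1%:R^-1[).
    exact: mh.
  by rewrite setTI; apply/seteqP; split => s /=; rewrite in_itv.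
Qed.

End common_zeros.

Arguments common_zeros {R d T k} n V g.

Section common_zeros_null.
Context {R : realType} {d : measure_display} {T : measurableType d}.
Variable P : probability T R.

Lemma negligible_measurable0 (d' : measure_display) (S : measurableType d')
    (mu : {measure set S -> \bar R}) (N : set S) :
  measurable N -> mu.-negligible N -> mu N = 0%E.
Proof. by move=> mN /negligibleP; exact. Qed.

Lemma negligible_countable (d' : measure_display) (S : measurableType d')
    (mu : {measure set S -> \bar R}) (I : Type) (D : set I) (F : I -> set S) :
  countable D -> (forall i, D i -> mu.-negligible (F i)) ->
  mu.-negligible (\bigcup_(i in D) F i).
Proof.
apply: countable_bigcup_ind; first exact: negligible_set0.
by move=> G; exact: negligible_bigcup.
Qed.


(** One sample [z] is integrated out: what remains are the common zeros of the other samples inside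
    the zero set of [g (-, z)]. Dimension zero and the inductive step both rest on this
    reduction. *)
Lemma common_zeros_section k n (V : set 'rV[R]_k) (g : 'rV[R]_k -> T -> R) :
  open V ->
  (forall z t, V t -> {for t, continuous (g ^~ z)}) ->
  (forall t, V t -> measurable_fun setT (g t)) ->
  (forall t, V t -> P [set z | g t z = 0] = 0%E) ->
  (forall z,
    (forall U, open U -> U `<=` V -> U !=set0 -> exists2 t, U t & g t z != 0) ->
    (power_measure P n).-negligible
      (common_zeros n (V `&` [set t | g t z = 0]) g)) ->
  (power_measure P n.+1).-negligible (common_zeros n.+1 V g).
Proof.
move=> oV gc gm g0 gz.
have mz t : V t -> measurable [set z | g t z = 0].
  move=> Vt; have := gm t Vt measurableT [set 0] (measurable_set1 _).
  by rewrite setTI.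
pose N := \bigcup_(q in [set q : 'rV[rat]_k | V (map_mx ratr q)])
  [set z | g (map_mx ratr q) z = 0].
have mN : measurable N.
  apply: countable_bigcup_ind => //; first by move=> F mF; exact: bigcup_measurable.
  by move=> q; exact: mz.
have N0 : P N = 0%E.
  apply: negligible_measurable0 => //; apply: negligible_countable => // q Vq.
  by apply/negligibleP; [exact: mz|exact: g0].
have nz z U : ~ N z -> open U -> U `<=` V -> U !=set0 ->
    exists2 t, U t & g t z != 0.
  move=> Nz oU UV U0; have [q Uq] := rat_vector_in oU U0.
  exists (map_mx ratr q) => //; apply/eqP => gq; apply: Nz; exists q => //.
  exact: UV.
(* Closed balls inside [V]: over each of them the set of common zeros is measurable, as Fubini's
   theorem requires. *)
have /choice[e eP] : forall t, exists e : R, V t ->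
    0 < e /\ [set u | `|u - t| <= e] `<=` V.
  move=> t; have [Vt|] := pselect (V t); last by exists 0.
  have /nbhs_ballP[e /= e0 eV] := open_nbhs_nbhs (conj oV Vt).
  exists (e / 2); split; rewrite ?divr_gt0// => u /= ut; apply: eV.
  by rewrite -ball_normE/= distrC (le_lt_trans ut)// ltr_pdivrMr// ltr_pMr// ltr1n.
have [|D [cD DV VD]] := @second_countable_cover _ V (fun t => [set u | `|u - t| <= e t])
    (@rv_second_countable R k).
  move=> t /eP[et _]; apply/nbhs_ballP; exists (e t) => // u.
  by rewrite -ball_normE/= distrC => /ltW.
apply: (@negligibleS _ _ _ _ (\bigcup_(t in D)
    common_zeros n.+1 [set u | `|u - t| <= e t] g)).
  by move=> s [t /VD[u Du tu] gt]; exists u => //; exists t.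
apply: negligible_countable => // t /DV Vt.
have [et eV] := eP t Vt.
have mE := @measurable_common_zeros R d T k n.+1 V g t (e t) et eV gc gm.
apply/negligibleP => //; apply: power_measure_null (mE) mN N0 _ => z Nz.
apply: negligible_measurable0.
  rewrite -[X in measurable X]setTI; apply: measurable_cons mE => //.
apply: negligibleS (gz z _); last by move=> U; exact: nz.
move=> s [u /= ut gu]; exists u.
  by split; [exact: eV|have := gu ord0].
by move=> i; have := gu (lift ord0 i); rewrite tnthS.
Qed.

(** [n], [V] and [g] are generalised, since each piece comes with its own ball and its own function
    [g (phi j t)]. The strict inequality [k < n] leaves a sample for dimension zero. *)
Lemma common_zeros_negligible k : forall n (V : set 'rV[R]_k) (g : 'rV[R]_k -> T -> R),
  (k < n)%N -> open V ->
  (forall z t, V t -> analytic_at (g ^~ z) t) ->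
  (forall t, V t -> measurable_fun setT (g t)) ->
  (forall t, V t -> P [set z | g t z = 0] = 0%E) ->
  (power_measure P n).-negligible (common_zeros n V g).
Proof.
elim: k => [|k IH] [//|n] V g kn oV ga gm g0;
  (apply: common_zeros_section => //; first by move=> z t Vt; exact/analytic_at_cont/ga);
  move=> z gz.
  (* In dimension zero [V] has at most one point, and [g (-, z)] does not vanish there. *)
  apply: negligibleS (negligible_set0 _) => s [t [Vt gtz] _].
  have [u Vu] := gz V oV (@subset_refl _ V) (ex_intro _ t Vt).
  by rewrite (_ : u = t) ?gtz ?eqxx//; apply/rowP; case.
have [e [phi [ephi phiS]]] := analytic_zeros_thin oV (ga z) gz.
apply: (@negligibleS _ _ _ _ (\bigcup_j common_zeros n [set t | `|t| < e j]
    (fun t => g (phi j t)))).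
  by move=> s [t /phiS[j _ [u uj <-]] gs]; exists j => //; exists u.
apply: negligible_bigcup => j; apply: IH.
- by [].
- rewrite (_ : [set t | _] = ball 0 (e j)); first exact: ball_open.
  by rewrite -ball_normE; apply/seteqP; split => t /=; rewrite sub0r normrN.
- move=> z' t /ephi[Vt phia]; exact: (analytic_at_comp phia (ga z' _ Vt)).
- by move=> t /ephi[Vt _]; exact: gm.
- by move=> t /ephi[Vt _]; exact: g0.
Qed.

End common_zeros_null.

(** * The law of independent samples *)

Section law_of_samples.
Context {R : realType} {d : measure_display} {T : measurableType d}.

Definition tuple_box n (B : 'I_n -> set T) : set (n.-tuple T) :=
  [set t | forall i, B i (tnth t i)].

Lemma measurable_tuple_box n (B : 'I_n -> set T) :
  (forall i, measurable (B i)) -> measurable (tuple_box B).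
Proof.
move=> mB; have -> : tuple_box B = \bigcap_(i in [set: 'I_n])
    ((fun t => tnth t i) @^-1` B i).
  by apply/seteqP; split => t /= h i; [move=> _|]; exact: h.
apply: fin_bigcap_measurable => // i _.
by rewrite -[X in measurable X]setTI; exact: measurable_tnth.
Qed.

(** Uniqueness of measures needs a generating family stable under intersection. Boxes are, whereas
    conditions on a single entry are not; the latter are boxes with all other sides full. *)
Lemma measurable_tuple_boxE n : @measurable _ (n.-tuple T) =
  <<s [set A | exists2 B : 'I_n -> set T,
         (forall i, measurable (B i)) & A = tuple_box B] >>.
Proof.
apply/seteqP; split; last first.
  apply: smallest_sub; first exact: sigma_algebra_measurable.
  by move=> _ [B mB ->]; exact: measurable_tuple_box.
apply: smallest_sub; first exact: smallest_sigma_algebra.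
rewrite -bigcup_seq => A [i _ [B mB <-]]; apply: sub_sigma_algebra.
exists (dfwith (fun=> setT) i B) => [j|].
  by have [<-|ij] := eqVneq i j; rewrite ?dfwithin// dfwithout.
rewrite setTI; apply/seteqP; split => t /=.
  move=> Bt j; have [<-|ij] := eqVneq i j; first by rewrite dfwithin.
  by rewrite dfwithout.
by move=> /(_ i); rewrite dfwithin.
Qed.

Context {d' : measure_display} {Omega : measurableType d'}.
Variables (P : probability Omega R) (nu : probability T R).

Lemma independent_samples_law n (z : 'I_n -> {RV P >-> T}) (E : set (n.-tuple T)) :
  independent_samples nu z -> measurable E ->
  P [set w | E [tuple z i w | i < n]] = power_measure nu n E.
Proof.
move=> [zlaw zind] mE.
have mf : measurable_fun setT (fun w => [tuple z i w | i < n]).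
  apply/measurable_fun_tnthP => i.
  rewrite (_ : _ \o _ = z i); first exact: measurable_funPT.
  by apply/funext => w /=; rewrite tnth_mktuple.
pose X : {mfun Omega >-> n.-tuple T} := mfun_Sub (mem_set mf).
have -> : P [set w | E [tuple z i w | i < n]] = distribution P X E by [].
apply: (@measure_unique _ R _ [set A | exists2 B : 'I_n -> set T,
         (forall i, measurable (B i)) & A = tuple_box B] (fun=> setT)) => //.
- exact: measurable_tuple_boxE.
- move=> _ _ [B mB ->] [C mC ->]; exists (fun i => B i `&` C i).
    by move=> i; exact: measurableI.
  apply/seteqP; split=> t /=; first by move=> [Bt Ct] i; split; [exact: Bt|exact: Ct].
  by move=> BC; split => i; have [] := BC i.
- by move=> _; exists (fun=> setT) => //; apply/seteqP; split.
- by rewrite bigcup_const//; exists 0%N.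
- move=> _ [B mB ->]; apply: etrans; last exact: esym (power_measureE nu mB).
  transitivity (P (\bigcap_i (z i @^-1` B i))).
    congr (P _); apply/seteqP; split => w /= H i.
      by move=> _; have := H i; rewrite tnth_mktuple.
    by rewrite tnth_mktuple; exact: H.
  by rewrite zind//; apply: eq_bigr => i _; exact: zlaw.
- move=> _; apply: (@le_lt_trans _ _ 1%E); last exact: ltry.
  exact: probability_le1.
Qed.

Lemma independent_samples_negligible n (z : 'I_n -> {RV P >-> T})
    (E : set (n.-tuple T)) :
  independent_samples nu z -> (power_measure nu n).-negligible E ->
  P.-negligible [set w | E [tuple z i w | i < n]].
Proof.
move=> zi [N [mN N0 EN]]; exists [set w | N [tuple z i w | i < n]]; split.
- rewrite -[X in measurable X]setTI.
  have mf : measurable_fun setT (fun w => [tuple z i w | i < n]).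
    apply/measurable_fun_tnthP => i.
    rewrite (_ : _ \o _ = z i); first exact: measurable_funPT.
    by apply/funext => w /=; rewrite tnth_mktuple.
  exact: mf.
- by rewrite independent_samples_law.
- by move=> w; exact: EN.
Qed.

End law_of_samples.

(** * Analytic maps between Banach spaces *)

Section multilinear_theory.
Context {K : numFieldType} {j : nat} {U V : lmodType K}.
Variable f : ('I_j -> U) -> V.
Hypothesis fl : multilinear f.

Lemma dfwith_id (x : 'I_j -> U) i : dfwith x i (x i) = x.
Proof. by apply/funext => l; case: dfwithP. Qed.

Lemma multilinear0 x i : f (dfwith x i 0) = 0.
Proof.
have := fl x i 1 0 0; rewrite !scale1r addr0 => /eqP.
by rewrite eq_sym -subr_eq0 addrK => /eqP.
Qed.

(** The slots are changed one at a time along a list without repetition, which is finally taken to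
    be all of ['I_j]. The other multilinear arguments below use the same device. *)
Lemma multilinear_scale (x : 'I_j -> U) (c : 'I_j -> K) :
  f (fun i => c i *: x i) = (\prod_i c i) *: f x.
Proof.
have H (s : seq 'I_j) : uniq s ->
    f (fun i => if i \in s then c i *: x i else x i) =
    (\prod_(i <- s) c i) *: f x.
  elim: s => [_|i s IH /= /andP[si us]]; first by rewrite big_nil scale1r.
  pose y := fun l => if l \in s then c l *: x l else x l.
  have -> : (fun l => if l \in i :: s then c l *: x l else x l) =
      dfwith y i (c i *: x i + 0).
    apply/funext => l; rewrite inE; case: dfwithP => [|l' il'].
      by rewrite eqxx addr0.
    by rewrite eq_sym (negbTE il').
  rewrite fl multilinear0 addr0 big_cons -scalerA -IH//.
  congr (_ *: f _); apply/funext => l; case: dfwithP => // .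
  by rewrite (negbTE si).
have := H (index_enum 'I_j) (index_enum_uniq _).
move=> <-; congr f; apply/funext => i.
by rewrite mem_index_enum.
Qed.

End multilinear_theory.

Lemma cvg_ptws (I : eqType) (V : topologicalType) (y : nat -> I -> V) (g : I -> V) :
  (forall i, (fun n => y n i) @ \oo --> g i) ->
  (y : nat -> {ptws I -> V}) @ \oo --> (g : {ptws I -> V}).
Proof.
move=> yg; apply/cvg_sup => i U [W] [[B] oB <-] Bg WU.
have yB : \forall n \near \oo, B (y n i) by exact: yg i B (open_nbhs_nbhs (conj oB Bg)).
suff : \forall n \near \oo, U (y n) by [].
by apply: filterS yB => n Bn; exact: WU.
Qed.

Section real_multilinear.
Context {R : realType} {j : nat} {U V : normedModType R}.
Variable f : ('I_j -> U) -> V.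
Hypothesis fl : multilinear f.

(** Continuity at the origin suffices: unbounded values on the polyball, after scaling the arguments
    by [1 / (n + 1)], would stay away from [f 0] along a sequence tending to zero. *)
Lemma multilinear_bounded : continuous (f : {ptws 'I_j -> U} -> V) ->
  has_ubound [set `|f x| | x in unit_polyball U j].
Proof.
move=> fc; apply: contrapT => nb.
(* The factor [n.+1 ^+ j] is the cost of the scaling; the term [|f 0|] covers [j = 0], where [f] is
   a constant that may be nonzero. *)
have /choice[x xP] : forall n : nat, exists x, unit_polyball U j x /\
    n.+1%:R ^+ j * (1 + `|f (fun=> 0)|) < `|f x|.
  move=> n; apply: contrapT => nx; apply: nb.
  exists (n.+1%:R ^+ j * (1 + `|f (fun=> 0)|)) => _ [x x1 <-].
  by rewrite leNgt; apply/negP => xn; apply: nx; exists x.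
pose y n i := n.+1%:R^-1 *: x n i.
have : (y : nat -> {ptws 'I_j -> U}) @ \oo --> ((fun=> 0) : {ptws 'I_j -> U}).
  apply: cvg_ptws => i; apply/cvgrPdist_le => e e0; near=> n.
  rewrite sub0r normrN normrZ ger0_norm ?invr_ge0//.
  apply: (@le_trans _ _ n.+1%:R^-1); first by rewrite ler_piMr ?invr_ge0//; exact: (xP n).1.
  by apply/ltW; near: n; exact: (near_infty_natSinv_lt (PosNum e0)).
move=> /(cvg_comp _ _)/(_ (fc _))/cvgr_norm_lt/(_ (1 + `|f (fun=> 0)|)).
rewrite ltrDr ltr01 => /(_ isT)[n _ /(_ n (leqnn _))] /=.
apply/negP; rewrite -leNgt.
rewrite /y multilinear_scale// prodr_const card_ord normrZ ger0_norm ?exprn_ge0 ?invr_ge0//.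
by rewrite exprVn ler_pdivlMl ?exprn_gt0// ltW// (xP n).2.
Unshelve. all: by end_near. Qed.

Lemma multinorm_ge0 : continuous (f : {ptws 'I_j -> U} -> V) -> 0 <= multinorm f.
Proof.
move=> /multilinear_bounded fb.
apply: (le_trans (normr_ge0 (f (fun=> 0)))); apply: ub_le_sup => //.
by exists (fun=> 0) => // i; rewrite normr0.
Qed.

Lemma multinorm_le x : continuous (f : {ptws 'I_j -> U} -> V) ->
  `|f x| <= multinorm f * \prod_i `|x i|.
Proof.
move=> fc; have [[i xi0]|nx] := pselect (exists i, x i = 0).
  by rewrite -(dfwith_id x i) xi0 multilinear0// normr0 mulr_ge0 ?multinorm_ge0 ?prodr_ge0.
have x0 i : x i != 0 by apply/eqP => xi0; apply: nx; exists i.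
have -> : x = (fun i => `|x i| *: (`|x i|^-1 *: x i)).
  by apply/funext => i; rewrite scalerA divff ?scale1r// normr_eq0.
rewrite multilinear_scale// normrZ mulrC; apply: ler_pM => //.
  apply: ub_le_sup; first exact: multilinear_bounded.
  exists (fun i => `|x i|^-1 *: x i) => // i.
  by rewrite normrZ normfV normr_id mulVf// normr_eq0.
rewrite ger0_norm ?prodr_ge0// le_eqVlt; apply/orP; left; apply/eqP.
by apply: eq_bigr => i _; rewrite scalerA divff ?scale1r// normr_eq0.
Qed.

Lemma aser_multilinear n r (psi : 'rV[R]_n -> U) (C K : R) :
  0 <= C -> 0 <= K -> (forall x, `|f x| <= K * \prod_i `|x i|) ->
  aser r psi C -> aser r (fun t => f (fun=> psi t)) (K * C ^+ j).
Proof.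
move=> C0 K0 fK psiC.
have H (s : seq 'I_j) : uniq s -> forall v : 'I_j -> U,
    aser r (fun t => f (fun i => if i \in s then psi t else v i))
      (K * \prod_i (if i \in s then C else `|v i|)).
  elim: s => [_ v|i s IH /= /andP[si us] v].
    exact: (@aser_cst _ _ _ _ _ _ (fK v)).
  pose y t l := if l \in s then psi t else v l.
  have -> : (fun t => f (fun l => if l \in i :: s then psi t else v l)) =
      (fun t => f (dfwith (y t) i (psi t))).
    apply/funext => t; congr f; apply/funext => l; rewrite inE.
    case: dfwithP => [|l' il']; first by rewrite eqxx.
    by rewrite eq_sym (negbTE il').
  pose K' := K * \prod_(l < j | l != i) (if l \in i :: s then C else `|v l|).
  have -> : K * \prod_l (if l \in i :: s then C else `|v l|) = K' * C.
    by rewrite /K' (bigD1 i)//= inE eqxx/= mulrA mulrAC.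
  apply: (@aser_apply _ _ _ _ _ (fun t u => f (dfwith (y t) i u))) psiC.
  - by rewrite mulr_ge0// prodr_ge0// => l _; case: ifP.
  - by move=> t c u u'; exact: fl.
  - move=> u; have := IH us (dfwith v i u).
    rewrite (bigD1 i)//= (negbTE si) dfwithin mulrCA mulrC.
    rewrite (_ : \prod_(_ < _ | _) _ = \prod_(l < j | l != i) (if l \in i :: s then C else `|v l|)).
      congr aser; apply/funext => t; congr f; apply/funext => l.
      have [<-|il] := eqVneq i l; first by rewrite !dfwithin (negbTE si).
      by rewrite !dfwithout.
    by apply: eq_bigr => l li; rewrite inE (negbTE li) dfwithout// eq_sym.
have := H (index_enum 'I_j) (index_enum_uniq _) (fun=> 0).
congr aser.
  by apply/funext => t; congr f; apply/funext => i; rewrite mem_index_enum.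
congr (_ * _); under eq_bigr do rewrite mem_index_enum.
by rewrite prodr_const card_ord.
Qed.

End real_multilinear.

(** The expansion of [G] at [phi t0] is applied to the increment of [phi]: each homogeneous term is
    an [aser] function, and the summability of the expansion of [G] bounds their sum. *)
Lemma real_analytic_comp (R : realType) (Y1 Y2 : normedModType R) (U : set Y1)
    (G : Y1 -> Y2) n (phi : 'rV[R]_n -> Y1) t0 :
  real_analytic U G -> analytic_at phi t0 -> U (phi t0) ->
  analytic_at (G \o phi) t0.
Proof.
move=> Ga phia /Ga[rho [rho0 [Gj [Gjl Gjs GjE]]]].
(* The expansion is given for [|h| < rho] only, so the increment of [phi] is kept within
   [rho / 2]. *)
have rho20 : 0 < rho / 2 by rewrite divr_gt0.
have rho2 : rho / 2 < rho by rewrite ltr_pdivrMr// ltr_pMr// ltr1n.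
have [r r0 psiC] := near_right_ex (analytic_at_small phia rho20).
pose c j := multinorm (Gj j) * rho ^+ j.
have c0 j : 0 <= c j.
  by have [Gl _ Gc] := Gjl j; rewrite mulr_ge0 ?multinorm_ge0 ?exprn_ge0 ?ltW.
exists r, (limn (series c)); split => //.
apply: (@aser_sum _ _ _ _ (fun j t => Gj j (fun=> phi (t0 + t) - phi t0))
   (fun j => multinorm (Gj j) * (rho / 2) ^+ j)).
- move=> j; have [Gl _ Gc] := Gjl j.
  apply: aser_multilinear psiC => //; first exact: ltW.
    exact: multinorm_ge0.
  by move=> x; exact: multinorm_le.
- move=> k; apply: (@le_trans _ _ (series c k)); last first.
    by apply: nondecreasing_cvgn_le => //; apply: nondecreasing_series.
  apply: ler_sum => j _; have [Gl _ Gc] := Gjl j.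
  rewrite ler_wpM2l ?multinorm_ge0//.
  by rewrite lerXn2r ?nnegrE ?ltW.
- move=> t tr; have := aser_norm psiC tr => /le_lt_trans/(_ rho2)/GjE[_].
  by rewrite subrKC.
Qed.

(** * Lebesgue measure of analytic zero sets *)

(** It makes open sets of a product measurable for the product sigma-algebra. Once the members of
    [B] are numbered, the boxes are indexed by [{ffun 'I_n -> nat}], which is countable. *)
Lemma measurable_tuple_basis d (T : measurableType d) n (B : set (set T))
    (S : set (n.-tuple T)) :
  countable B -> (forall b, B b -> measurable b) ->
  (forall t, S t -> exists b : 'I_n -> set T,
     [/\ forall i, B (b i), forall i, b i (tnth t i) & tuple_box b `<=` S]) ->
  measurable S.
Proof.
move=> /countable_injP[f finj] mB SB.
pose b (j : nat) := \bigcup_(U in B `&` [set U | f U = j]) U.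
have bE U : B U -> b (f U) = U.
  move=> BU; apply/seteqP; split => [x [W [BW fW] Wx]|x Ux]; last by exists U.
  by rewrite -(finj W U) ?inE.
have mb j : measurable (b j).
  have [[U [BU <-]]|nU] := pselect (exists U, B U /\ f U = j).
    by rewrite bE//; exact: mB.
  suff -> : b j = set0 by [].
  by apply/seteqP; split => // x [U [BU fU] _]; apply: nU; exists U.
have -> : S = \bigcup_(g in [set g : {ffun 'I_n -> nat} | tuple_box (b \o g) `<=` S])
    tuple_box (b \o g).
  apply/seteqP; split => [t St|t [g gS]]; last exact: gS.
  have [U [BU Ut US]] := SB t St.
  have UE : tuple_box (b \o [ffun i => f (U i)]) = tuple_box U.
    by congr tuple_box; apply/funext => i; rewrite /= ffunE bE.
  by exists [ffun i => f (U i)]; rewrite /= UE.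
apply: countable_bigcup_ind => //.
- by move=> F mF; exact: bigcup_measurable.
- by move=> g _; apply: measurable_tuple_box => i; exact: mb.
Qed.

Section lebesgue_null.
Context {R : realType}.
Local Notation mu := (@lebesgue_measure R).

Lemma measurable_row_of_tuple q (V : set 'rV[R]_q) : open V ->
  measurable ([set t | V (row_of_tuple t)] : set (q.-tuple (measurableTypeR R))).
Proof.
move=> oV.
pose ib (p : rat * nat) : set R := ball (ratr p.1 : R) (p.2.+1%:R^-1).
apply: (@measurable_tuple_basis _ (measurableTypeR R) _ (range ib)).
- exact: sub_countable (card_image_le _ _) (countableP _).
- by move=> _ [p _ <-]; apply: open_measurable; exact: ball_open.
move=> t Vt; have /nbhs_ballP[e /= e0 eV] := open_nbhs_nbhs (conj oV Vt).
have [m] := ltr_add_invr (divr_gt0 e0 (ltr0n R 2)); rewrite add0r => me.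
have m0 : 0 < m.+1%:R^-1 :> R by rewrite invr_gt0.
have [c tc] := rat_vector_dense (row_of_tuple t) m0.
exists (fun i => ib (c ord0 i, m)); split.
- by move=> i; exists (c ord0 i, m).
- move=> i; rewrite /ib -ball_normE/= distrC.
  apply: le_lt_trans tc; have := rv_coord_le (row_of_tuple t - map_mx ratr c) i.
  by rewrite !mxE.
move=> s sb /=; apply: eV; rewrite -ball_normE/=.
apply: le_lt_trans (_ : m.+1%:R^-1 + m.+1%:R^-1 < e); last first.
  by rewrite (splitr e) ltrD.
apply/rv_norm_leP => [|i]; first by rewrite addr_ge0// ltW.
rewrite -[_ - _](subrKA (map_mx ratr c)) mxE.
apply: le_trans (ler_normD _ _) _; apply: lerD.
  by apply: le_trans (rv_coord_le _ _) (ltW tc).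
by have := sb i; rewrite /ib -ball_normE/= !mxE => /ltW.
Qed.

Lemma row_of_tuple_cons q (x : R) (t : q.-tuple R) :
  row_of_tuple [tuple of x :: t] = insert_coord ord0 (row_of_tuple t) x.
Proof.
apply/rowP => i; rewrite !mxE; case: unliftP => [j ->|->]; last by [].
by rewrite tnthS mxE.
Qed.

(** The radius [r / 3] comes from recentring at [w]: the new radius [r - |w|] exceeds [2 * r / 3],
    hence the distance from [w] to [v], and the identity theorem carries the vanishing near [w] over
    to [v]. *)
Lemma aser_nonvanishing n (r C : R) (F : 'rV[R]_n -> R) v :
  0 < r -> aser r F C -> `|v| < r / 3 -> F v != 0 ->
  forall U, open U -> U `<=` ball 0 (r / 3) -> U !=set0 ->
    exists2 t, U t & F t != 0.
Proof.
move=> r0 FC vr Fv U oU Ur [w Uw].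
have wr : `|w| < r / 3 by have := Ur _ Uw; rewrite -ball_normE/= sub0r normrN.
apply: contrapT => nU.
have FU t : U t -> F t = 0.
  by move=> Ut; apply/eqP; apply: contrapT => /negP Ft; apply: nU; exists t.
have rw : 0 < r - `|w| by lra.
have FwC : aser (r - `|w|) (fun t => F (w + t)) C.
  by apply: aser_recenter FC; [exact: ltW|rewrite addrC subrK].
move/eqP: Fv; apply; rewrite -[v](subrKC w).
apply: (aser_identity rw FwC); last first.
  by apply: le_lt_trans (ler_normB _ _) _; lra.
have /nbhs_ballP[e /= e0 eU] := open_nbhs_nbhs (conj oU Uw).
apply/nbhs_ballP; exists e => // t; rewrite -ball_normE/= sub0r normrN => te.
by apply: FU; apply: eU; rewrite -ball_normE/= opprD addNKr normrN.
Qed.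

(** In one variable the thin pieces are images of the one-point space [R^0]. *)
Lemma aser_zeros_countable (r C : R) (F : 'rV[R]_1 -> R) v :
  0 < r -> aser r F C -> `|v| < r / 3 -> F v != 0 ->
  countable [set t | `|t| < r / 3 /\ F t = 0].
Proof.
move=> r0 FC vr Fv.
have r3 : r / 3 < r by lra.
have [e [phi [_ phiS]]] := @analytic_zeros_thin R 0 (ball 0 (r / 3)) F (ball_open _ _)
  (fun t (tr : ball 0 (r / 3) t) => ltac:(by apply: analytic_at_aser FC;
     apply: lt_trans r3; move: tr; rewrite -ball_normE/= sub0r normrN))
  (aser_nonvanishing r0 FC vr Fv).
apply: (@sub_countable _ _ _ (\bigcup_j [set phi j 0])).
  apply: subset_card_le => t [tr Ft].
  have [|j _ [u _ <-]] := phiS t; first by split; rewrite // -ball_normE/= sub0r normrN.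
  by exists j => //=; congr (phi j _); apply/rowP; case.
by apply: bigcup_countable => // j _; exact: countable1.
Qed.

Lemma measurable_zeros_row_of_tuple q (V : set 'rV[R]_q) (f : 'rV[R]_q -> R) :
  open V -> (forall t, V t -> {for t, continuous f}) ->
  measurable ([set t | V (row_of_tuple t) /\ f (row_of_tuple t) = 0]
    : set (q.-tuple (measurableTypeR R))).
Proof.
move=> oV fc; pose U := V `&` [set t | f t != 0].
have oU : open U.
  rewrite openE => t [Vt ft]; apply: filterI; first exact: open_nbhs_nbhs.
  exact: (cvgr_neq0 _ (fc t Vt) ft).
rewrite (_ : [set t | _] = [set t | V (row_of_tuple t)] `\` [set t | U (row_of_tuple t)]).
  by apply: measurableD; exact: measurable_row_of_tuple.
apply/seteqP; split => t /=.
  by move=> [Vt ft]; split => // -[_]; rewrite /= ft eqxx.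
by move=> [Vt nU]; split => //; apply/eqP; apply: contrapT => /negP ft; apply: nU.
Qed.

Lemma open_translate (W : normedModType R) (a : W) (U : set W) :
  open U -> open ((fun x => x + a) @^-1` U).
Proof.
by apply: open_comp => x _; apply: cvgD; [exact: cvg_id|exact: cvg_cst].
Qed.

Lemma power_lebesgue0 q (E : set (q.+1.-tuple (measurableTypeR R)))
    (N : set (q.-tuple (measurableTypeR R))) :
  measurable E -> measurable N -> power_measure mu q N = 0%E ->
  (forall t, ~ N t -> countable [set x : R | E [tuple of x :: t]]) ->
  power_measure mu q.+1 E = 0%E.
Proof.
move=> mE mN N0 EN; apply: power_measure_null_rest mE mN N0 _ => t Nt.
exact: countable_lebesgue_measure0 (EN t Nt).
Qed.

(** Locally, take [v] with [F v != 0] and freeze the first coordinate at [hd v]. The resulting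
    function of the tail is not zero, so by induction it is nonzero at almost every tail; over such
    a tail, [F] as a function of the first coordinate is nonzero at [hd v] and has countably many
    zeros. *)
Lemma analytic_zeros_lebesgue0 q : forall (V : set 'rV[R]_q) (f : 'rV[R]_q -> R),
  open V -> (forall t, V t -> analytic_at f t) ->
  (forall U, open U -> U `<=` V -> U !=set0 -> exists2 t, U t & f t != 0) ->
  power_measure mu q [set t | V (row_of_tuple t) /\ f (row_of_tuple t) = 0] = 0%E.
Proof.
elim: q => [|q IH] V f oV fa fV.
  rewrite (_ : [set t | _] = set0) ?measure0//.
  apply/seteqP; split => // t [Vt ft].
  have [u _] := fV V oV (@subset_refl _ V) (ex_intro _ _ Vt).
  by rewrite (_ : u = row_of_tuple t) ?ft ?eqxx//; apply/rowP; case.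
have /choice[rad rP] : forall t0, exists r, V t0 -> 0 < r /\ ball t0 r `<=` V /\
    exists C, aser r (fun t => f (t0 + t)) C.
  move=> t0; have [Vt0|] := pselect (V t0); last by exists 0.
  have [r [C [r0 fC]]] := fa _ Vt0.
  have /nbhs_ballP[e /= e0 eV] := open_nbhs_nbhs (conj oV Vt0).
  exists (Num.min r e); split; first by rewrite lt_min r0.
  split; first by apply: subset_trans eV; apply: le_ball; rewrite ge_min lexx orbT.
  exists C; apply: aser_restrict fC; first by rewrite le_min !ltW.
  by rewrite ge_min lexx.
have [t Vt|D [cD DV VD]] := @second_countable_cover _ V (fun t => ball t (rad t / 3))
    (@rv_second_countable R _).
  by have [r0 _] := rP t Vt; apply: nbhsx_ballx; rewrite divr_gt0.
apply: (@negligible_measurable0 R _ _ (power_measure mu q.+1)).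
  by apply: measurable_zeros_row_of_tuple => // t Vt; exact/analytic_at_cont/fa.
apply: (@negligibleS _ _ _ _ (\bigcup_(t0 in D)
    ([set t | ball t0 (rad t0 / 3) (row_of_tuple t) /\ f (row_of_tuple t) = 0]
     : set (q.+1.-tuple (measurableTypeR R))))).
  by move=> t [/VD[t0 Dt0 tt0] ft]; exists t0.
apply: negligible_countable => // t0 /DV Vt0.
have [r0 [rV [C fC]]] := rP _ Vt0; set r := rad t0 in r0 rV fC *.
have r3 : r / 3 < r by lra.
have r30 : 0 < r / 3 by lra.
set F := fun t => f (t0 + t) in fC.
have mE : measurable ([set t | ball t0 (r / 3) (row_of_tuple t) /\ f (row_of_tuple t) = 0]
     : set (q.+1.-tuple (measurableTypeR R))).
  apply: measurable_zeros_row_of_tuple; first exact: ball_open.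
  by move=> t tr; apply/analytic_at_cont/fa/rV; apply: le_ball tr; exact: ltW.
apply/negligibleP => //.
have [_ [v vr <-] Fv] : exists2 t, ((fun v => t0 + v) @` ball 0 (r / 3)) t & f t != 0.
  have [||t tr ft] := fV (ball t0 (r / 3)) (ball_open _ _).
  - by apply: subset_trans rV; apply: le_ball; exact: ltW.
  - by exists t0; exact: ballxx.
  exists t => //; exists (t - t0); last by rewrite subrKC.
  by move: tr; rewrite -!ball_normE/= sub0r normrN distrC.
rewrite -/(F v) in Fv.
have {}vr : `|v| < r / 3 by move: vr; rewrite -ball_normE/= sub0r normrN.
pose hd (u : 'rV[R]_q.+1) : R := u ord0 ord0.
pose tl (u : 'rV[R]_q.+1) : 'rV[R]_q := \row_j u ord0 (lift ord0 j).
have tl_le u : `|tl u| <= `|u|.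
  by apply/rv_norm_leP => // j; rewrite mxE rv_coord_le.
have hdtl u : u = insert_coord ord0 (tl u) (hd u).
  by apply/rowP => i; rewrite mxE; case: unliftP => [j ->|->//]; rewrite mxE.
pose g w := F (insert_coord ord0 w (hd v)).
have gC : aser r g C.
  apply: (aser_comp (ltW r0) _ fC) => l; under eq_fun do rewrite mxE.
  case: unliftP => [j _|_]; first exact/aser_proj/ltW.
  by apply: aser_cst; apply: le_trans (rv_coord_le _ _) _; rewrite ltW// (lt_trans vr).
have gtl : g (tl v) != 0 by rewrite /g -hdtl.
have tlr : `|tl v| < r / 3 by exact: le_lt_trans (tl_le v) vr.
pose N : set (q.-tuple (measurableTypeR R)) :=
  [set t | ball (tl t0) (r / 3) (row_of_tuple t) /\ g (row_of_tuple t - tl t0) = 0].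
have ga t : ball (tl t0) (r / 3) t -> analytic_at (fun t => g (t - tl t0)) t.
  rewrite -ball_normE/= distrC => tr.
  apply: (@analytic_at_comp _ _ _ _ g (fun t => t - tl t0)) => [l|].
    under eq_fun do rewrite !mxE.
    by apply: analytic_atB; [exact: analytic_at_proj|exact: analytic_at_cst].
  by apply: analytic_at_aser gC; exact: lt_trans r3.
apply: (@power_lebesgue0 q _ N mE).
- apply: (@measurable_zeros_row_of_tuple q (ball (tl t0) (r / 3)) (fun t => g (t - tl t0))).
    exact: ball_open.
  by move=> t tr; exact/analytic_at_cont/ga.
- apply: (IH (ball (tl t0) (r / 3)) (fun t => g (t - tl t0))) => //; first exact: ball_open.
  move=> U oU Ur [w Uw].
  have := aser_nonvanishing r0 gC tlr gtl.
  move=> /(_ ((fun t => t + tl t0) @^-1` U)) [].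
  + exact: open_translate.
  + by move=> x /Ur; rewrite -!ball_normE/= opprD addrCA subrr addr0 sub0r.
  + by exists (w - tl t0); rewrite /= subrK.
  by move=> x Ux gx; exists (x + tl t0); rewrite // addrK.
- move=> t Nt.
  (* A row lies in the ball only if its tail does, so the section over any other tail is empty. *)
  have [tr|ntr] := pselect (ball (tl t0) (r / 3) (row_of_tuple t)); last first.
    apply: (@sub_countable _ _ _ set0); last exact: countable0.
    apply: subset_card_le => x [xr _]; apply: ntr; move: xr.
    rewrite row_of_tuple_cons -!ball_normE/=; apply: le_lt_trans.
    apply: le_trans (tl_le _); rewrite le_eqVlt; apply/orP; left; apply/eqP; congr (`|_|).
    by apply/rowP => j; rewrite !mxE liftK !mxE.
  have {Nt} gt : g (row_of_tuple t - tl t0) != 0.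
    by apply/eqP => gt; apply: Nt.
  set w := row_of_tuple t - tl t0 in gt.
  have wr : `|w| < r / 3 by move: tr; rewrite -ball_normE/= distrC.
  pose G (s : 'rV[R]_1) := F (insert_coord ord0 w (s ord0 ord0)).
  have GC : aser r G C.
    apply: (aser_comp (ltW r0) _ fC) => l; under eq_fun do rewrite mxE.
    case: unliftP => [j _|_]; last exact/aser_proj/ltW.
    by apply: aser_cst; apply: le_trans (rv_coord_le _ _) _; rewrite ltW// (lt_trans wr).
  have cG := @aser_zeros_countable r C G (const_mx (hd v)) r0 GC.
  have {}cG : countable [set s | `|s| < r / 3 /\ G s = 0].
    apply: cG.
      by rewrite rv1_norm mxE; apply: le_lt_trans vr; exact: rv_coord_le.
    by rewrite /G mxE.
  apply: (@sub_countable _ _ _ ((fun s : 'rV[R]_1 => s ord0 ord0 + hd t0) @`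
      [set s | `|s| < r / 3 /\ G s = 0])); last exact: sub_countable (card_image_le _ _) cG.
  apply: subset_card_le => x [xr fx]; exists (const_mx (x - hd t0)); last first.
    by rewrite mxE subrK.
  have E : insert_coord ord0 w (x - hd t0) = row_of_tuple [tuple of x :: t] - t0.
    rewrite row_of_tuple_cons {2}(hdtl t0); apply/rowP => i; rewrite !mxE.
    by case: unliftP => [j _|_]; rewrite ?mxE.
  split; last by rewrite /G mxE E /F subrKC.
  rewrite rv1_norm mxE; move: xr; rewrite -ball_normE/= distrC -E.
  by apply: le_lt_trans; have := rv_coord_le (insert_coord ord0 w (x - hd t0)) ord0;
    rewrite insert_coord_eq.
Qed.

End lebesgue_null.

(** * Sampling on an analytic manifold *)

Definition scalar_im (R : realType) (k : scalar_kind) : scalar_field R k -> R :=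
  match k with
  | RealScalars => fun _ => 0
  | ComplexScalars => fun x => complex.Im x
  end.
Arguments scalar_im {R k}.

Section scalars.
Context {R : realType} {k : scalar_kind}.
Local Notation K := (scalar_field R k).
Local Notation KR := (real_scalar R k).

Lemma scalar_eqP (x y : K) :
  x = y <-> scalar_re x = scalar_re y /\ scalar_im x = scalar_im y.
Proof.
split=> [->//|]; move: x y; rewrite /scalar_im.
by case: (k) => [x y []//|[a b] [c e] /= [-> ->]].
Qed.

Lemma scalar_re_linear : linear (scalar_re : KR -> R).
Proof.
move=> a u v; rewrite /GRing.scale/= /GRing.scale/=; case: k u v => //= -[u1 u2] [v1 v2] /=.
by rewrite mul0r subr0.
Qed.

Lemma scalar_im_linear : linear (scalar_im : KR -> R).
Proof.
move=> a u v; rewrite /scalar_im /GRing.scale/= /GRing.scale/=.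
case: k u v => //= [u v|[u1 u2] [v1 v2]] /=; first by rewrite mulr0 addr0.
by rewrite mul0r addr0.
Qed.

Lemma scalar_re_le_norm (u : KR) : `|scalar_re u| <= 1 * `|u|.
Proof.
rewrite mul1r; change (`|scalar_re u| <= scalar_re `|u : K|).
case: k u => [//|[a b]]; rewrite /scalar_re (normc_def (a +i* b)%C)/=.
by rewrite -sqrtr_sqr ler_wsqrtr// lerDl sqr_ge0.
Qed.

Lemma scalar_im_le_norm (u : KR) : `|scalar_im u| <= 1 * `|u|.
Proof.
rewrite mul1r; change (`|scalar_im u| <= scalar_re `|u : K|).
case: k u => [u|[a b]].
  by rewrite /scalar_im /scalar_re normr0; exact: normr_ge0.
rewrite /scalar_re /scalar_im (normc_def (a +i* b)%C)/=.
by rewrite -sqrtr_sqr ler_wsqrtr// lerDr sqr_ge0.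
Qed.

End scalars.

Lemma measurable_fun_superlevel (R : realType) d (T : measurableType d) (D : set T)
    (f : T -> R) :
  (forall x, measurable (D `&` [set t | x < f t])) -> measurable_fun D f.
Proof.
move=> mf; apply: (measurability _ (RGenOInfty.measurableE R)).
move=> _ [_ [x ->] <-]; rewrite (_ : _ @^-1` _ = [set t | x < f t])//.
by apply/seteqP; split => t /=; rewrite in_itv/= andbT.
Qed.

(** * Zero sets of analytic functions on a connected manifold *)

Section manifold_null.
Context {R : realType} {Z : ptopologicalType} {q : nat}.
Variables (atlas : set (chart R Z q)).
Hypothesis atlasP : analytic_atlas atlas.

Lemma chart_map_cont c z : atlas c -> chart_dom c z ->
  {for z, continuous (chart_map c)}.
Proof.
have [_ _ cP _ _] := atlasP => /cP[oD _ [_ _ _ _ [mc _]]] Dz.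
by move: mc; rewrite continuous_open_subspace// => /(_ z (mem_set Dz)).
Qed.

Lemma chart_inv_cont c t : atlas c -> chart_img c t ->
  {for t, continuous (chart_inv c)}.
Proof.
have [_ _ cP _ _] := atlasP => /cP[_ oI [_ _ _ _ [_ ic]]] It.
by move: ic; rewrite continuous_open_subspace// => /(_ t (mem_set It)).
Qed.

Lemma chart_mapK c z : atlas c -> chart_dom c z -> chart_inv c (chart_map c z) = z.
Proof. by have [_ _ cP _ _] := atlasP => /cP[_ _ [_ _ mK _ _]] Dz; rewrite mK ?inE. Qed.

Lemma chart_invK c t : atlas c -> chart_img c t -> chart_map c (chart_inv c t) = t.
Proof. by have [_ _ cP _ _] := atlasP => /cP[_ _ [_ _ _ iK _]] It; rewrite iK ?inE. Qed.

Lemma chart_map_img c z : atlas c -> chart_dom c z -> chart_img c (chart_map c z).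
Proof. by have [_ _ cP _ _] := atlasP => /cP[_ _ [mf _ _ _ _]]; exact: mf. Qed.

Lemma chart_inv_dom c t : atlas c -> chart_img c t -> chart_dom c (chart_inv c t).
Proof. by have [_ _ cP _ _] := atlasP => /cP[_ _ [_ ifun _ _ _]]; exact: ifun. Qed.

Lemma chart_dom_nbhs c z : atlas c -> chart_dom c z -> nbhs z (chart_dom c).
Proof. by have [_ _ cP _ _] := atlasP => /cP[oD _ _] Dz; exact: open_nbhs_nbhs. Qed.

Lemma chart_img_nbhs c t : atlas c -> chart_img c t -> nbhs t (chart_img c).
Proof. by have [_ _ cP _ _] := atlasP => /cP[_ oI _] Dz; exact: open_nbhs_nbhs. Qed.

Variable g : Z -> R.
Hypothesis ga : forall c t, atlas c -> chart_img c t ->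
  analytic_at (g \o chart_inv c) t.

Lemma manifold_analytic_cont : continuous g.
Proof.
have [_ _ _ cov _] := atlasP => z; have [c ac Dz] := cov z.
have fc := analytic_at_cont (ga ac (chart_map_img ac Dz)).
have gc : (g \o chart_inv c) \o chart_map c @ z --> (g \o chart_inv c) (chart_map c z).
  exact: (cvg_comp _ _ (chart_map_cont ac Dz) fc).
move: gc; rewrite /= chart_mapK// => gc; apply: cvg_trans gc.
apply: near_eq_cvg; apply: filterS (chart_dom_nbhs ac Dz) => u Du /=.
by rewrite chart_mapK.
Qed.

(** The set [W] of points near which [g] vanishes is open, and it is closed: in a chart at a point
    of its closure, [aser_nonvanishing] spreads the vanishing from a nearby point of [W] to a whole
    ball. By connectedness a nonempty [W] would contain [z0]. *)
Lemma manifold_nonvanishing z0 : connected [set: Z] -> g z0 != 0 ->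
  forall z : Z, ~ nbhs z [set u | g u = 0].
Proof.
have [_ _ _ cov _] := atlasP => Zc gz0 z nz.
pose W : set Z := [set z : Z | nbhs z [set u | g u = 0]].
suff WT : W = setT.
  have : W z0 by rewrite WT.
  by move=> /nbhs_singleton/eqP; rewrite (negbTE gz0).
apply: Zc; first by exists z.
  exists W; last by rewrite setTI.
  by rewrite openE => u Wu; exact: nbhs_interior.
exists W; last by rewrite setTI.
move=> u clu; have [c ac Du] := cov u.
set t := chart_map c u; have It : chart_img c t by exact: chart_map_img.
have [r [C [r0 fC]]] := ga ac It.
have [e /= e0 eI] := (nbhs_ballP _ _).1 (chart_img_nbhs ac It).
pose s := Num.min r e; have s0 : 0 < s by rewrite lt_min r0.
have sr : s <= r by rewrite ge_min lexx.
have se : s <= e by rewrite ge_min lexx orbT.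
have {}fC := aser_restrict (ltW s0) sr fC.
have s30 : 0 < s / 3 by rewrite divr_gt0.
have near_t : \forall u' \near u, chart_dom c u' /\ ball t (s / 3) (chart_map c u').
  apply: filterI; first exact: chart_dom_nbhs.
  exact: (chart_map_cont ac Du (nbhsx_ballx _ _ s30)).
have [u1 [Wu1 [Du1 tu1]]] := clu _ near_t.
suff F0 v : `|v| < s / 3 -> g (chart_inv c (t + v)) = 0.
  apply: filterS near_t => u' [Du' tu'] /=.
  rewrite -(chart_mapK ac Du') -[chart_map c u'](subrKC t); apply: F0.
  by move: tu'; rewrite -ball_normE/= distrC.
move=> vs; apply/eqP; apply: contrapT => /negP Fv.
pose U := [set v : 'rV[R]_q | g (chart_inv c (t + v)) = 0]° `&` ball 0 (s / 3).
have [|||v' [/interior_subset /= -> _]] := @aser_nonvanishing R q s C _ v s0 fC vs Fv U.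
- by apply: openI; [exact: open_interior|exact: ball_open].
- by move=> ? [].
- exists (chart_map c u1 - t); split; last first.
    by move: tu1; rewrite -!ball_normE/= sub0r normrN distrC.
  have I1 := chart_map_img ac Du1.
  have : \forall y \near chart_map c u1, g (chart_inv c y) = 0.
    have := chart_inv_cont ac I1.
    by rewrite /prop_for /continuous_at chart_mapK// => /(_ _ Wu1).
  move=> /nbhs_ballP[d /= d0 dW]; apply/nbhs_ballP; exists d => // y.
  rewrite -ball_normE/= => yd; apply: dW; rewrite -ball_normE/=.
  by rewrite opprD addrA.
- by rewrite eqxx.
Qed.

End manifold_null.

Lemma borel_open_measurable (T : ptopologicalType) (U : set T) : open U ->
  measurable (U : set (borel T)).
Proof. by move=> oU; exact: sub_sigma_algebra. Qed.

Lemma borel_continuous_measurable (R : realType) (T : ptopologicalType) (g : T -> R) :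
  continuous g -> measurable_fun setT (g : borel T -> R).
Proof.
move=> gc; apply: measurable_fun_superlevel => x; rewrite setTI.
apply: (@borel_open_measurable T (g @^-1` [set y | x < y])).
by apply: open_comp; [move=> t _; exact: gc|exact: open_gt].
Qed.

Section manifold_zeros.
Context {R : realType} {Z : ptopologicalType} {q : nat}.
Variables (atlas : set (chart R Z q)).
Hypothesis atlasP : analytic_atlas atlas.
Variable g : Z -> R.
Hypothesis ga : forall c t, atlas c -> chart_img c t ->
  analytic_at (g \o chart_inv c) t.
Variables (vol : {measure set (borel Z) -> \bar R}).
Hypothesis volP : smooth_positive_volume atlas vol.

Lemma measurable_manifold_zeros U : open U ->
  measurable ([set z | U z /\ g z = 0] : set (borel Z)).
Proof.
move=> oU; have gc := manifold_analytic_cont atlasP ga.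
have mg := borel_continuous_measurable gc.
rewrite (_ : [set z | _] = (U : set (borel Z)) `&` (setT `&` g @^-1` [set 0])).
  by apply: measurableI; [exact: borel_open_measurable|exact: mg].
by rewrite setTI.
Qed.

Lemma manifold_zeros_vol0 c z0 : connected [set: Z] -> g z0 != 0 -> atlas c ->
  vol [set z | chart_dom c z /\ g z = 0] = 0%E.
Proof.
move=> Zc gz0 ac; have [_ _ cP _ _] := atlasP; have [oD oI _] := cP c ac.
have [rho [/(_ 0%N) rhoc _ volE]] := volP ac.
rewrite volE; [|exact: measurable_manifold_zeros|by move=> z []].
pose N : set (q.-tuple (measurableTypeR R)) := [set t | chart_img c (row_of_tuple t) /\
  (g \o chart_inv c) (row_of_tuple t) = 0].
rewrite (_ : [set t | _] = N); last first.
  apply/seteqP; split => t /=.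
    move=> [z [Dz gz] zt]; rewrite /N/= -zt (chart_mapK atlasP)//.
    by split => //; exact: (chart_map_img atlasP).
  move=> [It gt]; exists (chart_inv c (row_of_tuple t)); last exact: (chart_invK atlasP).
  by split => //; exact: (chart_inv_dom atlasP).
have mN : measurable N.
  apply: (@measurable_zeros_row_of_tuple R q (chart_img c) (g \o chart_inv c)) => // t It.
  by apply: analytic_at_cont; exact: ga.
apply: null_set_integral => //.
  apply/measurable_EFinP.
  have It : measurable ([set t | chart_img c (row_of_tuple t)] : set (q.-tuple (measurableTypeR R))).
    exact: measurable_row_of_tuple.
  apply: (measurable_funS It) => [t []//|].
  apply: measurable_fun_superlevel => x.
  rewrite (_ : _ `&` _ = [set t | (chart_img c `&` [set t | x < rho t]) (row_of_tuple t)])//.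
  apply: measurable_row_of_tuple.
  move: rhoc; rewrite /= continuous_open_subspace// => rhoc.
  rewrite openE => t [It' xt]; apply: filterI; first exact: open_nbhs_nbhs.
  exact: (rhoc t (mem_set It') [set y | x < y] (open_nbhs_nbhs (conj (@open_gt R x) xt))).
apply: (@analytic_zeros_lebesgue0 R q (chart_img c) (g \o chart_inv c)) => //.
  by move=> t It; exact: ga.
move=> U oU UI [t Ut]; apply: contrapT => nU.
have It := UI _ Ut.
apply: (manifold_nonvanishing atlasP ga Zc gz0 (z := chart_inv c t)).
have : \forall z \near chart_inv c t, chart_dom c z /\ U (chart_map c z).
  apply: filterI; first exact/(chart_dom_nbhs atlasP)/(chart_inv_dom atlasP).
  have := chart_map_cont atlasP ac (chart_inv_dom atlasP ac It).
  rewrite /prop_for /continuous_at (chart_invK atlasP)// => /(_ U); apply.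
  exact: open_nbhs_nbhs.
apply: filterS => z [Dz Uz] /=; rewrite -(chart_mapK atlasP ac Dz).
by apply/eqP; apply: contrapT => /negP gz; apply: nU; exists (chart_map c z).
Qed.

(** Second countability leaves countably many charts, in each of which the zero set is null for
    [vol]; absolute continuity transfers this to [mu]. *)
Lemma manifold_zeros_null (mu : probability (borel Z) R) z0 :
  connected [set: Z] -> g z0 != 0 -> mu `<< vol ->
  measurable ([set z | g z = 0] : set (borel Z)) /\ mu [set z | g z = 0] = 0%E.
Proof.
move=> Zc gz0 mv.
have mE : measurable ([set z | g z = 0] : set (borel Z)).
  rewrite (_ : [set z | g z = 0] = [set z | setT z /\ g z = 0]).
    by apply: measurable_manifold_zeros; exact: openT.
  by apply/seteqP; split => z //= [].
split => //; apply: (mv [set z | g z = 0]) => //.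
apply/measure0_null_setP => //.
have [_ sc _ cov _] := atlasP.
have /choice[c cP] : forall z, exists c, atlas c /\ chart_dom c z.
  by move=> z; have [c ac Dz] := cov z; exists c.
have [z _|D [cD _ TD]] := second_countable_cover sc (S := setT)
    (U := fun z => chart_dom (c z)).
  by have [ac Dz] := cP z; exact: (chart_dom_nbhs atlasP).
apply: negligible_measurable0 => //.
apply: (@negligibleS _ _ _ _ (\bigcup_(z in D)
  ([set z' | chart_dom (c z) z' /\ g z' = 0] : set (borel Z)))).
  by move=> z gz; have [z' Dz' zz'] := TD z I; exists z'.
apply: negligible_countable => // z _; have [ac _] := cP z.
apply/negligibleP; last exact: manifold_zeros_vol0 Zc gz0 ac.
by apply: measurable_manifold_zeros; have [_ _ cP' _ _] := atlasP; have [] := cP' _ ac.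
Qed.

End manifold_zeros.

(** The common interface of the two architectures. Analyticity is asked at a fixed sample and along
    finite-dimensional parametrisations, with no joint regularity in the point and the sample. *)
Definition generic_sampling (R : realType) (k : scalar_kind)
    (X : completeNormedModType R) (A M : set X) (d : measure_display)
    (Zs : measurableType d) (nu : probability Zs R)
    (m : X -> Zs -> scalar_field R k) : Prop :=
  [/\ forall a, A a -> measurable_fun setT (scalar_re \o m a) /\
                       measurable_fun setT (scalar_im \o m a),
      forall a1 a2, (A `&` M) a1 -> (A `&` M) a2 -> a1 <> a2 ->
        nu [set z | m a1 z = m a2 z] = 0%E &
      forall z n (phi : 'rV[R]_n -> X) t, A (phi t) -> analytic_at phi t ->
        analytic_at (fun u => scalar_re (m (phi u) z)) t /\
        analytic_at (fun u => scalar_im (m (phi u) z)) t].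

Section analytic_at_scalar.
Context {R : realType} {k : scalar_kind}.

Lemma analytic_at_scalar n (f : 'rV[R]_n -> real_scalar R k) t :
  analytic_at f t ->
  analytic_at (fun u => scalar_re (f u)) t /\
  analytic_at (fun u => scalar_im (f u)) t.
Proof.
move=> fa; split.
  exact: (analytic_at_linear ler01 (@scalar_re_linear R k) (@scalar_re_le_norm R k) fa).
exact: (analytic_at_linear ler01 (@scalar_im_linear R k) (@scalar_im_le_norm R k) fa).
Qed.

Lemma analytic_at_pair (X Y : normedModType R) n (f : 'rV[R]_n -> X)
    (g : 'rV[R]_n -> Y) t :
  analytic_at f t -> analytic_at g t -> analytic_at (fun u => (f u, g u)) t.
Proof.
move=> fa ga.
have -> : (fun u => (f u, g u)) = (fun u => ((f u, 0) : X * Y) + ((0, g u) : X * Y)).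
  by apply/funext => u; congr pair; rewrite /= ?addr0 ?add0r.
apply: analytic_atD.
  apply: (analytic_at_linear (B := fun x => (x, 0) : X * Y) ler01 _ _ fa).
    by move=> a u v; congr pair; rewrite /= ?scaler0 ?addr0.
  by move=> x; rewrite prod_normE/= normr0 mul1r max_l.
apply: (analytic_at_linear (B := fun x => (0, x) : X * Y) ler01 _ _ ga).
  by move=> a u v; congr pair; rewrite /= ?scaler0 ?addr0.
by move=> x; rewrite prod_normE/= normr0 mul1r max_r.
Qed.

Lemma analytic_at_sum (W : normedModType R) n p (f : 'I_p -> 'rV[R]_n -> W) t :
  (forall i, analytic_at (f i) t) -> analytic_at (fun u => \sum_i f i u) t.
Proof.
move=> fa; elim: (index_enum _) => [|i s IH].
  by under eq_fun do rewrite big_nil; exact: analytic_at_cst.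
by under eq_fun do rewrite big_cons; exact: analytic_atD.
Qed.

Lemma analytic_at_id n (t : 'rV[R]_n) : analytic_at (fun u => u) t.
Proof.
have -> : (fun u : 'rV[R]_n => u) = (fun u => \sum_(l < n) u ord0 l *: delta_mx ord0 l).
  by apply/funext => u; exact: row_sum_delta.
apply: analytic_at_sum => l.
by apply: analytic_atM; [exact: analytic_at_proj|exact: analytic_at_cst].
Qed.

Lemma real_analytic_at n (W : normedModType R) (V : set 'rV[R]_n) (f : 'rV[R]_n -> W) t :
  real_analytic V f -> V t -> analytic_at f t.
Proof. by move=> fa; exact: (real_analytic_comp fa (analytic_at_id t)). Qed.

End analytic_at_scalar.

Lemma analytic_sampling_generic (R : realType) (k : scalar_kind)
    (X : completeNormedModType R) (A M : set X) (Z : ptopologicalType) (q : nat)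
    (atlas : set (chart R Z q)) (vol : {measure set (borel Z) -> \bar R})
    (mu : probability (borel Z) R) (m : X -> borel Z -> scalar_field R k) :
  analytic_atlas atlas -> connected [set: Z] -> smooth_positive_volume atlas vol ->
  mu `<< vol -> real_analytic_prod atlas A (m : X -> Z -> real_scalar R k) ->
  (forall a1 a2, (A `&` M) a1 -> (A `&` M) a2 -> a1 <> a2 ->
     exists z, m a1 z <> m a2 z) ->
  generic_sampling A M mu m.
Proof.
move=> atP Zc volP mv ma minj.
have mchart c a t : atlas c -> A a -> chart_img c t ->
    analytic_at (fun u => m a (chart_inv c u) : real_scalar R k) t.
  move=> ac Aa It.
  exact: (real_analytic_comp (ma c ac)
    (analytic_at_pair (analytic_at_cst a t) (analytic_at_id t))).
have rea a : A a -> forall c t, atlas c -> chart_img c t ->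
    analytic_at ((fun z => scalar_re (m a z)) \o chart_inv c) t.
  by move=> Aa c t ac It; have [] := analytic_at_scalar (mchart c a t ac Aa It).
have ima a : A a -> forall c t, atlas c -> chart_img c t ->
    analytic_at ((fun z => scalar_im (m a z)) \o chart_inv c) t.
  by move=> Aa c t ac It; have [] := analytic_at_scalar (mchart c a t ac Aa It).
split.
- move=> a Aa; split; apply: borel_continuous_measurable.
    exact: (manifold_analytic_cont atP (rea a Aa)).
  exact: (manifold_analytic_cont atP (ima a Aa)).
- move=> a1 a2 a1A a2A a12; have [z0 mz0] := minj a1 a2 a1A a2A a12.
  have [A1 _] := a1A; have [A2 _] := a2A.
  pose gre z := scalar_re (m a1 z) - scalar_re (m a2 z).
  pose gim z := scalar_im (m a1 z) - scalar_im (m a2 z).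
  have grea c t : atlas c -> chart_img c t -> analytic_at (gre \o chart_inv c) t.
    by move=> ac It; apply: analytic_atB; exact: rea.
  have gima c t : atlas c -> chart_img c t -> analytic_at (gim \o chart_inv c) t.
    by move=> ac It; apply: analytic_atB; exact: ima.
  have mre := measurable_manifold_zeros atP grea openT.
  have mim := measurable_manifold_zeros atP gima openT.
  have E : [set z | m a1 z = m a2 z] = [set z | setT z /\ gre z = 0] `&`
      [set z | setT z /\ gim z = 0].
    apply/seteqP; split => z /=.
      by move=> mz; rewrite /gre /gim mz !subrr.
    move=> [[_ /eqP]]; rewrite subr_eq0 => /eqP re [_ /eqP].
    by rewrite subr_eq0 => /eqP im; apply/scalar_eqP.
  apply: negligible_measurable0; first by rewrite E; exact: measurableI.
  (* At [z0] the real or the imaginary part of the difference is nonzero; the zero set of that part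
     contains all coincidences. *)
  have [gr|gr] := eqVneq (gre z0) 0; last first.
    have [mN N0] := manifold_zeros_null atP grea volP Zc gr mv.
    exists [set z | gre z = 0]; split => // z mz.
    by rewrite /gre /= mz subrr.
  have gi : gim z0 != 0.
    apply/eqP => /eqP gi; apply: mz0; apply/scalar_eqP; split; apply/eqP.
      by rewrite -subr_eq0 -/(gre z0) gr.
    by rewrite -subr_eq0.
  have [mN N0] := manifold_zeros_null atP gima volP Zc gi mv.
  exists [set z | gim z = 0]; split => // z mz.
  by rewrite /gim /= mz subrr.
- move=> z n phi t At phia.
  have [_ _ _ cov _] := atP; have [c ac Dz] := cov z.
  have := @real_analytic_comp R _ _ _ _ n (fun u => (phi u, chart_map c z)) t (ma c ac)
    (analytic_at_pair phia (analytic_at_cst _ _)).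
  move=> /(_ (conj At (chart_map_img atP ac Dz)))/analytic_at_scalar /=.
  by rewrite (chart_mapK atP ac Dz).
Qed.

(** * Gaussian sampling *)

Section riesz.
Context {R : realType} {Z : completeNormedModType R}.
Variable ip : Z -> Z -> R.
Hypothesis ipP : inner_product idfun ip.

Lemma ip_linear u : linear (ip u).
Proof.
have [ipl ips _] := ipP => a x y.
by rewrite ips [idfun _]/= ipl (ips x u) (ips y u).
Qed.

Lemma ip_sym u v : ip u v = ip v u.
Proof. by have [_ ips _] := ipP; rewrite ips. Qed.

Lemma ip_norm u : ip u u = `|u| ^+ 2.
Proof. by have [_ _ ->] := ipP. Qed.

Lemma ipDr u v w : ip u (v + w) = ip u v + ip u w.
Proof. by have := ip_linear u 1 v w; rewrite !scale1r. Qed.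

Lemma ipZr u a v : ip u (a *: v) = a * ip u v.
Proof. by have := ip_linear u a v 0; rewrite addr0 (linear_for0 (ip_linear u)) addr0. Qed.

Lemma ipDl u v w : ip (u + v) w = ip u w + ip v w.
Proof. by rewrite ip_sym ipDr !(ip_sym w). Qed.

Lemma ipZl a u v : ip (a *: u) v = a * ip u v.
Proof. by rewrite ip_sym ipZr ip_sym. Qed.

Lemma norm2D (u v : Z) : `|u + v| ^+ 2 = `|u| ^+ 2 + 2 * ip u v + `|v| ^+ 2.
Proof. by rewrite -!ip_norm ipDl !ipDr (ip_sym v u); ring. Qed.

Lemma parallelogram (u v : Z) :
  `|u - v| ^+ 2 = 2 * (`|u| ^+ 2 + `|v| ^+ 2) - `|u + v| ^+ 2.
Proof.
by rewrite -scaleN1r !norm2D ipZr normrZ normrN1 mul1r; ring.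
Qed.

Lemma ip_cauchy_schwarz u v : `|ip u v| <= `|u| * `|v|.
Proof.
rewrite -ler_sqr ?nnegrE ?mulr_ge0// real_normK ?num_real// exprMn.
have [->|v0] := eqVneq v 0.
  by rewrite (linear_for0 (ip_linear u)) normr0 expr0n/= mulr0.
have nv : 0 < `|v| ^+ 2 by rewrite exprn_gt0// normr_gt0.
have := sqr_ge0 (`|u + (- (ip u v / `|v| ^+ 2)) *: v|).
rewrite norm2D ipZr normrZ exprMn real_normK ?num_real// sqrrN.
move: (`|v| ^+ 2) nv (`|u| ^+ 2) (ip u v) => b b0 a c.
have -> : a + 2 * (- (c / b) * c) + (c / b) ^+ 2 * b = a - c ^+ 2 / b.
  by field; rewrite gt_eqF.
by rewrite subr_ge0 ler_pdivrMr.
Qed.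

Lemma ip_cont u : continuous (ip u).
Proof.
move=> v; apply/cvgrPdist_le => e e0; near=> w.
rewrite -[- ip u w]mulN1r -ipZr -ipDr scaleN1r.
apply: le_trans (ip_cauchy_schwarz _ _) _.
apply: (@le_trans _ _ ((`|u| + 1) * `|v - w|)); first by rewrite ler_wpM2r// lerDl.
rewrite mulrC -ler_pdivlMr ?ltr_wpDl//; near: w.
by apply: cvgr_dist_le; rewrite // divr_gt0// ltr_wpDl.
Unshelve. all: by end_near. Qed.

(* The representing vector is a multiple of the point of smallest norm of the
   hyperplane [b = 1]. *)
Lemma riesz (b : Z -> R) (C : R) :
  linear b -> (forall v, `|b v| <= C * `|v|) -> (exists v, b v != 0) ->
  exists u, u != 0 /\ forall v, b v = ip u v.
Proof.
move=> bl bC [v1 bv1].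
have b0 := linear_for0 bl.
have bZ a v : b (a *: v) = a * b v by have := bl a v 0; rewrite !addr0 b0 addr0.
have bD v w : b (v + w) = b v + b w by have := bl 1 v w; rewrite !scale1r.
pose S := [set `|v| ^+ 2 | v in [set v | b v = 1]].
have S0 : has_inf S.
  split; last by exists 0 => _ [v _ <-]; exact: sqr_ge0.
  exists (`|(b v1)^-1 *: v1| ^+ 2), ((b v1)^-1 *: v1) => //=.
  by rewrite bZ mulVf.
pose D := inf S.
have DS v : b v = 1 -> D <= `|v| ^+ 2.
  by move=> bv; apply: ge_inf; [exact: S0.2|exists v].
(* The parallelogram law will give [|v n.+1 - v n| ^+ 2 <= 2 * (eps n + eps n.+1) <= 4^-1 ^+ n],
   hence summable steps [2^-1 ^+ n]. *)
pose eps (n : nat) : R := 4^-1 ^+ n / 4.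
have eps0 n : 0 < eps n by rewrite divr_gt0// exprn_gt0// invr_gt0.
have /choice[v vP] : forall n, exists v, b v = 1 /\ `|v| ^+ 2 < D + eps n.
  move=> n; have [_ [v bv <-] vn] := inf_adherent (eps0 n) S0.
  by exists v.
have dv n : `|v n.+1 - v n| <= 2^-1 ^+ n.
  rewrite -ler_sqr ?nnegrE ?exprn_ge0// parallelogram.
  have [bn vn] := vP n; have [bn1 vn1] := vP n.+1.
  (* The midpoint still lies on the hyperplane [b = 1]. *)
  have : D <= `|2^-1 *: (v n.+1 + v n)| ^+ 2.
    by apply: DS; rewrite bZ bD bn bn1; field.
  rewrite normrZ exprMn ger0_norm ?invr_ge0// => Dm.
  have -> : (2^-1 ^+ n) ^+ 2 = 4^-1 ^+ n :> R.
    by rewrite exprAC; congr (_ ^+ n); field.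
  move: vn1 vn; rewrite /eps (exprS 4^-1 n).
  have : 0 < 4^-1 ^+ n :> R by rewrite exprn_gt0// invr_gt0.
  move: Dm; rewrite (_ : 2^-1 ^+ 2 = 4^-1 :> R); last by field.
  move: (4^-1 ^+ n) (`|v n.+1 + v n| ^+ 2) (`|v n.+1| ^+ 2) (`|v n| ^+ 2) (D) => x y p q D0; lra.
have half_sum k : \sum_(0 <= j < k) 2^-1 ^+ j <= 2 :> R.
  suff -> : \sum_(0 <= j < k) 2^-1 ^+ j = 2 - 2 * 2^-1 ^+ k :> R.
    by rewrite gerBl mulr_ge0// exprn_ge0.
  elim: k => [|k IH]; first by rewrite big_geq// expr0; ring.
  by rewrite big_nat_recr//= IH exprS; field.
have vcvg := cvg_series_bounded dv half_sum.
pose w := limn (series (fun n => v n.+1 - v n)).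
pose v0 := v 0%N + w.
have sv n : series (fun n => v n.+1 - v n) n = v n - v 0%N.
  by rewrite /series/= telescope_sumr.
have vv0 : v @ \oo --> v0.
  rewrite (_ : v = (fun n => v 0%N + series (fun n => v n.+1 - v n) n)).
    by apply: cvgD; [exact: cvg_cst|exact: vcvg].
  by apply/funext => n; rewrite sv subrKC.
have bv0 : b v0 = 1.
  have bw : series (b \o (fun n => v n.+1 - v n)) @ \oo --> b w.
    exact: linear_cvg_bounded bl bC vcvg.
  have bs : series (b \o (fun n => v n.+1 - v n)) @ \oo --> (0 : R).
    rewrite (_ : series _ = fun=> 0); first exact: cvg_cst.
    apply/funext => n; rewrite /series/= big1// => i _.
    by rewrite -scaleN1r bD bZ !(vP _).1 mulN1r subrr.
  by rewrite bD (vP 0%N).1 (cvg_unique _ bw bs) ?addr0.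
have v0min y : b y = 1 -> `|v0| ^+ 2 <= `|y| ^+ 2.
  move=> by1; have vn2 : (fun n => `|v n| ^+ 2) @ \oo --> `|v0| ^+ 2.
    rewrite expr2; under eq_fun do rewrite expr2.
    by apply: cvgM; exact: cvg_norm.
  have e_cvg : (fun n => `|y| ^+ 2 + eps n) @ \oo --> `|y| ^+ 2 + 0 / 4.
    apply: cvgD; first exact: cvg_cst.
    apply: cvgM; last exact: cvg_cst.
    by apply: cvg_expr; rewrite ger0_norm ?invr_ge0// invf_lt1// ltr1n.
  rewrite mul0r addr0 in e_cvg.
  apply: ler_cvg_to vn2 e_cvg _; apply: nearW => n.
  by apply: le_trans (ltW (vP n).2) _; rewrite lerD2r; exact: DS.
have orth h : b h = 0 -> ip v0 h = 0.
  move=> bh; have [->|h0] := eqVneq h 0; first exact: linear_for0 (ip_linear v0).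
  have nh : 0 < `|h| ^+ 2 by rewrite exprn_gt0// normr_gt0.
  (* The point closest to the origin on the line through [v0] in the direction [h]; minimality of
     [v0] forces [ip v0 h ^+ 2 <= 0]. *)
  have := v0min (v0 + (- (ip v0 h / `|h| ^+ 2)) *: h).
  rewrite bD bZ bh mulr0 addr0 => /(_ bv0).
  rewrite norm2D ipZr normrZ exprMn real_normK ?num_real// sqrrN.
  move: (`|h| ^+ 2) nh (`|v0| ^+ 2) (ip v0 h) => x x0 a c.
  have -> : a + 2 * (- (c / x) * c) + (c / x) ^+ 2 * x = a - c ^+ 2 / x.
    by field; rewrite gt_eqF.
  rewrite lerBrDr gerDl pmulr_lle0 ?invr_gt0// => c2.
  by apply/eqP; rewrite -sqrf_eq0 eq_le c2 sqr_ge0.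
have v00 : v0 != 0.
  by apply/eqP => v00; move: bv0; rewrite v00 b0 => /esym/eqP; rewrite oner_eq0.
have n0 : `|v0| ^+ 2 != 0 by rewrite sqrf_eq0 normr_eq0.
exists ((`|v0| ^+ 2)^-1 *: v0); split; first by rewrite scaler_eq0 invr_eq0 negb_or n0.
move=> y; have := orth (y + (- b y) *: v0).
rewrite bD bZ bv0 mulr1 subrr => /(_ erefl).
rewrite ipDr ipZr ip_norm mulNr => /eqP; rewrite subr_eq0 => /eqP yE.
by rewrite ipZl yE mulrC mulfK.
Qed.

End riesz.

(** * Gaussian measure of hyperplanes and of zero sets of multilinear forms *)

Section gaussian_hyperplane.
Context {R : realType} {Z : completeNormedModType R}.
Variables (ip : Z -> Z -> R) (gamma : probability (borel Z) R).
Hypothesis ipP : inner_product idfun ip.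

Lemma ip_measurable u : measurable_fun setT (ip u : borel Z -> R).
Proof. by apply: borel_continuous_measurable; exact: ip_cont. Qed.

Lemma covariance_ae_cst u v (c : R) : {ae gamma, forall z, ip u z = c} ->
  covariance gamma (ip u : borel Z -> R) (ip v : borel Z -> R) = 0%E.
Proof.
move=> uc.
have Eu : expectation gamma (ip u : borel Z -> R) = c%:E.
  rewrite unlock; transitivity (\int[gamma]_z (cst c%:E z))%E.
    apply: ae_eq_integral => //; first by apply/measurable_EFinP; exact: ip_measurable.
    case: uc => N [mN N0 NE]; exists N; split => // z nz; apply: NE => zc.
    by apply: nz => _ /=; rewrite zc.
  rewrite integral_cst// -[RHS]mule1; congr (_ * _)%E.
  exact: (probability_setT gamma).
rewrite unlock Eu/= unlock -[RHS](integral0 gamma setT).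
apply: ae_eq_integral => //.
  apply/measurable_EFinP; apply: measurable_funM; apply: measurable_funB => //;
    exact: ip_measurable.
case: uc => N [mN N0 NE]; exists N; split => // z nz; apply: NE => zc.
by apply: nz => _ /=; rewrite /GRing.mul/= zc subrr mul0r.
Qed.

(** By [riesz], [b] is [ip u] with [u != 0], and its law is Gaussian. With nonzero variance the law
    has no atoms. If it were a Dirac mass, the covariance of [ip u] with [ip (Cov u)], which is
    [|Cov u| ^+ 2], would vanish, and nondegeneracy would give [u = 0]. *)
Lemma gaussian_hyperplane_null (b : Z -> R) (C : R) :
  gaussian_measure ip gamma -> nondegenerate_gaussian ip gamma ->
  linear b -> (forall v, `|b v| <= C * `|v|) -> (exists v, b v != 0) ->
  gamma [set z | b z = 0] = 0%E.
Proof.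
move=> gg [Cov CovE Cov0] bl bC b0; have [u [u0 bE]] := riesz ipP bl bC b0.
have -> : [set z | b z = 0] = ip u @^-1` [set 0].
  by apply/seteqP; split => z /=; rewrite bE.
have m0 : measurable ([set 0] : set R) by exact: measurable_set1.
have [[m [s [_ gE]]]|[m gE]] := gg u.
  rewrite gE//; apply: (@normal_prob_dominates R m s [set 0]) => //.
  by apply/measure0_null_setP => //; exact: lebesgue_measure_set1.
exfalso; move/eqP: u0; apply; apply: Cov0.
have mm : measurable (ip u @^-1` [set m] : set (borel Z)).
  by rewrite -[X in measurable X]setTI; apply: ip_measurable.
have um : {ae gamma, forall z, ip u z = m}.
  exists (~` (ip u @^-1` [set m] : set (borel Z))); split.
  - exact: measurableC.
  - have gm : gamma (ip u @^-1` [set m]) = 1%E by rewrite gE// diracE mem_set.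
    by rewrite probability_setC// gm subee.
  - by [].
have := CovE u (Cov u); rewrite (covariance_ae_cst _ um) => -[].
by rewrite (ip_norm ipP) => /eqP; rewrite sqrf_eq0 normr_eq0 => /eqP.
Qed.

End gaussian_hyperplane.

Section multilinear_null.
Context {R : realType}.

Definition slot_cons (T : Type) r (x : T) (y : 'I_r -> T) : 'I_r.+1 -> T :=
  fun i => if unlift ord0 i is Some j then y j else x.

Lemma slot_cons_dfwith (T : Type) r (x v : T) (y : 'I_r -> T) :
  dfwith (slot_cons x y) ord0 v = slot_cons v y.
Proof.
apply/funext => i; case: dfwithP => [|j j0]; first by rewrite /slot_cons unlift_none.
by rewrite /slot_cons; case: unliftP j0 => [l ->//|->]; rewrite eqxx.
Qed.

Lemma dfwith_slot_cons (T : Type) r (x v : T) (y : 'I_r -> T) i :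
  dfwith (slot_cons x y) (lift ord0 i) v = slot_cons x (dfwith y i v).
Proof.
apply/funext => l; rewrite /slot_cons; case: dfwithP => [|j ij].
  by rewrite liftK dfwithin.
case: unliftP ij => [h ->|//]; rewrite (inj_eq (@lift_inj _ _)) => ih.
by rewrite dfwithout.
Qed.

Lemma tnth_cons_slot (T : Type) r (x : T) (t : r.-tuple T) :
  tnth [tuple of x :: t] = slot_cons x (tnth t).
Proof.
apply/funext => i; rewrite /slot_cons; case: unliftP => [j ->|->//].
by rewrite tnthS.
Qed.

Variables (Z : completeNormedModType R) (ip : Z -> Z -> R).
Variable (gamma : probability (borel Z) R).
Hypotheses (ipP : inner_product idfun ip) (gg : gaussian_measure ip gamma)
  (ng : nondegenerate_gaussian ip gamma).

(** The scheme used for the Lebesgue measure: with the first slot frozen at [x0] the form is nonzero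
    at almost every tail by induction, and over such a tail the first slot carries a nonzero linear
    functional. *)
Lemma gaussian_multilinear_null r : forall (B : ('I_r -> Z) -> R),
  multilinear (B : ('I_r -> Z) -> R^o) ->
  (forall y i, exists C, forall v, `|B (dfwith y i v)| <= C * `|v|) ->
  measurable ([set t | B (tnth t) = 0] : set (r.-tuple (borel Z))) ->
  (exists y, B y != 0) ->
  power_measure gamma r [set t | B (tnth t) = 0] = 0%E.
Proof.
elim: r => [|r IH] B Bl BC mB [y0 By0].
  rewrite (_ : [set t | _] = set0) ?measure0//.
  apply/seteqP; split => // t /= Bt; move/eqP: By0; apply; rewrite -Bt.
  by congr B; apply/funext; case.
pose x0 := y0 ord0; pose y1 i := y0 (lift ord0 i).
have y0E : y0 = slot_cons x0 y1.
  by apply/funext => i; rewrite /slot_cons; case: unliftP => [j ->|->].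
pose B' y := B (slot_cons x0 y).
pose N : set (r.-tuple (borel Z)) := [set t | B' (tnth t) = 0].
have mN : measurable N.
  rewrite (_ : N = [set t : r.-tuple (borel Z) | [set t | B (tnth t) = 0] [tuple of x0 :: t]]).
    by rewrite -[X in measurable X]setTI; apply: measurable_cons mB => //.
  by apply/seteqP; split => t; rewrite /N/= /B' tnth_cons_slot.
have N0 : power_measure gamma r N = 0%E.
  apply: IH => //.
  - by move=> y i c u v; rewrite /B' -!dfwith_slot_cons Bl.
  - move=> y i; have [C BCi] := BC (slot_cons x0 y) (lift ord0 i).
    by exists C => v; rewrite /B' -dfwith_slot_cons.
  - by exists y1; rewrite /B' -y0E.
apply: (@power_measure_null_rest R _ _ gamma r _ N) => // t Nt.
have [C BCi] := BC (slot_cons x0 (tnth t)) ord0.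
rewrite (_ : [set x | _] = [set x | B (slot_cons x (tnth t)) = 0]); last first.
  by apply/seteqP; split => x /=; rewrite tnth_cons_slot.
apply: (gaussian_hyperplane_null ipP (C := C)) => //.
- move=> c u v; have := Bl (slot_cons x0 (tnth t)) ord0 c u v.
  by rewrite !slot_cons_dfwith.
- by move=> v; have := BCi v; rewrite slot_cons_dfwith.
- by exists x0; apply/eqP => Bx; apply: Nt.
Qed.

End multilinear_null.

Section scalar_norms.
Context {R : realType} {k : scalar_kind}.
Local Notation K := (scalar_field R k).
Local Notation KR := (real_scalar R k).

Lemma scalar_ge0E (a : K) : 0 <= a -> a = of_real (scalar_re a).
Proof.
case: k a => //= -[a b]; rewrite lecE/= => /andP[/eqP -> _].
by [].
Qed.

Lemma of_realK (x : R) : scalar_re (of_real x : K) = x.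
Proof. by case: k. Qed.

Lemma of_real_le (x y : R) : ((of_real x : K) <= of_real y) = (x <= y).
Proof. by case: k => //=; rewrite lecR. Qed.

Lemma of_real_lt (x y : R) : ((of_real x : K) < of_real y) = (x < y).
Proof. by case: k => //=; rewrite ltcR. Qed.

Lemma norm_of_real (x : R) : 0 <= x -> `|of_real x : K| = of_real x.
Proof. by move=> x0; apply: ger0_norm; rewrite (_ : 0 = of_real 0) ?of_real_le//; case: k. Qed.

Lemma of_real_neq0 (x : R) : x != 0 -> (of_real x : K) != 0.
Proof.
by apply: contra => /eqP x0; rewrite -(of_realK x) x0; case: k.
Qed.

Lemma normr_realify (E : normedModType K) (u : E) :
  `|u| = of_real `|u : realify E|.
Proof. exact: scalar_ge0E. Qed.

Lemma real_multilinear_bound (H : normedModType K) r (L : ('I_r -> H) -> KR) (D : R) :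
  @multilinear K r H K^o L -> 0 <= D ->
  (forall x, unit_polyball H r x -> `|L x| <= D) ->
  forall x, `|L x| <= D * \prod_i `|x i : realify H|.
Proof.
move=> Ll D0 LD x; have [[i xi0]|nx] := pselect (exists i, x i = 0).
  have -> : L x = 0 by rewrite -(dfwith_id x i) xi0; exact: (multilinear0 Ll).
  by rewrite normr0 mulr_ge0// prodr_ge0.
pose n i := `|x i : realify H|.
have n0 i : n i != 0.
  rewrite normr_eq0; apply/eqP => xi0; apply: nx; exists i; exact: xi0.
have nK i : (of_real (n i) : K) != 0 by exact: of_real_neq0.
pose y i := (of_real (n i) : K)^-1 *: x i.
have -> : L x = (\prod_i n i) *: L y.
  have -> : x = (fun i => (of_real (n i) : K) *: y i).
    by apply/funext => i; rewrite scalerA divff// scale1r.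
  rewrite (multilinear_scale Ll).
  rewrite [RHS]/GRing.scale/= /GRing.scale/=; congr (_ * L _).
    by rewrite (big_morph of_real (@of_realM R k) (@of_real1 R k)).
have P0 : 0 <= \prod_i n i by apply: prodr_ge0 => i _; exact: normr_ge0.
rewrite normrZ ger0_norm// mulrC; apply: ler_pM => //.
apply: LD => i; rewrite normrZ normfV (norm_of_real (normr_ge0 _)).
by rewrite (normr_realify (x i)) -/(n i) mulVf ?nK.
Qed.

Lemma mform_bound (H : normedModType K) r (f : mform H r) x :
  `|f x| <= `|f| * \prod_i `|x i : realify H|.
Proof.
have [fl [C fC]] := mformP f.
apply: real_multilinear_bound => // {}x x1.
apply: ub_le_sup; last by exists x.
exists (scalar_re `|C|) => _ [y y1 <-]; apply: scalar_re_le.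
apply: (le_trans (fC y)).
have p0 : 0 <= \prod_(i < r) `|y i| by exact: prodr_ge0.
have p1 : \prod_(i < r) `|y i| <= 1.
  by apply: prodr_ile1 => i _; rewrite normr_ge0 y1.
have Cp_real : C * \prod_(i < r) `|y i| \is Num.real.
  by apply: ger0_real; apply: le_trans (fC y).
rewrite (le_trans (real_ler_norm Cp_real))// normrM (ger0_norm p0).
by rewrite ler_piMr.
Qed.

End scalar_norms.

(** * Continuity and measurability of multilinear forms *)

Section multilinear_continuity.
Context {R : realType} {Z : normedModType R} {r : nat}.
Variables (B : ('I_r -> Z) -> R) (C : R).
Hypothesis Bl : multilinear (B : ('I_r -> Z) -> R^o).
Hypothesis BC : forall y, `|B y| <= C * \prod_i `|y i|.

Lemma multilinear_slot_bound y i :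
  exists D, forall v, `|B (dfwith y i v)| <= D * `|v|.
Proof.
exists (C * \prod_(l < r | l != i) `|y l|) => v; apply: le_trans (BC _) _.
rewrite (bigD1 i)//= dfwithin mulrCA mulrC le_eqVlt; apply/orP; left; apply/eqP.
by congr (_ * _ * _); apply: eq_bigr => l li; rewrite dfwithout// eq_sym.
Qed.

Lemma multilinear_cont y (e : R) : 0 < e -> exists2 d, 0 < d &
  forall y', (forall i, `|y' i - y i| < d) -> `|B y' - B y| < e.
Proof.
move=> e0; pose K := `|C| * \prod_(l < r) (`|y l| + 1).
have K0 : 0 <= K by rewrite mulr_ge0// prodr_ge0// => l _; rewrite addr_ge0.
(* Each of the [r] slots changes the value by at most [K * d]; [d <= 1] keeps all arguments below
   [|y l| + 1], as built into [K]. *)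
pose d := Num.min 1 (e / (r%:R * K + 1)).
have rK : 0 < r%:R * K + 1 by rewrite ltr_wpDl// mulr_ge0.
have d0 : 0 < d by rewrite lt_min ltr01 divr_gt0.
have d1 : d <= 1 by rewrite ge_min lexx.
exists d => // y' yd.
have H (s : seq 'I_r) : uniq s ->
    `|B (fun i => if i \in s then y' i else y i) - B y| <= (size s)%:R * (K * d).
  elim: s => [_|i s IH /= /andP[si us]]; first by rewrite subrr normr0 mul0r.
  pose w l := if l \in s then y' l else y l.
  have -> : (fun l => if l \in i :: s then y' l else y l) =
      dfwith w i (1 *: (y' i - y i) + y i).
    apply/funext => l; rewrite inE; case: dfwithP => [|l' il'].
      by rewrite eqxx scale1r subrK.
    by rewrite eq_sym (negbTE il').
  have wi : dfwith w i (y i) = w.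
    by apply/funext => l; case: dfwithP => //; rewrite /w (negbTE si).
  rewrite Bl wi scale1r -addrA -natr1 mulrDl mul1r [leRHS]addrC.
  apply: le_trans (ler_normD _ _) _; apply: lerD; last exact: IH.
  apply: le_trans (BC _) _; rewrite (bigD1 i)//= dfwithin.
  rewrite /K [\prod_(l < r) (`|y l| + 1)](bigD1 i)//=.
  set p := \prod_(l < r | l != i) `|dfwith w i (y' i - y i) l|.
  set p' := \prod_(l < r | l != i) (`|y l| + 1).
  have p0 : 0 <= p by rewrite prodr_ge0.
  have pp : p <= p'.
    apply: ler_prod => l li; rewrite normr_ge0/= dfwithout 1?eq_sym// /w.
    case: ifP => _; last by rewrite lerDl.
    rewrite -[y' l](subrKC (y l)); apply: le_trans (ler_normD _ _) _.
    by rewrite lerD2l (le_trans (ltW (yd l))).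
  apply: (@le_trans _ _ (`|C| * (d * p'))).
    apply: (@le_trans _ _ (`|C| * (`|y' i - y i| * p))).
      by apply: ler_wpM2r; [exact: mulr_ge0|exact: ler_norm].
    by apply: ler_wpM2l => //; apply: ler_pM => //; exact: ltW.
  rewrite -[leRHS]mulrA ler_wpM2l//.
  rewrite (_ : (`|y i| + 1) * p' * d = (`|y i| + 1) * (d * p')); last by ring.
  by rewrite ler_peMl ?lerDr// mulr_ge0 ?(ltW d0)// (le_trans p0).
have := H (index_enum 'I_r) (index_enum_uniq _).
under [X in `|B X - _|]eq_fun do rewrite mem_index_enum.
rewrite /index_enum -enumT size_enum_ord => /le_lt_trans; apply.
apply: (@le_lt_trans _ _ (r%:R * K * (e / (r%:R * K + 1)))).
  by rewrite -mulrA ler_wpM2l// ler_wpM2l// ge_min lexx orbT.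
by rewrite mulrA ltr_pdivrMr// mulrC ltr_pM2l// ltrDl.
Qed.

End multilinear_continuity.

Lemma separable_second_countable (R : realType) (Z : normedModType R) :
  separable Z -> @second_countable Z.
Proof.
move=> [S cS dS].
pose b (p : Z * nat) : set Z := ball p.1 (p.2.+1%:R^-1).
exists (b @` (S `*` setT)).
  apply: sub_countable (card_image_le _ _) _.
  by apply: countableX => //; exact: countableP.
split; first by move=> _ [p _ <-]; exact: ball_open.
move=> x U /nbhs_ballP[e /= e0 xU].
have [m] := ltr_add_invr (divr_gt0 e0 (ltr0n R 2)); rewrite add0r => me.
have m0 : 0 < m.+1%:R^-1 :> R by rewrite invr_gt0.
have [||c [xc Sc]] := dS (ball x m.+1%:R^-1); [by exists x; exact: ballxx|exact: ball_open|].
exists (b (c, m)); first by split; [exists (c, m)|rewrite /b; exact: ball_sym].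
move=> y; rewrite /b -ball_normE/= => cy; apply: xU; rewrite -ball_normE/=.
rewrite -(subrK c x) -addrA; apply: le_lt_trans (ler_normD _ _) _.
rewrite (splitr e) ltrD ?(lt_trans cy)//.
by apply: lt_trans me; move: xc; rewrite -ball_normE.
Qed.

(** Superlevel sets are open, and separability makes them countable unions of boxes, hence
    measurable for the product of the Borel sigma-algebras. *)
Lemma multilinear_measurable (R : realType) (Z : completeNormedModType R) r
    (B : ('I_r -> Z) -> R) (C : R) :
  separable Z -> multilinear (B : ('I_r -> Z) -> R^o) ->
  (forall y, `|B y| <= C * \prod_i `|y i|) ->
  measurable_fun setT (fun t : r.-tuple (borel Z) => B (tnth t)).
Proof.
move=> /separable_second_countable[Ba cB [oB Bb]] Bl BC.
apply: measurable_fun_superlevel => x; rewrite setTI.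
apply: (@measurable_tuple_basis _ (borel Z) r Ba) => //.
  by move=> b /oB ob; exact: borel_open_measurable.
move=> t xt; have e0 : 0 < B (tnth t) - x by rewrite subr_gt0.
have [d d0 Bd] := multilinear_cont Bl BC (tnth t) e0.
have /choice[U UP] : forall i, exists U : set Z,
    [/\ Ba U, U (tnth t i) & U `<=` ball (tnth t i : Z) d].
  move=> i; have [U [BU Ut] Ud] := Bb (tnth t i) _ (nbhsx_ballx _ _ d0).
  by exists U.
exists U; split; [by move=> i; have [] := UP i|by move=> i; have [] := UP i|].
move=> s sU /=; have : `|B (tnth s) - B (tnth t)| < B (tnth t) - x.
  apply: Bd => i; have [_ _ Ub] := UP i; have := Ub _ (sU i).
  by rewrite -ball_normE/= distrC.
by rewrite distrC => /(le_lt_trans (ler_norm _)); rewrite ltrD2l ltrN2.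
Qed.

Section gaussian_sampling.
Context {R : realType} {k : scalar_kind}.
Local Notation K := (scalar_field R k).
Local Notation KR := (real_scalar R k).
Context {H : normedModType K} {Z : completeNormedModType R} {r : nat}.
Variable psi : {linear Z -> realify H}.
Variable Cpsi : R.
Hypothesis psiC : forall z, `|psi z| <= Cpsi * `|z|.
Variables (L : ('I_r -> H) -> KR) (D : R).
Hypothesis Ll : @multilinear K r H K^o L.
Hypothesis D0 : 0 <= D.
Hypothesis LD : forall x, `|L x| <= D * \prod_i `|x i : realify H|.

Lemma pullback_multilinear (T : KR -> R) : linear T ->
  multilinear ((fun y => T (L (fun i => psi (y i)))) : ('I_r -> Z) -> R^o).
Proof.
move=> Tl x i c u v.
have E w : (fun l => psi (dfwith x i w l) : H) = dfwith (fun l => psi (x l) : H) i (psi w).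
  apply/funext => l; have [<-|il] := eqVneq i l; first by rewrite !dfwithin.
  by rewrite !dfwithout.
rewrite !E linearP -Tl; congr (T _).
exact: (Ll (fun l => psi (x l)) i (of_real c) (psi u) (psi v)).
Qed.

Lemma pullback_bound (T : KR -> R) : (forall u, `|T u| <= 1 * `|u|) ->
  forall y : 'I_r -> Z,
  `|T (L (fun i => psi (y i)))| <= D * `|Cpsi| ^+ r * \prod_i `|y i|.
Proof.
move=> T1 y; apply: le_trans (T1 _) _; rewrite mul1r.
apply: le_trans (LD _) _; rewrite -mulrA ler_wpM2l//.
rewrite -[X in _ ^+ X](card_ord r) -prodr_const -big_split/=.
apply: ler_prod => i _; rewrite normr_ge0/=.
by apply: le_trans (psiC _) _; rewrite ler_wpM2r// ler_norm.
Qed.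

(** Vanishing of [L] on the range of [psi] would spread one slot at a time, to the span by
    multilinearity over the scalar field and to its closure by boundedness. As the span is taken
    over the scalar field, real and imaginary parts come only afterwards. *)
Lemma dense_span_neq0 :
  closure (linear_span (range (psi : Z -> H))) = [set: H] ->
  (exists x, L x != 0) -> exists y, L (fun i => psi (y i)) != 0.
Proof.
move=> dpsi [x Lx]; apply: contrapT => nL; move/negP: Lx; apply; apply/eqP.
have L0 y : L (fun i => psi (y i)) = 0.
  by apply/eqP; apply: contrapT => /negP Ly; apply: nL; exists y.
have Hs (s : seq 'I_r) : uniq s -> forall y : 'I_r -> Z,
    L (fun i => if i \in s then x i else psi (y i)) = 0.
  elim: s => [_ y|i s IH /= /andP[si us] y]; first exact: L0.
  pose w l : H := if l \in s then x l else psi (y l).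
  have -> : (fun l => if l \in i :: s then x l else psi (y l)) = dfwith w i (x i).
    apply/funext => l; rewrite inE; case: dfwithP => [|l' il']; first by rewrite eqxx.
    by rewrite eq_sym (negbTE il').
  have Lpsi z : L (dfwith w i (psi z)) = 0.
    rewrite -(IH us (dfwith y i z)); congr L; apply/funext => l.
    have [<-|il] := eqVneq i l; first by rewrite !dfwithin (negbTE si).
    by rewrite !dfwithout.
  have LD' c u v : L (dfwith w i (c *: u + v)) =
      c * (L (dfwith w i u) : K) + L (dfwith w i v) :> K.
    exact: Ll.
  have Lspan v : linear_span (range (psi : Z -> H)) v -> L (dfwith w i v) = 0.
    move=> [n [c [e [er ->]]]]; elim: (index_enum _) => [|j js IHj].
      by rewrite big_nil; exact: (multilinear0 Ll).
    rewrite big_cons LD' IHj; have [z _ <-] := er j.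
    by rewrite Lpsi mulr0 addr0.
  have [E EP] : exists E, forall v, `|L (dfwith w i v)| <= E * `|v : realify H|.
    exists (D * \prod_(l < r | l != i) `|w l : realify H|) => v.
    apply: le_trans (LD _) _.
    rewrite (bigD1 i)//= dfwithin mulrCA mulrC le_eqVlt; apply/orP; left; apply/eqP.
    by congr (_ * _ * _); apply: eq_bigr => l li; rewrite dfwithout// eq_sym.
  suff : `|L (dfwith w i (x i)) : KR| <= 0 by rewrite normr_le0 => /eqP.
  apply/ler_addgt0Pl => e e0; rewrite addr0.
  have E1 : 0 < `|E| + 1 by rewrite ltr_wpDl.
  have d0 : (0 : K) < of_real (e / (`|E| + 1)).
    by rewrite (_ : 0 = of_real 0); [rewrite of_real_lt divr_gt0|case: (k)].
  have : closure (linear_span (range (psi : Z -> H))) (x i) by rewrite dpsi.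
  move=> /(_ _ (nbhsx_ballx (x i) _ d0))[v [/Lspan Lv]].
  rewrite -ball_normE/= => xv.
  have {}xv : `|x i - v : realify H| <= e / (`|E| + 1).
    by have := scalar_re_le (ltW xv); rewrite of_realK.
  have -> : L (dfwith w i (x i)) = L (dfwith w i (x i - v)).
    have := LD' 1 (x i - v) v; rewrite scale1r subrK => ->.
    by rewrite mul1r Lv addr0.
  apply: le_trans (EP _) _.
  apply: (@le_trans _ _ ((`|E| + 1) * (e / (`|E| + 1)))).
    apply: (@le_trans _ _ (`|E| * `|x i - v : realify H|)).
      by rewrite ler_wpM2r// ler_norm.
    by apply: ler_pM => //; rewrite lerDl.
  by rewrite mulrC divfK ?gt_eqF.
have := Hs (index_enum 'I_r) (index_enum_uniq _) (fun=> 0).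
by under [X in L X]eq_fun do rewrite mem_index_enum.
Qed.

End gaussian_sampling.

Lemma mform_eval_linear (R : realType) (k : scalar_kind)
    (H : normedModType (scalar_field R k)) r (x : 'I_r -> H) :
  linear ((fun f => f x) : mform H r -> real_scalar R k).
Proof. by move=> a f g. Qed.

Lemma gaussian_sampling_generic (R : realType) (k : scalar_kind)
    (X : completeNormedModType R) (A M : set X)
    (H : completeNormedModType (scalar_field R k)) (Z : completeNormedModType R)
    (ipZ : Z -> Z -> R) (r : nat) (F : X -> mform H r)
    (psi : {linear Z -> realify H}) (gamma : probability (borel Z) R)
    (m : X -> r.-tuple (borel Z) -> scalar_field R k) :
  open A -> inner_product idfun ipZ -> separable Z ->
  real_analytic A F -> {in A `&` M &, injective F} ->
  (exists C : R, forall z, `|psi z| <= C * `|z|) ->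
  closure (linear_span (range (psi : Z -> H))) = [set: H] ->
  gaussian_measure ipZ gamma -> nondegenerate_gaussian ipZ gamma ->
  (forall a z, A a -> m a z = F a (fun i => psi (tnth z i))) ->
  generic_sampling A M (power_measure gamma r) m.
Proof.
move=> oA ipP sZ Fa Finj [Cpsi psiC] dpsi gg ng mE.
have pb (L : ('I_r -> H) -> real_scalar R k) D T :
    @multilinear (scalar_field R k) r H (scalar_field R k)^o L -> 0 <= D ->
    (forall x, `|L x| <= D * \prod_i `|x i : realify H|) ->
    linear T -> (forall u, `|T u| <= 1 * `|u|) ->
    let B (y : 'I_r -> Z) : R := T (L (fun i => psi (y i))) in
    [/\ multilinear (B : ('I_r -> Z) -> R^o),
        (forall y, `|B y| <= D * `|Cpsi| ^+ r * \prod_i `|y i|) &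
        measurable_fun setT (fun t : r.-tuple (borel Z) => B (tnth t))].
  move=> Ll D0 LD Tl T1 B.
  have Bl := pullback_multilinear psi Ll Tl.
  have BC := pullback_bound psiC D0 LD T1.
  by split => //; exact: multilinear_measurable sZ Bl BC.
have mmT a (T : real_scalar R k -> R) : A a -> linear T -> (forall u, `|T u| <= 1 * `|u|) ->
    measurable_fun setT (fun t : r.-tuple (borel Z) => T (m a t)).
  move=> Aa Tl T1; have [fl _] := mformP (F a).
  have [_ _] := pb _ _ T fl (normr_ge0 _) (mform_bound (F a)) Tl T1.
  by under eq_fun do rewrite -(mE _ _ Aa).
split.
- move=> a Aa; split.
    exact: mmT Aa (@scalar_re_linear R k) (@scalar_re_le_norm R k).
  exact: mmT Aa (@scalar_im_linear R k) (@scalar_im_le_norm R k).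
- move=> a1 a2 a1A a2A a12; have [A1 _] := a1A; have [A2 _] := a2A.
  pose L (x : 'I_r -> H) : real_scalar R k := F a1 x - F a2 x.
  have [f1l _] := mformP (F a1); have [f2l _] := mformP (F a2).
  have Ll : @multilinear (scalar_field R k) r H (scalar_field R k)^o L.
    move=> x i c u v; have key (a b a' b' : scalar_field R k) :
        (c * a + b) - (c * a' + b') = c * (a - a') + (b - b').
      by rewrite mulrBr opprD addrACA.
    by rewrite /L f1l f2l; exact: key.
  have D0 : 0 <= `|F a1| + `|F a2| by rewrite addr_ge0.
  have LD x : `|L x| <= (`|F a1| + `|F a2|) * \prod_i `|x i : realify H|.
    apply: le_trans (ler_normB _ _) _; rewrite mulrDl.
    by apply: lerD; exact: mform_bound.
  have [y Ly] : exists y, L (fun i => psi (y i)) != 0.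
    apply: (dense_span_neq0 Ll LD dpsi).
    apply: contrapT => nx; apply: a12; apply: Finj; rewrite ?inE//.
    apply: val_inj; apply/funext => x /=; apply/eqP; rewrite -subr_eq0.
    by apply: contrapT => /negP Lx; apply: nx; exists x.
  (* [T] stands for the real or the imaginary part, whichever is nonzero at [y]; it turns the form
     into a real one, to which the Gaussian argument applies. *)
  have nullT (T : real_scalar R k -> R) : linear T -> (forall u, `|T u| <= 1 * `|u|) ->
      T (L (fun i => psi (y i))) != 0 ->
      (power_measure gamma r).-negligible [set z | m a1 z = m a2 z].
    move=> Tl T1 Ty; have [Bl BC mB] := pb _ _ T Ll D0 LD Tl T1.
    have mB0 : measurable ([set t | T (L (fun i => psi (tnth t i))) = 0]
        : set (r.-tuple (borel Z))).
      have := mB measurableT [set 0] (measurable_set1 _).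
      by rewrite setTI.
    exists [set t | T (L (fun i => psi (tnth t i))) = 0]; split => //.
      apply: (gaussian_multilinear_null ipP gg ng Bl) => //; last by exists y.
      by move=> y' i; exact: multilinear_slot_bound BC y' i.
    move=> z /= mz; rewrite /L -(mE _ _ A1) -(mE _ _ A2) mz subrr.
    exact: linear_for0 Tl.
  apply: negligible_measurable0; last first.
    have [re0|] := eqVneq (scalar_re (L (fun i => psi (y i)))) 0; last first.
      by apply: nullT; [exact: scalar_re_linear|exact: scalar_re_le_norm].
    have [im0|] := eqVneq (scalar_im (L (fun i => psi (y i)))) 0; last first.
      by apply: nullT; [exact: scalar_im_linear|exact: scalar_im_le_norm].
    exfalso; move/eqP: Ly; apply.
    by apply/scalar_eqP; rewrite re0 im0; case: (k).
  have mT (T : real_scalar R k -> R) : linear T -> (forall u, `|T u| <= 1 * `|u|) ->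
      measurable [set t | T (m a1 t) = T (m a2 t)].
    move=> Tl T1.
    have := measurable_funB (mmT _ _ A1 Tl T1) (mmT _ _ A2 Tl T1).
    move=> /(_ measurableT [set 0] (measurable_set1 _)); rewrite setTI.
    congr measurable; apply/seteqP; split => t /=; last by move=> ->; rewrite subrr.
    by move=> /eqP; rewrite subr_eq0 => /eqP.
  rewrite (_ : [set z | _] = [set t | scalar_re (m a1 t) = scalar_re (m a2 t)] `&`
      [set t | scalar_im (m a1 t) = scalar_im (m a2 t)]).
    apply: measurableI; apply: mT.
    - exact: scalar_re_linear.
    - exact: scalar_re_le_norm.
    - exact: scalar_im_linear.
    - exact: scalar_im_le_norm.
  by apply/seteqP; split => t /=; [move=> ->|move=> ?; apply/scalar_eqP].
- move=> z n phi t At phia.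
  have Fphi := real_analytic_comp Fa phia At.
  pose x i : H := psi (tnth z i).
  have P0 : 0 <= \prod_i `|x i : realify H| by rewrite prodr_ge0.
  have evb (f : mform H r) : `|f x : real_scalar R k| <= \prod_i `|x i : realify H| * `|f|.
    by rewrite mulrC; exact: mform_bound.
  have /analytic_at_scalar[rea ima] := analytic_at_linear P0 (mform_eval_linear x) evb Fphi.
  (* The formula for [m] holds only on [A]; openness of [A] makes it valid near [t], as analyticity
     at [t] demands. *)
  have Anear : \forall u \near t, A (phi u).
    exact: (analytic_at_cont phia (open_nbhs_nbhs (conj oA At))).
  split; [apply: analytic_at_eq_near rea _|apply: analytic_at_eq_near ima _];
    by apply: filterS Anear => u Au; rewrite mE.
Qed.

(** * The theorem *)

Lemma sampling_generic (R : realType) (k : scalar_kind)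
    (X : completeNormedModType R) (A M : set X) (d : measure_display)
    (Zs : measurableType d) (nu : probability Zs R)
    (m : X -> Zs -> scalar_field R k) :
  open A -> sampling_architecture A M nu m -> generic_sampling A M nu m.
Proof.
move=> oA; case.
- move=> Z q atlas vol mu {}m _ atP Zc volP mv ma minj.
  exact: analytic_sampling_generic atP Zc volP mv ma minj.
- move=> H ipH Z ipZ r F psi gamma {}m _ _ ipP sZ _ _ Fa Finj psiC dpsi gg ng mE.
  exact: gaussian_sampling_generic oA ipP sZ Fa Finj psiC dpsi gg ng mE.
Qed.

(** * Coincidences between two parametrised pieces *)

Section coincidences.
Context {R : realType} {k : scalar_kind} {X : completeNormedModType R}.
Context {A M : set X} {d : measure_display} {Zs : measurableType d}.
Context {nu : probability Zs R} {m : X -> Zs -> scalar_field R k}.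
Hypotheses (oA : open A) (gm : generic_sampling A M nu m).

(** Discarding the diagonal and the parameters of points outside [A] leaves an open set [U], on
    which each [g t] is almost surely nonzero; [common_zeros_negligible] then applies in dimension
    [n]. *)
Lemma coincidences_negligible n N (V : set 'rV[R]_n) (phi psi : 'rV[R]_n -> X) :
  (n < N)%N -> open V ->
  (forall t, V t -> analytic_at phi t /\ analytic_at psi t) ->
  (forall t, V t -> M (phi t) /\ M (psi t)) ->
  (power_measure nu N).-negligible [set s | exists t,
     [/\ V t, A (phi t), A (psi t), phi t <> psi t &
         forall i, m (phi t) (tnth s i) = m (psi t) (tnth s i)]].
Proof.
move=> nN oV Va VM; have [mm m0 ma] := gm.
pose U := V `&` [set t | [/\ A (phi t), A (psi t) & phi t - psi t != 0]].
have UA t : U t -> A (phi t) /\ A (psi t) by move=> [_ []].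
have oU : open U.
  rewrite openE => t [Vt [At1 At2 t12]]; have [phia psia] := Va _ Vt.
  apply: filterI; first exact: open_nbhs_nbhs.
  have n1 : \forall u \near t, A (phi u).
    exact: (analytic_at_cont phia (open_nbhs_nbhs (conj oA At1))).
  have n2 : \forall u \near t, A (psi u).
    exact: (analytic_at_cont psia (open_nbhs_nbhs (conj oA At2))).
  have n3 : \forall u \near t, phi u - psi u != 0.
    exact: (cvgr_neq0 _ (analytic_at_cont (analytic_atB phia psia)) t12).
  by near=> u; split; [near: u|near: u|near: u].
pose re t z : R := scalar_re (m (phi t) z) - scalar_re (m (psi t) z).
pose im t z : R := scalar_im (m (phi t) z) - scalar_im (m (psi t) z).
pose g t z : R := re t z * re t z + im t z * im t z.
have g0 t z : g t z = 0 <-> m (phi t) z = m (psi t) z.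
  split=> [/eqP|mz]; last by rewrite /g /re /im mz !subrr mul0r addr0.
  rewrite /g paddr_eq0 -?expr2 ?sqr_ge0// !sqrf_eq0 !subr_eq0.
  by move=> /andP[/eqP ? /eqP ?]; apply/scalar_eqP.
apply: (@negligibleS _ _ _ _ (common_zeros N U g)).
  move=> s [t [Vt At1 At2 t12 ms]]; exists t; last by move=> i; apply/g0.
  by split => //; split => //; rewrite subr_eq0; apply/eqP.
apply: common_zeros_negligible => //.
- move=> z t Ut; have [At1 At2] := UA t Ut; have [phia psia] := Va t Ut.1.
  have [re1 im1] := ma z _ _ _ At1 phia; have [re2 im2] := ma z _ _ _ At2 psia.
  have rea := analytic_atB re1 re2; have ima := analytic_atB im1 im2.
  exact: analytic_atD (analytic_atM rea rea) (analytic_atM ima ima).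
- move=> t /UA[/mm[re1 im1] /mm[re2 im2]].
  have rem := measurable_funB re1 re2; have imm := measurable_funB im1 im2.
  exact: measurable_funD (measurable_funM rem rem) (measurable_funM imm imm).
- move=> t [Vt [At1 At2 t12]]; have [M1 M2] := VM t Vt.
  rewrite (_ : [set z | _] = [set z | m (phi t) z = m (psi t) z]).
    by apply: m0 => // t0; move: t12; rewrite t0 subrr eqxx.
  by apply/seteqP; split => z /g0.
Unshelve. all: by end_near. Qed.

End coincidences.

Lemma embedded_manifold_charts (R : realType) (X : normedModType R) (d : nat)
    (M : set X) : embedded_manifold d M -> @second_countable (set_type M) ->
  exists (I : Type) (D : set I) (V : I -> set 'rV[R]_d) (phi : I -> 'rV[R]_d -> X),
    [/\ countable D, forall i, open (V i),
        forall i t, V i t -> analytic_at (phi i) t /\ M (phi i t) &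
        forall a, M a -> exists i t, [/\ D i, V i t & phi i t = a]].
Proof.
move=> manM scM.
have /choice[V /choice[phi /choice[U UP]]] : forall a : set_type M,
    exists V (phi : 'rV[R]_d -> X) O, [/\ open V,
      forall t, V t -> analytic_at phi t /\ M (phi t), open O, O (set_val a) &
      forall x, O x -> M x -> exists2 t, V t & phi t = x].
  move=> a; have Ma : M (set_val a) by exact: set_valP.
  have [V [phi [W [Vo phia _ [Q oQ WE] [Wa [g [VW WV _ gK _]]]]]]] := manM _ Ma.
  exists V, phi, Q; split => //.
  - move=> t Vt; split; first exact: real_analytic_at phia Vt.
    by have := VW _ Vt; rewrite WE => -[].
  - by move: Wa; rewrite WE => -[].
  - move=> x Ox Mx; have Wx : W x by rewrite WE.
    by exists (g x); [exact: WV|apply: gK; rewrite inE].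
have [a _|D [cD _ TD]] := @second_countable_cover _ setT
    (fun a => set_val @^-1` U a) scM.
  have [_ _ oO Oa _] := UP a; apply: open_nbhs_nbhs; split => //.
  by exists (U a).
exists (set_type M), D, V, phi; split => //.
- by move=> a; have [] := UP a.
- by move=> a t; have [_ H _ _ _] := UP a; exact: H.
- move=> x Mx; have [a Da ax] := TD (exist _ x (mem_set Mx)) I.
  have [_ _ _ _ /(_ x ax Mx)[t Vt tx]] := UP a.
  by exists a, t.
Qed.

Theorem theorem2p2 (R : realType) (k : scalar_kind)
    (X : completeNormedModType R) (A : set X) (d : nat) (M : set X)
    (dZ : measure_display) (Zs : measurableType dZ) (nu : probability Zs R)
    (m : X -> Zs -> scalar_field R k) (N : nat)
    (dO : measure_display) (Omega : measurableType dO)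
    (P : probability Omega R) (z : 'I_N -> {RV P >-> Zs}) :
  open A ->
  embedded_manifold d M ->
  @second_countable (set_type M) ->
  sampling_architecture A M nu m ->
  (2 * d + 1 <= N)%N ->
  independent_samples nu z ->
  {ae P, forall w, forall a1 a2, (A `&` M) a1 -> (A `&` M) a2 ->
     (forall i, m a1 (z i w) = m a2 (z i w)) -> a1 = a2}.
Proof.
move=> oA manM scM /(sampling_generic oA) gm dN zi.
have [I [D [V [phi [cD oV Va Vcov]]]]] := embedded_manifold_charts manM scM.
have dN' : (d + d < N)%N by rewrite addnn -mul2n -[X in (X <= _)%N]addn1.
(* For a pair of charts, the two halves of a row of length [d + d] are the parameters of the two
   points. *)
pose E (p : I * I) : set (N.-tuple Zs) := [set s | exists t : 'rV[R]_(d + d),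
  [/\ (lsubmx @^-1` V p.1 `&` rsubmx @^-1` V p.2) t, A (phi p.1 (lsubmx t)),
      A (phi p.2 (rsubmx t)), phi p.1 (lsubmx t) <> phi p.2 (rsubmx t) &
      forall i, m (phi p.1 (lsubmx t)) (tnth s i) = m (phi p.2 (rsubmx t)) (tnth s i)]].
have la (t : 'rV[R]_(d + d)) : analytic_at (fun u : 'rV[R]_(d + d) => lsubmx u) t.
  apply: (analytic_at_linear (K := 1) _ _ _ (analytic_at_id t)) => //.
    by move=> a u v; apply/rowP => i; rewrite !mxE.
  by move=> u; rewrite mul1r; apply/rv_norm_leP => // i; rewrite mxE rv_coord_le.
have ra (t : 'rV[R]_(d + d)) : analytic_at (fun u : 'rV[R]_(d + d) => rsubmx u) t.
  apply: (analytic_at_linear (K := 1) _ _ _ (analytic_at_id t)) => //.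
    by move=> a u v; apply/rowP => i; rewrite !mxE.
  by move=> u; rewrite mul1r; apply/rv_norm_leP => // i; rewrite mxE rv_coord_le.
have EN p : (power_measure nu N).-negligible (E p).
  apply: (coincidences_negligible oA gm) => //.
  - by apply: openI; apply: open_comp => // t _; apply: analytic_at_cont.
  - move=> t [V1 V2]; split.
      apply: (@analytic_at_comp _ _ _ _ (phi p.1) lsubmx); last exact: (Va _ _ V1).1.
      by move=> l; under eq_fun do rewrite mxE; exact: analytic_at_proj.
    apply: (@analytic_at_comp _ _ _ _ (phi p.2) rsubmx); last exact: (Va _ _ V2).1.
    by move=> l; under eq_fun do rewrite mxE; exact: analytic_at_proj.
  - by move=> t [V1 V2]; split; [exact: (Va _ _ V1).2|exact: (Va _ _ V2).2].
(* Any coincidence is seen in some pair of charts, and these pairs are countably many. *)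
apply: (@negligibleS _ _ _ _ (\bigcup_(p in D `*` D)
    [set w | E p [tuple z i w | i < N]])); last first.
  apply: negligible_countable; first exact: countableX.
  by move=> p _; exact: independent_samples_negligible zi (EN p).
move=> w /= nw; apply: contrapT => nE; apply: nw => a1 a2 [A1 M1] [A2 M2] mw.
apply: contrapT => a12; apply: nE.
have [i1 [t1 [D1 V1 ta1]]] := Vcov _ M1; have [i2 [t2 [D2 V2 ta2]]] := Vcov _ M2.
exists (i1, i2) => //; exists (row_mx t1 t2).
rewrite /= row_mxKl row_mxKr ta1 ta2; split => // i.
by rewrite tnth_mktuple.
Qed.
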